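(* Let $G$ be a unicyclic graph with a cycle of length $d$. Then: (a) The ideal $J$ has a quadratic Gröbner basis with respect to $<'$ if and only if $c(G)=1$ and $d\in\{3,4\}$. (b) If $c(G)=1$ and $d\in\{3,4\}$, then $\mathcal{R}(I_c(G))$ is Koszul.
   Context: Let $K$ be a field, let $G$ be a finite simple graph with vertex set $V(G)=[n]=\{1,\dots,n\}$ and edge set $E(G)=\{e_1,\dots,e_m\}$, and let $S=K[x_1,\dots,x_n]$. For each $i$, write $e_i=\{p,q\}$ and put $u_i=(x_1\cdots x_n)/(x_px_q)$. The complementary edge ideal of $G$ is $I_c(G)=(u_1,\dots,u_m)\subset S$, and its Rees algebra is $\mathcal{R}(I_c(G))=\bigoplus_{k\ge 0}I_c(G)^kt^k\subset S[t]$. Let $T=S[y_1,\dots,y_m]=K[x_1,\dots,x_n,y_1,\dots,y_m]$, let $\varphi:T\to\mathcal{R}(I_c(G))$ be the $S$-algebra homomorphism with $\varphi(y_i)=u_it$, and let $J=\ker\varphi$. All variables of $T$ have degree $1$; a Gröbner basis is quadratic if it consists of polynomials of degree $2$. $\mathcal{R}(I_c(G))\cong T/J$ is regarded as a standard graded $K$-algebra with $x_1,\dots,x_n,u_1t,\dots,u_mt$ in degree $1$; Koszulness is with respect to this grading. The number $c(G)$ is the number of connected components of $G$ having at least two vertices. A graph is unicyclic if it contains exactly one cycle. Let $G$ be unicyclic with unique cycle $C$ of length $d$. The vertices of $G$ are assumed to be labeled as follows: for each $1\le i\le n-d$, the vertex $i$ has degree at most $1$ in the induced subgraph $G_i$ of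 $G$ on the vertex set $\{i,i+1,\dots,n\}$ (when $G$ is connected this means that $i$ is a leaf of $G_i$), and the vertices of $C$ are $n-d+1,n-d+2,\dots,n$ with $\{i,i+1\}\in E(G)$ for $n-d+1\le i\le n-1$. With respect to such a labeling, $<'$ denotes the lexicographic order on $T$ induced by $x_1>\cdots>x_n>y_1>\cdots>y_m$. *)

(* Defs.v *)
From HB Require Import structures.
From mathcomp Require Import all_boot all_order all_algebra.
From mathcomp Require Export mpoly.
Set Implicit Arguments.
Unset Strict Implicit.
Unset Printing Implicit Defensive.
Import GRing.Theory.
Local Open Scope ring_scope.

Section Graphs.
Local Open Scope nat_scope.

(* The paper's vertex i is the ordinal of value i - 1. *)
Record sgraph (n : nat) := SGraph {
  adj :> rel 'I_n;
  adj_sym : ssrbool.symmetric adj;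
  adj_irr : irreflexive adj }.

Variables (n : nat) (G : sgraph n).

Definition edge_set : {set {set 'I_n}} :=
  [set [set p.1; p.2] | p : 'I_n * 'I_n & G p.1 p.2].

Definition cycle_edges (c : seq 'I_n) : {set {set 'I_n}} :=
  [set [set x; next c x] | x in c].

(* Cycles are subgraphs, represented by their edge sets, so that rotations
   and reversals of a vertex sequence count as the same cycle.  The bound on
   [size c] excludes going back and forth along an edge. *)
Definition is_cycle (C : {set {set 'I_n}}) : Prop :=
  exists c : seq 'I_n, [/\ 2 < size c, ucycle G c & C = cycle_edges c].

Definition unicyclic (C : {set {set 'I_n}}) (d : nat) : Prop :=
  [/\ is_cycle C, forall C', is_cycle C' -> C' = C & #|C| = d].

Definition components : {set {set 'I_n}} :=
  equivalence_partition (connect G) [set: 'I_n].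

Definition nontrivial_components : nat := #|[set B in components | 1 < #|B|]|.

(* [#|[set j : 'I_n | i <= j & G i j]|] is the degree of i in the subgraph
   induced on the vertices that are at least i. *)
Definition well_labeled (C : {set {set 'I_n}}) (d : nat) : Prop :=
  [/\ forall i : 'I_n, i < n - d -> #|[set j : 'I_n | i <= j & G i j]| <= 1,
      cover C = [set i : 'I_n | n - d <= i]
    & forall i j : 'I_n, n - d <= i -> j = i.+1 :> nat -> G i j].

End Graphs.

Section Ideals.
Variable A : comNzRingType.

Definition ideal_gen (P : A -> Prop) (f : A) : Prop :=
  exists s : seq (A * A),
    (forall g, g \in s -> P g.2) /\ f = \sum_(g <- s) g.1 * g.2.

Definition ideal_pow (I : A -> Prop) (k : nat) : A -> Prop :=
  ideal_gen (fun f => exists g : 'I_k -> A,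
    (forall i, I (g i)) /\ f = \prod_(i < k) g i).

Definition rees (I : A -> Prop) (f : {poly A}) : Prop :=
  forall k, ideal_pow I k f`_k.

End Ideals.

Section Koszul.
(* R is a subring of A, graded by the additive subgroups Rd 0, Rd 1, ... *)
Variables (A : comNzRingType) (R : A -> Prop) (Rd : nat -> A -> Prop).

Definition mx_over (p q : nat) (M : 'M[A]_(p, q)) : Prop :=
  forall i j, R (M i j).

Definition irrelevant_ideal (f : A) : Prop :=
  exists s : seq A,
    (forall g, g \in s -> exists2 d, (0 < d)%N & Rd d g) /\ f = \sum_(g <- s) g.

(* The residue field R / R_+ has a linear free resolution over R,
     ... -> R(-2)^(b 2) -> R(-1)^(b 1) -> R -> R / R_+ -> 0,
   where the i-th differential is right multiplication of row vectors over R
   by the matrix D i, whose entries have degree 1.  The third clause says that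
   the image of D 0 is R_+, the last one that the kernel of each differential
   is the image of the next. *)
Definition koszul : Prop :=
  exists (b : nat -> nat) (D : forall i, 'M[A]_(b i.+1, b i)),
    [/\ b 0%N = 1%N,
        forall i j k, Rd 1%N (D i j k),
        forall v : 'rV[A]_(b 0%N), mx_over v ->
          ((exists2 w : 'rV[A]_(b 1%N), mx_over w & v = w *m D 0%N)
           <-> forall j, irrelevant_ideal (v ord0 j))
      & forall i (v : 'rV[A]_(b i.+1)), mx_over v ->
          (v *m D i = 0
           <-> exists2 w : 'rV[A]_(b i.+2), mx_over w & v = w *m D i.+1)].

End Koszul.

Section Groebner.
Variables (K : fieldType) (N : nat).
Implicit Types (a b : 'X_{1..N}) (f g : {mpoly K[N]}) (I : {mpoly K[N]} -> Prop).

(* The order built into mpoly compares total degrees first; this is the pure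
   lexicographic order, with the variable of index 0 the largest. *)
Definition lex_lt a b : bool :=
  [exists i : 'I_N, (a i < b i)%N &&
     [forall j : 'I_N, (j < i)%N ==> (a j == b j)]].

Definition is_lex_lead f a : Prop :=
  a \in msupp f /\ (forall b, b \in msupp f -> b != a -> lex_lt b a).

Definition initial_ideal I : {mpoly K[N]} -> Prop :=
  ideal_gen (fun g => exists f a, [/\ I f, is_lex_lead f a & g = 'X_[a]]).

Definition groebner_basis I (gs : seq {mpoly K[N]}) : Prop :=
  (forall g, g \in gs -> I g) /\
  (forall f, initial_ideal (fun g => g \in gs) f <-> initial_ideal I f).

(* [msize g] is 1 plus the total degree of a nonzero g. *)
Definition has_quadratic_groebner_basis I : Prop :=
  exists gs : seq {mpoly K[N]},
    groebner_basis I gs /\ (forall g, g \in gs -> msize g = 3%N).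

End Groebner.

Section ComplementaryEdgeIdeal.
Variables (K : fieldType) (n m : nat) (E : m.-tuple {set 'I_n}).

Definition edge_gen (k : 'I_m) : {mpoly K[n]} :=
  \prod_(j : 'I_n | j \notin tnth E k) 'X_j.

Definition comp_edge_ideal : {mpoly K[n]} -> Prop :=
  ideal_gen (fun f => exists k, f = edge_gen k).

Definition rees_comp_edge : {poly {mpoly K[n]}} -> Prop :=
  rees comp_edge_ideal.

(* T is {mpoly K[n + m]}, whose first n variables are the x_i and whose last m
   variables are the y_k; the variable t of S[t] is the 'X of {poly S}. *)
Definition phi_var (i : 'I_(n + m)) : {poly {mpoly K[n]}} :=
  match split i with
  | inl j => ('X_j)%:P
  | inr k => (edge_gen k)%:P * 'X
  end.

Definition phi (p : {mpoly K[n + m]}) : {poly {mpoly K[n]}} :=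
  mmap (fun c : K => (c%:MP_[n])%:P) phi_var p.

Definition rees_ker (p : {mpoly K[n + m]}) : Prop := phi p = 0.

(* The grading of the Rees algebra in which the x_i and the u_k t have
   degree 1. *)
Definition rees_deg (d : nat) (f : {poly {mpoly K[n]}}) : Prop :=
  exists2 p : {mpoly K[n + m]}, p \is d.-homog & f = phi p.

End ComplementaryEdgeIdeal.

(* Main.v *)
From HB Require Import structures.
Require Import Defs.
From mathcomp Require Import all_boot all_order all_algebra.
From mathcomp Require Import mpoly.
From mathcomp Require Import ring zify.
From Stdlib Require Import Classical ClassicalEpsilon.

(** phi maps each variable, hence each monomial, to a monomial of S[t], so the
    Rees algebra is the semigroup ring of a finitely generated monoid of
    weights: x_v has weight e_v, and y_k has weight tau - e_p - e_q for the k-th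
    edge {p, q}. Both parts of the theorem are statements on this monoid.

    Groebner bases. The initial ideal of the kernel J is spanned by the
    monomials that are not the smallest ones of their fibre under the weight
    map. So J has a quadratic Groebner basis if and only if every nonminimal
    monomial has a nonminimal divisor of degree two
    ([quadratic_groebner_basisP]). Quadratic fibres with more than one element
    come from exchanges x_v y_vw = x_v' y_v'w at a vertex w and from the two
    perfect matchings of a four-cycle ([nonminimal_quadric]).
    For the necessity, the cubics x_p x_q y_pq all have the same weight, and
    exchanges never lead from one component to another ([edges_connected]); if
    the cycle has length at least five, walking around it yields a nonminimal
    monomial of degree at least three all of whose quadratic divisors are
    minimal ([odd_cycle_false], [even_cycle_false]).
    For the sufficiency, let a be a monomial without nonminimal quadratic
    divisors and b a smaller one of the same weight. Going through the vertices
    in the order of their labels, the exchange at the neighbour of a leaf shows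
    that a and b have the same exponents at the leaf ([agree_step]). In the end
    a and b differ only on the cycle, and for a triangle or a four-cycle the
    remaining quadrics exclude this.

    Koszulness. It suffices to have a Koszul filtration, that is, a family of
    ideals generated by linear forms, containing the irrelevant ideal and closed
    under the colon ideals of the generators by each other: generators with
    linear quotients in such a family have linear syzygies with the same
    property ([syzygies_linear_quotients], [koszul_of_filtration]). A connected
    unicyclic graph is obtained from its cycle by attaching leaves, up to
    isolated vertices. Attaching a leaf p at q replaces the algebra R by
    R[a, b] / (ab - c), where a = x_p, b = y_pq and c = x_r y_qr for another
    neighbour r of q, and filtrations extend to this ring ([filtered_leaf]).
    For the triangle and the four-cycle, membership in a monomial ideal depends
    only on the set of facets of the monoid that contain the given element, and
    a filtration is given by a finite table ([filtered_saturated]). *)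

Set Implicit Arguments.
Unset Strict Implicit.
Unset Printing Implicit Defensive.
Import Order.TTheory GRing.Theory Num.Theory.
Local Open Scope ring_scope.

(** * Linear quotients and linear resolutions *)

Section LinearQuotients.

Variables (A : comNzRingType) (R : A -> Prop) (Rd : nat -> A -> Prop).
Hypotheses (R0 : R 0) (R1 : R 1) (RD : forall a b, R a -> R b -> R (a + b)).
Hypotheses (RN : forall a, R a -> R (- a)).
Hypotheses (RM : forall a b, R a -> R b -> R (a * b)).
Hypothesis Rd1R : forall a, Rd 1 a -> R a.

Lemma R_sum (I : Type) (r : seq I) (P : pred I) (F : I -> A) :
  (forall i, P i -> R (F i)) -> R (\sum_(i <- r | P i) F i).
Proof. by move=> RF; elim/big_ind: _. Qed.

(** Coefficients are indexed by all naturals rather than by the positions of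
    [s], so that appending a generator keeps their type. *)
Definition span (V : lmodType A) (s : seq V) (v : V) : Prop :=
  exists c : nat -> A, (forall i, R (c i)) /\ v = \sum_(i < size s) c i *: s`_i.

Lemma span_nil (V : lmodType A) (v : V) : span [::] v <-> v = 0.
Proof.
split=> [[c [_ ->]]|->]; first by rewrite big_ord0.
by exists (fun=> 0); rewrite big_ord0.
Qed.

Lemma span_rcons (V : lmodType A) (s : seq V) t v :
  span (rcons s t) v <-> exists2 a, R a & span s (v - a *: t).
Proof.
split=> [[c [Rc ->]]|[a Ra [c [Rc /eqP]]]].
  exists (c (size s)) => //; exists c; split=> //.
  rewrite size_rcons big_ord_recr /= nth_rcons ltnn eqxx addrK.
  by apply: eq_bigr => i _; rewrite nth_rcons ltn_ord.
rewrite subr_eq => /eqP->.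
exists (fun i => if i == size s then a else c i); split=> [i|].
  by case: ifP.
rewrite size_rcons big_ord_recr /= nth_rcons ltnn !eqxx; congr (_ + _).
by apply: eq_bigr => i _; rewrite nth_rcons ltn_ord ltn_eqF.
Qed.

Lemma span0 (V : lmodType A) (s : seq V) : span s 0.
Proof.
by exists (fun=> 0); split=> //; rewrite big1 // => i _; rewrite scale0r.
Qed.

Lemma spanD (V : lmodType A) (s : seq V) u v :
  span s u -> span s v -> span s (u + v).
Proof.
move=> [c [Rc ->]] [e [Re ->]]; exists (fun i => c i + e i).
split=> [i|]; first exact: RD.
by rewrite -big_split; apply: eq_bigr => i _; rewrite scalerDl.
Qed.

Lemma spanZ (V : lmodType A) (s : seq V) a v :
  R a -> span s v -> span s (a *: v).
Proof.
move=> Ra [c [Rc ->]]; exists (fun i => a * c i).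
split=> [i|]; first exact: RM.
by rewrite scaler_sumr; apply: eq_bigr => i _; rewrite scalerA.
Qed.

Lemma span_nth (V : lmodType A) (s : seq V) i : (i < size s)%N -> span s s`_i.
Proof.
move=> lt_i; exists (fun j => (j == i)%:R); split=> [j|].
  by case: (j == i).
rewrite (bigD1 (Ordinal lt_i)) //= eqxx scale1r big1 ?addr0 // => j.
by rewrite -val_eqE /= => /negPf->; rewrite scale0r.
Qed.

Lemma span_row (q : nat) (s : seq 'rV[A]_q) v :
  span s v <->
  exists2 w : 'rV[A]_(size s), mx_over R w & v = \sum_i w 0 i *: s`_i.
Proof.
split=> [[c [Rc ->]]|[w Rw ->]].
  exists (\row_i c i) => [i j|]; first by rewrite mxE.
  by apply: eq_bigr => i _; rewrite mxE.
exists (fun i => if insub i is Some j then w 0 j else 0); split=> [i|].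
  by case: insub => [j|].
by apply: eq_bigr => i _; rewrite valK.
Qed.

Definition ideal_span (s : seq A) (a : A) : Prop := @span A^o s a.

Variable F : seq A -> Prop.

(** The Koszul filtrations of Conca, Trung and Valla, each ideal being
    presented by the sequence of linear forms that displays its linear
    quotients. *)
Definition koszul_filtration : Prop :=
  forall L, F L -> forall k, (k < size L)%N ->
  exists2 L', F L' &
    forall w, R w -> ideal_span (take k L) (w * L`_k) <-> ideal_span L' w.

Definition linear_quotients (V : lmodType A) (s : seq V) : Prop :=
  forall k, (k < size s)%N ->
  exists2 L', F L' &
    forall w, R w -> span (take k s) (w *: s`_k) <-> ideal_span L' w.

Hypothesis F_lin : forall L, F L -> forall l, l \in L -> Rd 1 l.
Hypothesis F_filt : koszul_filtration.

Variables (deg1 deg2 : A -> A).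
Hypothesis deg1_Rd : forall a, R a -> Rd 1 (deg1 a).
Hypothesis deg2D : {morph deg2 : a b / a + b}.
Hypothesis deg2_deg1 : forall a l, R a -> Rd 1 l -> deg2 (a * l) = deg1 a * l.
Hypothesis deg2_id : forall l l', Rd 1 l -> Rd 1 l' -> deg2 (l * l') = l * l'.

Let deg20 : deg2 0 = 0.
Proof. by apply: (addIr (deg2 0)); rewrite -deg2D !add0r. Qed.

Definition linear_row (q : nat) (v : 'rV[A]_q) := forall j, Rd 1 (v 0 j).

(** A linear multiple of a linear vector that is an R-combination of linear
    vectors is one with linear coefficients: the components of degree two of
    both sides agree, and they only see the linear part of each coefficient. *)
Lemma linear_coefs (q : nat) (s : seq 'rV[A]_q) (r : 'rV[A]_q) l :
  (forall v, v \in s -> linear_row v) -> linear_row r -> Rd 1 l ->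
  span s (l *: r) ->
  exists c : nat -> A,
    (forall i, Rd 1 (c i)) /\ l *: r = \sum_(i < size s) c i *: s`_i.
Proof.
move=> lin_s lin_r Rl [c [Rc Dlr]]; exists (deg1 \o c).
split=> [i|]; first exact/deg1_Rd.
apply/rowP=> j; move/rowP/(_ j)/(congr1 deg2): Dlr.
rewrite mxE (deg2_id Rl (lin_r j)) !summxE => ->.
rewrite (big_morph deg2 deg2D deg20); apply: eq_bigr => i _.
by rewrite !mxE deg2_deg1 //; apply: lin_s; rewrite mem_nth.
Qed.

Hypothesis Rd1_0 : Rd 1 0.
Hypothesis Rd1_N : forall a, Rd 1 a -> Rd 1 (- a).

Section Syzygies.

Variables (q : nat) (s : seq 'rV[A]_q).
Hypotheses (lin_s : forall v, v \in s -> linear_row v).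
Hypothesis lq_s : linear_quotients s.
Let p := size s.

(** These filter the syzygy module, whose generators are found by increasing
    [j]. *)
Definition syzygy (j : nat) (v : 'rV[A]_p) : Prop :=
  [/\ mx_over R v, forall i : 'I_p, (j <= i)%N -> v 0 i = 0
    & \sum_i v 0 i *: s`_i = 0].

Lemma syzygyD j u v : syzygy j u -> syzygy j v -> syzygy j (u + v).
Proof.
move=> [Ru u0 su] [Rv v0 sv]; split=> [i i'|i le_ji|].
- by rewrite mxE; apply: RD.
- by rewrite mxE u0 ?v0 ?addr0.
under eq_bigr do rewrite mxE scalerDl.
by rewrite big_split /= su sv addr0.
Qed.

Lemma syzygyZ j a v : R a -> syzygy j v -> syzygy j (a *: v).
Proof.
move=> Ra [Rv v0 sv]; split=> [i i'|i /v0 vi|].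
- by rewrite mxE; apply: RM.
- by rewrite mxE vi mulr0.
under eq_bigr do rewrite mxE -scalerA.
by rewrite -scaler_sumr sv scaler0.
Qed.

(** The invariant that is handed from the rows of one differential to the
    rows of the next. *)
Definition good_rows (P : 'rV[A]_p -> Prop) (T : seq 'rV[A]_p) : Prop :=
  [/\ forall t, t \in T -> linear_row t, linear_quotients T
    & forall v, span T v <-> P v].

Lemma eq_good_rows P Q T : (forall v, P v <-> Q v) ->
  good_rows P T -> good_rows Q T.
Proof.
by move=> PQ [lT qT sT]; split=> // v; rewrite -PQ.
Qed.

Lemma sum_prefix (j : 'I_p) (v : 'rV[A]_p) :
  (forall i : 'I_p, (j < i)%N -> v 0 i = 0) ->
  \sum_i v 0 i *: s`_i =
  \sum_(i < size (take j s)) v 0 (insubd j (i : nat)) *: (take j s)`_i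
    + v 0 j *: s`_j.
Proof.
move=> v0; rewrite (bigD1 j) //= addrC; congr (_ + _).
rewrite (bigID (fun i : 'I_p => (i < j)%N)) /= [X in _ + X]big1 ?addr0; last first.
  move=> i /andP[ne_ij]; rewrite -leqNgt leq_eqVlt => /orP[/eqP eq_ij|lt_ij].
    by case/eqP: ne_ij; apply: val_inj.
  by rewrite v0 ?scale0r.
have sz : size (take j s) = j by rewrite size_take ltn_ord.
rewrite sz -(big_mkord xpredT (fun i => v 0 (insubd j i) *: (take j s)`_i)).
rewrite (eq_bigl (fun i : 'I_p => (i < j)%N)) => [|i]; last first.
  by rewrite -val_eqE /= andbC; case: ltngtP.
rewrite (big_ord_narrow (ltnW (ltn_ord j))) /= big_mkord.
apply: eq_bigr => i _; rewrite nth_take //.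
congr (v 0 _ *: _); apply: val_inj; rewrite val_insubd /=.
by rewrite (ltn_trans (ltn_ord i)).
Qed.

(** The last nonzero entry of a syzygy multiplies its row into the span of
    the earlier rows. *)
Lemma syzygy_coef (j : 'I_p) L :
  (forall w, R w -> span (take j s) (w *: s`_j) <-> ideal_span L w) ->
  forall v, syzygy j.+1 v -> ideal_span L (v 0 j).
Proof.
move=> LP v [Rv v0 sv]; apply/LP=> //.
move: sv; rewrite (sum_prefix v0) => /eqP; rewrite addrC addr_eq0 => /eqP->.
rewrite -scaleN1r; apply: spanZ; first exact: RN.
by exists (fun i => v 0 (insubd j i)); split.
Qed.

(** The syzygies that end in position [j] end in the colon ideal of the j-th
    row, a member [L] of [F], and each form [l] of [L] is the last entry of a
    linear syzygy [t]. A multiple [w *: t] lies in the span of the syzygies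
    found before exactly when its last entry lies in the ideal of the earlier
    forms of [L]. So the colon ideal attached to [t] is a colon ideal of [L],
    and this is again in [F]. *)
Lemma syzygies_step (j : 'I_p) T :
  good_rows (syzygy j) T -> exists T', good_rows (syzygy j.+1) T'.
Proof.
move=> gT; have [L FL LP] := lq_s (ltn_ord j).
suff /(_ (size L) (leqnn _))[T' gT'] : forall k, (k <= size L)%N -> exists T',
    good_rows (fun v => syzygy j.+1 v /\ ideal_span (take k L) (v 0 j)) T'.
  exists T'; apply: eq_good_rows gT' => v; rewrite take_size.
  by split=> [[]|sv] //; split=> //; apply: syzygy_coef sv.
elim=> [|k IHk] lt_k.
  exists T; apply: eq_good_rows gT => v; rewrite take0 /ideal_span span_nil.
  split=> [[Rv v0 sv]|[[Rv v0 sv] vj]].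
    by split; [split=> // i /ltnW/v0 | apply: v0].
  by split=> // i; rewrite leq_eqVlt => /orP[/eqP/val_inj<-|/v0].
have [T' [linT lqT spanT]] := IHk (ltnW lt_k).
set l := L`_k; have Rl : Rd 1 l by apply: (F_lin FL); rewrite mem_nth.
have [c [c_lin Dc]] : exists c : nat -> A, (forall i, Rd 1 (c i)) /\
    l *: s`_j = \sum_(i < size (take j s)) c i *: (take j s)`_i.
  apply: linear_coefs => // [v /mem_take/lin_s //||].
    by apply/lin_s/mem_nth.
  apply/LP; first exact: Rd1R.
  exact: span_nth.
(* the relation [l *: s`_j = \sum_i c i *: s`_i], written as a syzygy *)
pose t : 'rV[A]_p := \row_i (if (i < j)%N then - c i
                             else if i == j then l else 0).
have tj : t 0 j = l by rewrite mxE ltnn eqxx.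
have lin_t : linear_row t.
  move=> i; rewrite mxE; case: ifP => _; first exact: Rd1_N.
  by case: ifP.
have syz_t : syzygy j.+1 t.
  have t0 (i : 'I_p) : (j < i)%N -> t 0 i = 0.
    move=> lt_ji; rewrite mxE ltnNge (ltnW lt_ji) /=.
    by rewrite -val_eqE /= gtn_eqF.
  split=> // [i i'|]; first by rewrite (ord1 i); apply/Rd1R/lin_t.
  rewrite (sum_prefix t0) tj Dc -big_split big1 //= => i _.
  have lt_ij : (i < j)%N.
    by apply: leq_trans (ltn_ord i) _; rewrite size_take ltn_ord.
  rewrite mxE val_insubd (ltn_trans lt_ij) // lt_ij.
  by rewrite scaleNr addNr.
exists (rcons T' t); split.
- by move=> u; rewrite mem_rcons inE => /orP[/eqP->|/linT].
- move=> i; rewrite size_rcons ltnS leq_eqVlt => /orP[/eqP->|lt_i]; last first.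
    have [L' FL' L'P] := lqT i lt_i; exists L' => // w Rw.
    by rewrite -cats1 takel_cat 1?ltnW // nth_cat lt_i L'P.
  have [L' FL' L'P] := F_filt FL lt_k; exists L' => // w Rw.
  rewrite -cats1 take_size_cat // nth_cat ltnn subnn /= spanT -L'P // mxE tj.
  by split=> [[]|] //; split=> //; apply: syzygyZ.
move=> v; rewrite span_rcons (take_nth 0) // /ideal_span.
split=> [[a Ra /spanT[syz_v idv]]|[syz_v /span_rcons[a Ra idv]]].
  split; last by apply/span_rcons; exists a => //; rewrite !mxE ltnn eqxx in idv.
  by rewrite -(subrK (a *: t) v); apply: syzygyD => //; apply: syzygyZ.
exists a => //; apply/spanT; split; last by rewrite !mxE ltnn eqxx.
by rewrite -scaleNr; apply: syzygyD => //; apply: syzygyZ => //; apply: RN.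
Qed.

Lemma syzygies_linear_quotients : exists T, good_rows
  (fun v => mx_over R v /\ \sum_i v 0 i *: s`_i = 0) T.
Proof.
suff /(_ p (leqnn p))[T gT] :
    forall j, (j <= p)%N -> exists T, good_rows (syzygy j) T.
  exists T; apply: eq_good_rows gT => v; split=> [[]//|[Rv sv]]; split=> // i.
  by rewrite leqNgt ltn_ord.
elim=> [|j IHj] lt_j; last first.
  by have [T] := IHj (ltnW lt_j); apply: (@syzygies_step (Ordinal lt_j)).
exists [::]; split=> // v; rewrite span_nil.
split=> [->|[_ v0 _]]; last by apply/rowP=> i; rewrite v0 ?mxE.
split=> [i i'|i _|]; rewrite ?mxE //.
by rewrite big1 // => i _; rewrite mxE scale0r.
Qed.

End Syzygies.

Definition row_list := {q : nat & seq 'rV[A]_q}.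

(** The width of the next list is, by computation, the length of the present
    one, so that consecutive differentials compose without casts. *)
Definition next_rows (s : row_list) : row_list :=
  existT _ (size (tagged s))
    (epsilon (inhabits [::]) (good_rows (s := tagged s)
      (fun v => mx_over R v /\ \sum_i v 0 i *: (tagged s)`_i = 0))).

Lemma span_const_mx (s : seq A) (v : 'rV[A]_1) :
  span [seq const_mx l | l <- s] v <-> ideal_span s (v 0 0).
Proof.
have Dv (c : nat -> A) (u : 'rV[A]_1) : u = \sum_(i < size s) c i *: const_mx s`_i
    <-> u 0 0 = \sum_(i < size s) c i * s`_i.
  split=> [->|Du].
    by rewrite summxE; apply: eq_bigr => i _; rewrite !mxE.
  apply/rowP=> i; rewrite (ord1 i) Du summxE.
  by apply: eq_bigr => k _; rewrite !mxE.
have Ds (c : nat -> A) : \sum_(i < size s) c i *: const_mx s`_i =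
    \sum_(i < size [seq const_mx l : 'rV[A]_1 | l <- s])
      c i *: [seq const_mx l : 'rV[A]_1 | l <- s]`_i.
  by rewrite size_map; apply: eq_bigr => i _; rewrite (nth_map 0).
split=> -[c [Rc vP]]; exists c; split=> //; first by apply/(Dv c v); rewrite Ds.
by rewrite -Ds; apply/(Dv c v).
Qed.

(** Linear quotients with colon ideals in [F] pass from the rows of a matrix
    to generators of its syzygies, so the construction starting with the
    generators of the irrelevant ideal never stops and yields a linear free
    resolution. *)
Lemma koszul_of_filtration L :
  F L ->
  (forall a, R a -> (irrelevant_ideal Rd a <-> ideal_span L a)) ->
  koszul R Rd.
Proof.
move=> FL LP; pose s0 : row_list := existT _ 1%N [seq const_mx l | l <- L].
pose st i := iter i next_rows s0.
have lq_st i : (forall v, v \in tagged (st i) -> linear_row v) /\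
    linear_quotients (tagged (st i)).
  elim: i => [|i [lin_i lq_i]] /=; last first.
    by have [] := epsilon_spec (inhabits [::])
      _ (syzygies_linear_quotients lin_i lq_i).
  split=> [v /mapP[l /(F_lin FL) Rl ->] j|k]; first by rewrite mxE.
  rewrite size_map => lt_k; have [L' FL' L'P] := F_filt FL lt_k.
  exists L' => // w Rw; rewrite -map_take span_const_mx -L'P //.
  by rewrite (nth_map 0) // !mxE.
have ker_st i (v : 'rV_(size (tagged (st i)))) : span (tagged (st i.+1)) v <->
    mx_over R v /\ \sum_k v 0 k *: (tagged (st i))`_k = 0.
  have [lin_i lq_i] := lq_st i.
  by have [] := epsilon_spec (inhabits [::])
      _ (syzygies_linear_quotients lin_i lq_i).
pose b i := tag (st i).
pose D i : 'M[A]_(b i.+1, b i) := \matrix_j (tagged (st i))`_j.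
have mulD i (v : 'rV[A]_(b i.+1)) :
    v *m D i = \sum_j v 0 j *: (tagged (st i))`_j.
  by rewrite mulmx_sum_row; apply: eq_bigr => j _; rewrite rowK.
exists b, D; split=> // [i j k|v Rv|i v Rv].
- by rewrite mxE; apply: (lq_st i).1; rewrite mem_nth.
- split=> [[w Rw ->] j|irr_v].
    rewrite (ord1 j); apply/LP; last first.
      by apply/span_const_mx/span_row; exists w => //; exact: (mulD 0%N w).
    rewrite mxE; apply: R_sum => k _; apply: RM => //.
    by rewrite mxE; apply/Rd1R/(lq_st 0%N).1; rewrite mem_nth.
  have /span_const_mx/span_row[w Rw ->] := (LP _ (Rv 0 0)).1 (irr_v 0).
  by exists w => //; rewrite mulD.
rewrite mulD; split=> [sv|[w Rw Dv]].
  have /span_row[w Rw ->] := (ker_st i v).2 (conj Rv sv).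
  by exists w => //; rewrite mulD.
by case: ((ker_st i v).1 _) => //; apply/span_row; exists w => //; rewrite Dv mulD.
Qed.

End LinearQuotients.

(** * Monomial ideals in affine monoids *)

Section AffineMonoids.

Variables (I : finType) (V : zmodType) (gen : I -> V).
Implicit Types (X Y : {set I}) (L : seq I) (v w : V).

(** [X] selects the generators in use; all monoids live in the same group. *)
Definition in_monoid X w : Prop :=
  exists2 c : I -> nat, forall i, i \notin X -> c i = 0%N
    & w = \sum_i gen i *+ c i.

Definition in_ideal X L w : Prop := exists2 i, i \in L & in_monoid X (w - gen i).

(** In the semigroup ring of [X]: the colon ideal of the monomial ideal of
    [L1] by the generator [l] is the monomial ideal of [L']. *)
Definition colon X L1 l L' : Prop :=
  forall w, in_monoid X w -> in_ideal X L1 (w + gen l) <-> in_ideal X L' w.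

Definition filtration X (F : seq I -> Prop) : Prop :=
  forall L, F L -> {subset L <= X} /\
    forall L1 l L2, L = L1 ++ l :: L2 -> exists2 L', F L' & colon X L1 l L'.

(** A Koszul filtration of the semigroup ring whose ideals are generated by
    variables and which contains the maximal ideal. *)
Definition filtered X : Prop :=
  exists2 F, filtration X F & exists2 M, F M & M =i X.

Lemma in_monoid0 X : in_monoid X 0.
Proof. by exists (fun=> 0%N) => //; rewrite big1. Qed.

Lemma in_monoidD X v w : in_monoid X v -> in_monoid X w -> in_monoid X (v + w).
Proof.
move=> [c c0 ->] [e e0 ->]; exists (fun i => (c i + e i)%N) => [i Xi|].
  by rewrite c0 ?e0.
by rewrite -big_split; apply: eq_bigr => i _; rewrite mulrnDr.
Qed.

Lemma in_monoidMn X v k : in_monoid X v -> in_monoid X (v *+ k).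
Proof.
by move=> Xv; elim: k => [|k IHk]; [apply: in_monoid0 | rewrite mulrS; apply: in_monoidD].
Qed.

Lemma in_monoid_gen X i : i \in X -> in_monoid X (gen i).
Proof.
move=> Xi; exists (fun j => j == i : nat) => [j|].
  by case: eqP => [->|//]; rewrite Xi.
by rewrite (bigD1 i) //= eqxx big1 ?addr0 // => j /negPf->.
Qed.

Lemma in_monoidS X Y w : X \subset Y -> in_monoid X w -> in_monoid Y w.
Proof.
move=> /subsetP sXY [c c0 Dw]; exists c => // i Yi; apply: c0.
by apply: contra Yi; apply: sXY.
Qed.

Lemma in_monoid1U X a w :
  in_monoid (a |: X) w -> exists i, in_monoid X (w - gen a *+ i).
Proof.
move=> [c c0 ->].
exists (if a \in X then 0 else c a)%N.
exists (fun i => if i \in X then c i else 0)%N => [i /negPf->//|].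
apply/eqP; rewrite subr_eq; apply/eqP.
rewrite (bigD1 a) //= [in RHS](bigD1 a) //=.
rewrite (eq_bigr (fun i => gen i *+ (if i \in X then c i else 0))) => [|i ne_ia].
  by case: ifP; rewrite ?addr0 // mulr0n add0r addrC.
by case: ifPn => // /negPf nXi; rewrite c0 // !inE (negPf ne_ia) nXi.
Qed.

Lemma in_idealD X L v w : in_ideal X L v -> in_monoid X w -> in_ideal X L (v + w).
Proof.
by move=> [i Li Xv] Xw; exists i => //; rewrite addrAC; apply: in_monoidD.
Qed.

Lemma in_ideal_rcons X L a w :
  in_ideal X (rcons L a) w <-> in_ideal X L w \/ in_monoid X (w - gen a).
Proof.
split=> [[i]|[[i Li Xi]|Xa]].
- by rewrite mem_rcons inE => /orP[/eqP->|]; [right|left; exists i].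
- by exists i; rewrite // mem_rcons inE Li orbT.
- by exists a; rewrite // mem_rcons mem_head.
Qed.

Section Extensions.

Variables (X : {set I}) (lam : {additive V -> int}).
Hypothesis lamX : forall i, i \in X -> lam (gen i) = 0.

Lemma lam_in_monoid w : in_monoid X w -> lam w = 0.
Proof.
move=> [c c0 ->]; rewrite raddf_sum big1 // => i _; rewrite raddfMn.
by have [/lamX->|/c0->] := boolP (i \in X); rewrite ?mul0rn.
Qed.

(** Translation by [u] turns membership in an ideal of [X] into membership in
    its extension to [Y]. Together with [decomposes] below, this is how
    ideals behave when the semigroup ring of [Y] is free over that of [X],
    with a basis of monomials [u]. *)
Definition extends_ideals Y (u : V) : Prop :=
  forall L h, {subset L <= X} -> lam h = 0 ->
  in_ideal Y L (h + u) <-> in_ideal X L h.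

Lemma extends_idealsP Y u :
  (forall h, lam h = 0 -> in_monoid Y (h + u) <-> in_monoid X h) ->
  extends_ideals Y u.
Proof.
move=> XY L h sLX lam_h; have lamB l : l \in L -> lam (h - gen l) = 0.
  by move=> Ll; rewrite raddfB lam_h lamX ?sLX // subrr.
split=> -[l Ll]; first by rewrite addrAC => /(XY _ (lamB l Ll)); exists l.
by move/(XY _ (lamB l Ll)); exists l; rewrite // addrAC.
Qed.

Definition decomposes Y : Prop :=
  forall w, in_monoid Y w ->
  exists h u, [/\ w = h + u, in_monoid X h & extends_ideals Y u].

(** Colon ideals commute with free extensions, so a filtration of the smaller
    ring is kept by the larger one. *)
Lemma colon_extension Y F L1 l L2 : filtration X F -> decomposes Y ->
  F (L1 ++ l :: L2) -> exists2 L', F L' & colon Y L1 l L'.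
Proof.
move=> filtF decY FL; have [sLX /(_ _ _ _ erefl)[L' FL' L'P]] := filtF _ FL.
exists L' => // w /decY[h [u [-> Xh ext_u]]]; have lam_h := lam_in_monoid Xh.
have [sL'X _] := filtF _ FL'; rewrite addrAC !ext_u ?L'P //.
  by move=> i L1i; apply: sLX; rewrite mem_cat L1i.
by rewrite raddfD lam_h lamX // sLX // mem_cat mem_head orbT.
Qed.

Section FreeVariable.

Variable a : I.
Hypothesis lam_a : lam (gen a) = 1.
Let Y := a |: X.

Lemma in_monoid_free i h : lam h = 0 ->
  in_monoid Y (h + gen a *+ i) <-> in_monoid X h.
Proof.
move=> lam_h; split=> [/in_monoid1U[j Xhj]|Xh]; last first.
  apply: in_monoidD; first exact: in_monoidS (subsetUr _ _) Xh.
  by apply/in_monoidMn/in_monoid_gen; rewrite setU11.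
suff eq_ij : i = j by move: Xhj; rewrite eq_ij addrK.
have := lam_in_monoid Xhj; rewrite raddfB raddfD !raddfMn lam_h lam_a /= ?mulNrn !natz; lia.
Qed.

(** For a polynomial extension R[a] of R with maximal ideal M, the quotient
    by the extension of M is K[a], where [a] is regular. Hence M : a = M, and
    adding M + (a) to the filtration of R suffices. *)
Lemma filtered_free_variable : filtered X -> filtered Y.
Proof.
move=> [F filtF [M FM MX]].
have decY : decomposes Y.
  move=> w /in_monoid1U[i Xh]; exists (w - gen a *+ i), (gen a *+ i).
  by rewrite subrK; split=> //; apply/extends_idealsP/in_monoid_free.
exists (fun L => F L \/ L = rcons M a); last first.
  by exists (rcons M a); [right|move=> i; rewrite mem_rcons !inE MX].
have colonF L1 l L2 : F (L1 ++ l :: L2) ->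
    exists2 L', F L' \/ L' = rcons M a & colon Y L1 l L'.
  by case/(colon_extension filtF decY)=> L' FL' L'P; exists L'; first left.
move=> L [FL|->]; split.
- by move=> i /(proj1 (filtF _ FL)) Xi; rewrite !inE Xi orbT.
- by move=> L1 l L2 DL; apply: (colonF L1 l L2); rewrite -DL.
- by move=> i; rewrite mem_rcons !inE MX.
move=> L1 l L2; case/lastP: L2 => [|L2 l2]; last first.
  rewrite -rcons_cons -rcons_cat => /rcons_inj[DM _].
  by apply: (colonF L1 l L2); rewrite -DM.
rewrite cats1 => /rcons_inj[<- <-]; exists M; first by left.
have sMX : {subset M <= X} by move=> i; rewrite MX.
move=> w /in_monoid1U[i Xh]; have lam_h := lam_in_monoid Xh.
rewrite -(subrK (gen a *+ i) w) -addrA -mulrSr.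
by rewrite !(extends_idealsP (in_monoid_free _)).
Qed.

End FreeVariable.

End Extensions.

Section LeafNormalForm.

Variables (X : {set I}) (lam : {additive V -> int}) (a b : I).
Hypothesis lamX : forall i, i \in X -> lam (gen i) = 0.
Hypotheses (lam_a : lam (gen a) = 1) (lam_b : lam (gen b) = -1).
Variable M : seq I.
Hypothesis MX : M =i X.
Hypothesis Mab : in_ideal X M (gen a + gen b).
Let Y := a |: (b |: X).

Let Xab : in_monoid X (gen a + gen b).
Proof.
case: Mab => i Mi /in_monoidD/(_ (in_monoid_gen _)); rewrite MX in Mi.
by move/(_ _ Mi); rewrite subrK.
Qed.

Let sMX : {subset M <= X}. Proof. by move=> i; rewrite MX. Qed.

(** As [gen a + gen b] lies in the smaller monoid, common multiples of the
    two new generators can be cancelled. *)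
Lemma leaf_decomposition w : in_monoid Y w ->
  exists2 h, in_monoid X h & exists i, w = h + gen a *+ i \/ w = h + gen b *+ i.
Proof.
move=> /in_monoid1U[i /in_monoid1U[j Xh]]; set h := _ - _ in Xh.
have Dw : w = h + gen a *+ i + gen b *+ j by rewrite /h addrAC !subrK.
have [le_ij|/ltnW le_ji] := leqP i j.
  exists (h + (gen a + gen b) *+ i).
    by apply: in_monoidD => //; apply: in_monoidMn.
  by exists (j - i)%N; right; rewrite Dw -{1}(subnKC le_ij) mulrnDr mulrnDl !addrA.
exists (h + (gen a + gen b) *+ j).
  by apply: in_monoidD => //; apply: in_monoidMn.
exists (i - j)%N; left.
by rewrite Dw -{1}(subnKC le_ji) mulrnDr mulrnDl !addrA [LHS]addrAC.
Qed.

(** The functional [lam] reads off the exponent of the new generator, which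
    makes the decomposition unique. *)
Lemma leaf_monoid_a i h : lam h = 0 ->
  in_monoid Y (h + gen a *+ i) <-> in_monoid X h.
Proof.
move=> lam_h; split=> [/leaf_decomposition[h' Xh' [j Dh]]|Xh].
  have lam_h' := lam_in_monoid lamX Xh'.
  case: Dh => Dh; have := congr1 lam Dh;
    rewrite !raddfD !raddfMn lam_h lam_h' lam_a ?lam_b /= ?mulNrn ?natz => eq_ij.
    have {}eq_ij : i = j by lia.
    by move: Dh; rewrite eq_ij => /addIr->.
  have [i0 j0] : i = 0%N /\ j = 0%N by lia.
  by move: Dh; rewrite i0 j0 !mulr0n !addr0 => ->.
apply: in_monoidD; first by apply: in_monoidS Xh; rewrite /Y setUA subsetUr.
by apply/in_monoidMn/in_monoid_gen; rewrite setU11.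
Qed.

Lemma leaf_ideal_a i : extends_ideals X lam Y (gen a *+ i).
Proof. exact/extends_idealsP/leaf_monoid_a. Qed.

(** Cancelling [gen b] costs one more [gen a], and the sum of the two lies in
    the maximal ideal of the smaller monoid. *)
Lemma leaf_ideal_aB i h : in_monoid X h -> in_monoid Y (h + gen a *+ i - gen b) ->
  in_ideal X M h.
Proof.
move=> Xh /leaf_decomposition[h' Xh' [k Dh]].
have lam_h := lam_in_monoid lamX Xh; have lam_h' := lam_in_monoid lamX Xh'.
case: Dh => Dh; have := congr1 lam Dh; rewrite raddfB !raddfD !raddfMn;
  rewrite lam_h lam_h' lam_a lam_b /= ?mulNrn ?natz => Dk; last by lia.
have {}Dk : k = i.+1 by lia.
suff -> : h = gen a + gen b + h' by apply: in_idealD.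
apply: (addIr (gen a *+ i)); apply: (addIr (- gen b)); rewrite Dh Dk mulrS.
by rewrite [X in _ = X + _ + _]addrC !addrA [RHS]addrAC addrK.
Qed.

End LeafNormalForm.

Section Leaf.

Variables (X : {set I}) (lam : {additive V -> int}) (a b : I).
Hypothesis lamX : forall i, i \in X -> lam (gen i) = 0.
Hypotheses (lam_a : lam (gen a) = 1) (lam_b : lam (gen b) = -1).
Variable M : seq I.
Hypothesis MX : M =i X.
Hypothesis Mab : in_ideal X M (gen a + gen b).
Let Y := a |: (b |: X).

Let lamX' : forall i, i \in X -> (\- lam) (gen i) = 0.
Proof. by move=> i /lamX /= ->; rewrite oppr0. Qed.

Let lam_a' : (\- lam) (gen a) = -1. Proof. by rewrite /= lam_a. Qed.
Let lam_b' : (\- lam) (gen b) = 1. Proof. by rewrite /= lam_b opprK. Qed.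
Let Mba : in_ideal X M (gen b + gen a). Proof. by rewrite addrC. Qed.

Lemma leaf_ideal_b i : extends_ideals X lam Y (gen b *+ i).
Proof.
move=> L h sLX lam_h; rewrite /Y setUCA.
by apply: (leaf_ideal_a lamX' lam_b' lam_a' MX) => //=; rewrite lam_h oppr0.
Qed.

Lemma leaf_ideal_bB i h : in_monoid X h -> in_monoid Y (h + gen b *+ i - gen a) ->
  in_ideal X M h.
Proof.
move=> Xh; rewrite /Y setUCA.
exact: (leaf_ideal_aB lamX' lam_b' lam_a' MX).
Qed.

Let sMX : {subset M <= X}. Proof. by move=> i; rewrite MX. Qed.
Let leaf_a := leaf_ideal_a lamX lam_a lam_b MX Mab.

Lemma leaf_colon_a : colon Y M a (rcons M b).
Proof.
move=> w /(leaf_decomposition MX Mab)[h Xh [i Dw]].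
have lam_h := lam_in_monoid lamX Xh; rewrite in_ideal_rcons.
have caseA k : w = h + gen a *+ k ->
    in_ideal Y M (w + gen a) <-> in_ideal Y M w \/ in_monoid Y (w - gen b).
  move=> ->; rewrite -addrA -mulrSr !leaf_a //.
  split=> [|[//|]]; first by left.
  exact: (leaf_ideal_aB lamX lam_a lam_b MX Mab Xh).
case: Dw => Dw; first exact: caseA Dw.
case: i Dw => [Dw|i Dw]; first by apply: (caseA 0%N).
split=> _.
  right; rewrite Dw mulrSr addrA addrK; apply: in_monoidD.
    by apply: in_monoidS Xh; rewrite /Y setUA subsetUr.
  by apply/in_monoidMn/in_monoid_gen; rewrite !inE eqxx orbT.
have -> : w + gen a = h + (gen a + gen b) + gen b *+ i.
  by rewrite Dw mulrS !addrA [LHS]addrAC [X in X + _ = _]addrAC.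
apply/leaf_ideal_b => //; last by rewrite addrC; apply: in_idealD.
by rewrite !raddfD lam_h lam_a lam_b.
Qed.

Lemma leaf_colon_b : colon Y (rcons M a) b (rcons M a).
Proof.
move=> w /(leaf_decomposition MX Mab)[h Xh [i Dw]].
have lam_h := lam_in_monoid lamX Xh; rewrite !in_ideal_rcons.
have caseB k : w = h + gen b *+ k ->
    in_ideal Y M (w + gen b) \/ in_monoid Y (w + gen b - gen a) <->
    in_ideal Y M w \/ in_monoid Y (w - gen a).
  move=> ->; rewrite -addrA -mulrSr !leaf_ideal_b //.
  by split=> [] [|Yw]; left => //; apply: leaf_ideal_bB Yw.
case: Dw => Dw; last exact: caseB Dw.
case: i Dw => [Dw|i Dw]; first by apply: (caseB 0%N).
split=> _.
  right; rewrite Dw mulrSr addrA addrK; apply: in_monoidD.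
    by apply: in_monoidS Xh; rewrite /Y setUA subsetUr.
  by apply/in_monoidMn/in_monoid_gen; rewrite !inE eqxx.
left; have -> : w + gen b = h + (gen a + gen b) + gen a *+ i.
  by rewrite Dw mulrS !addrA [LHS]addrAC.
apply/leaf_a => //; last by rewrite addrC; apply: in_idealD.
by rewrite !raddfD lam_h lam_a lam_b.
Qed.

End Leaf.

(** Attaching a leaf replaces R by R' = R[a, b] / (ab - c) with c in the
    maximal ideal M of R. This R' is free over R, with basis the powers of a
    and of b, so the filtration of R extends. Modulo M it is K[a, b] / (ab),
    whence M : a = M + (b), M : b = M + (a) and (M + (a)) : b = M + (a), so
    that adding M + (a), M + (b) and M + (a, b) suffices. *)
Lemma filtered_leaf X (lam : {additive V -> int}) a b :
  (forall i, i \in X -> lam (gen i) = 0) ->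
  lam (gen a) = 1 -> lam (gen b) = -1 ->
  (exists2 i, i \in X & in_monoid X (gen a + gen b - gen i)) ->
  filtered X -> filtered (a |: (b |: X)).
Proof.
move=> lamX lam_a lam_b [i0 Xi0 Xab] [F filtF [M FM MX]].
set Y := a |: (b |: X).
have Mab : in_ideal X M (gen a + gen b) by exists i0; rewrite ?MX.
have lamX' i : i \in X -> (\- lam) (gen i) = 0.
  by move=> /lamX /= ->; rewrite oppr0.
have decY : decomposes X lam Y.
  move=> w /(leaf_decomposition MX Mab)[h Xh [i Dw]]; exists h.
  case: Dw => ->; [exists (gen a *+ i) | exists (gen b *+ i)]; split=> //.
    exact: (leaf_ideal_a lamX lam_a lam_b MX Mab).
  exact: (leaf_ideal_b lamX lam_a lam_b MX Mab).
have colonF L1 l L2 : F (L1 ++ l :: L2) -> exists2 L', F L' & colon Y L1 l L'.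
  exact: (colon_extension lamX filtF decY).
have sXY i : i \in X -> i \in Y by rewrite !inE => ->; rewrite !orbT.
pose F' L := [\/ F L, L = rcons M a, L = rcons M b | L = rcons (rcons M a) b].
have colonF' L1 l L2 : F (L1 ++ l :: L2) -> exists2 L', F' L' & colon Y L1 l L'.
  by case/colonF=> L'; exists L'; first constructor 1.
have colonMc c L' L1 l L2 : F' L' -> colon Y M c L' ->
    rcons M c = L1 ++ l :: L2 -> exists2 L', F' L' & colon Y L1 l L'.
  move=> F'L' cMc; case/lastP: L2 => [|L2 l2].
    by rewrite cats1 => /rcons_inj[<- <-]; exists L'.
  rewrite -rcons_cons -rcons_cat => /rcons_inj[DM _].
  by apply: (colonF' L1 l L2); rewrite -DM.
have colon_a : colon Y M a (rcons M b) by apply: (leaf_colon_a lamX lam_a lam_b MX Mab).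
have colon_b : colon Y M b (rcons M a).
  rewrite /Y setUCA; apply: (leaf_colon_a lamX' _ _ MX) => /=.
  - by rewrite lam_b opprK.
  - by rewrite lam_a.
  - by rewrite addrC.
exists F'; last first.
  exists (rcons (rcons M a) b); first by constructor 4.
  by move=> i; rewrite !(mem_rcons, inE) MX orbCA.
move=> L [FL|->|->|->]; split.
- by move=> i /(proj1 (filtF _ FL))/sXY.
- by move=> L1 l L2 DL; apply: (colonF' L1 l L2); rewrite -DL.
- by move=> i; rewrite mem_rcons inE MX !inE => /orP[->|->]; rewrite ?orbT.
- by move=> L1 l L2; apply: colonMc colon_a; constructor 3.
- by move=> i; rewrite mem_rcons inE MX !inE => /orP[->|->]; rewrite ?orbT.
- by move=> L1 l L2; apply: colonMc colon_b; constructor 2.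
- by move=> i; rewrite !(mem_rcons, inE) MX => /or3P[]->; rewrite ?orbT.
move=> L1 l L2; case/lastP: L2 => [|L2 l2].
  rewrite cats1 => /rcons_inj[<- <-]; exists (rcons M a); first by constructor 2.
  exact: (leaf_colon_b lamX lam_a lam_b MX Mab).
rewrite -rcons_cons -rcons_cat => /rcons_inj[DM _].
by apply: colonMc colon_a DM; constructor 3.
Qed.

End AffineMonoids.

(** * Weights of monomials *)

Section Weights.

Variables (K : fieldType) (n m : nat) (E : m.-tuple {set 'I_n}).

Local Notation S := {mpoly K[n]}.
Local Notation weight := ({ffun 'I_n -> int} * int)%type.
Local Notation phiE := (phi (K := K) E).

(** The exponent of phi of a variable, after subtracting the t-degree from
    the exponent of each x_v. In these coordinates x_v has weight e_v and y_k
    has weight tau - e_p - e_q, where {p, q} is the k-th edge. *)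
Definition gen (i : 'I_(n + m)) : weight :=
  match split i with
  | inl v => ([ffun u => (u == v : nat)%:Z], 0)
  | inr k => ([ffun u => - (u \in tnth E k : nat)%:Z], 1)
  end.

Definition wt (a : 'X_{1..n + m}) : weight := \sum_i gen i *+ a i.

Lemma wtD a b : wt (a + b)%MM = wt a + wt b.
Proof.
by rewrite -big_split; apply: eq_bigr => i _; rewrite mnmDE mulrnDr.
Qed.

Lemma wt1 i : wt U_(i)%MM = gen i.
Proof.
rewrite /wt (bigD1 i) //= mnm1E eqxx big1 ?addr0 // => j.
by rewrite mnm1E eq_sym => /negPf->.
Qed.

(** The same change of coordinates for the monomial x^u t^k. *)
Definition mono_wt (u : 'X_{1..n}) (k : nat) : weight :=
  ([ffun v => (u v)%:Z - k%:Z], k%:Z).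

Definition mono (u : 'X_{1..n}) (k : nat) : {poly S} := ('X_[u])%:P * 'X^k.

Lemma mono_wt_inj u k u' k' : mono_wt u k = mono_wt u' k' -> u = u' /\ k = k'.
Proof.
case=> /ffunP eq_u [eq_k]; split=> //; apply/mnmP=> v.
by have := eq_u v; rewrite !ffunE; lia.
Qed.

Lemma mono_wtD u k u' k' :
  mono_wt (u + u')%MM (k + k')%N = mono_wt u k + mono_wt u' k'.
Proof.
congr pair.
apply/ffunP=> v; rewrite !ffunE mnmDE !PoszD. ring.
Qed.

Lemma monoM u k u' k' : mono u k * mono u' k' = mono (u + u')%MM (k + k')%N.
Proof. by rewrite /mono mpolyXD rmorphM exprD /= mulrACA. Qed.

Definition gen_exp (i : 'I_(n + m)) : 'X_{1..n} * nat :=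
  match split i with
  | inl v => (U_(v)%MM, 0%N)
  | inr k => ([multinom (v \notin tnth E k : nat) | v < n], 1%N)
  end.

Lemma gen_expE i : gen i = mono_wt (gen_exp i).1 (gen_exp i).2.
Proof.
rewrite /gen /gen_exp; case: split => [v|k]; congr pair; apply/ffunP=> u.
  by rewrite !ffunE mnm1E eq_sym subr0.
by rewrite !ffunE mnmE; case: (u \in _).
Qed.

Lemma phi_var_mono i : phi_var K E i = mono (gen_exp i).1 (gen_exp i).2.
Proof.
rewrite /phi_var /gen_exp /mono; case: split => [v|k] /=.
  by rewrite expr0 mulr1.
rewrite expr1; congr (_%:P * _); rewrite /edge_gen mpolyXE_id.
rewrite [RHS](bigID (fun v => v \in tnth E k)) /= [X in _ = X * _]big1 ?mul1r => [|v].
  by apply: eq_bigr => v Ekv; rewrite mnmE Ekv.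
by rewrite mnmE => ->.
Qed.

Definition scalar : {rmorphism K -> {poly S}} := polyC \o @mpolyC n K.

Lemma phiE_mmap p : phiE p = mmap scalar (phi_var K E) p. Proof. by []. Qed.

Lemma phiD : {morph phiE : p q / p + q}.
Proof. by move=> p q; rewrite !phiE_mmap raddfD. Qed.

Lemma phiX_exists a : exists u k, phiE 'X_[a] = mono u k /\ wt a = mono_wt u k.
Proof.
rewrite phiE_mmap mmapX /mmap1 /wt.
elim/big_rec2: _ => [|i w f _ [u [k [-> ->]]]].
  exists 0%MM, 0%N; rewrite /mono mpolyX0 expr0 mulr1; split=> //.
  by congr pair; apply/ffunP=> v; rewrite !ffunE mnm0E subr0.
elim: (a i) => [|j [u' [k' [Df Dw]]]]; first by exists u, k; rewrite mul1r add0r.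
exists ((gen_exp i).1 + u')%MM, ((gen_exp i).2 + k')%N.
by rewrite exprS mulrS -mulrA -addrA Df Dw phi_var_mono gen_expE monoM mono_wtD.
Qed.

Lemma phiX a u k : wt a = mono_wt u k -> phiE 'X_[a] = mono u k.
Proof.
by have [u' [k' [-> ->]]] := phiX_exists a; case/mono_wt_inj => -> ->.
Qed.

Lemma coef_mono u k u' k' : ((mono u k)`_k')@_u' = ((u == u') && (k == k'))%:R.
Proof.
rewrite /mono coefCM coefXn (eq_sym k'); case: (k == k').
  by rewrite mulr1 andbT mcoeffX.
by rewrite mulr0 mcoeff0 andbF.
Qed.

Lemma phiC c : phiE c%:MP = (c%:MP)%:P.
Proof. by rewrite phiE_mmap mmapC. Qed.

Lemma phiZ c p : phiE (c *: p) = (c%:MP)%:P * phiE p.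
Proof. by rewrite !phiE_mmap mmapZ. Qed.

(** Everything about the kernel of phi follows from this formula: phi adds up
    the coefficients along the fibres of [wt]. *)
Lemma coef_phi p u k :
  ((phiE p)`_k)@_u = \sum_(a <- msupp p | wt a == mono_wt u k) p@_a.
Proof.
rewrite {1}[p]mpolyE (big_morph _ phiD (_ : phiE 0 = 0)); last first.
  by rewrite -mpolyC0 phiC.
rewrite coef_sum raddf_sum /= [RHS]big_mkcond; apply: eq_bigr => a _.
rewrite phiZ coefCM mcoeffCM.
have [u' [k' [-> Dw]]] := phiX_exists a; rewrite coef_mono Dw.
have [|neq] := eqVneq (mono_wt u' k') (mono_wt u k).
  by case/mono_wt_inj => -> ->; rewrite !eqxx mulr1.
case: eqP => [eq_u|_]; last by rewrite mulr0.
case: eqP => [eq_k|_]; last by rewrite mulr0.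
by rewrite eq_u eq_k eqxx in neq.
Qed.

(** With [s] empty and [e = 1] this is the t-degree; with [s] a single vertex
    and [e = 0] it is the coordinate of that vertex. All facets and gradings
    below have this form. *)
Definition functional (s : seq 'I_n) (e : nat) (w : weight) : int :=
  \sum_(v <- s) w.1 v + w.2 *+ e.

Lemma functionalB s e : {morph functional s e : v w / v - w}.
Proof.
move=> v w; rewrite /functional opprD [RHS]addrACA -mulrnBl; congr (_ + _).
by rewrite -sumrB; apply: eq_bigr => u _; rewrite !ffunE.
Qed.

HB.instance Definition _ s e :=
  GRing.isZmodMorphism.Build weight int (functional s e) (functionalB s e).

Lemma functional_x s e v :
  functional s e (gen (lshift m v)) = (count_mem v s : nat)%:Z.
Proof.
rewrite /functional /gen (unsplitK (inl v)) /= mul0rn addr0.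
rewrite -sum1_count (big_morph Posz PoszD (erefl 0)) [RHS]big_mkcond /=.
by apply: eq_bigr => u _; rewrite ffunE; case: (u == v).
Qed.

Lemma functional_y s e k :
  functional s e (gen (rshift n k)) =
  e%:Z - (count (mem (tnth E k)) s : nat)%:Z.
Proof.
rewrite /functional /gen (unsplitK (inr k)) /= natz addrC; congr (_ + _).
rewrite -sum1_count (big_morph Posz PoszD (erefl 0)) -sumrN [RHS]big_mkcond /=.
by apply: eq_bigr => u _; rewrite ffunE; case: (u \in _); rewrite ?oppr0.
Qed.

Lemma weightP (v w : weight) :
  (forall u, functional [:: u] 0 v = functional [:: u] 0 w) ->
  functional [::] 1 v = functional [::] 1 w -> v = w.
Proof.
case: v w => [v k] [w l]; rewrite /functional => eq_vw.
rewrite !big_nil !add0r !mulr1n /= => ->; congr pair; apply/ffunP=> u.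
by have := eq_vw u; rewrite !big_seq1 !mulr0n !addr0.
Qed.

(** A condition on the weights of the monomials that occur in [f]. *)
Definition supported (P : weight -> Prop) (f : {poly S}) : Prop :=
  forall u k, (f`_k)@_u != 0 -> P (mono_wt u k).

Lemma supportedW (P Q : weight -> Prop) f :
  (forall w, P w -> Q w) -> supported P f -> supported Q f.
Proof. by move=> PQ Pf u k /Pf/PQ. Qed.

Lemma supported0 P : supported P 0.
Proof. by move=> u k; rewrite coef0 mcoeff0 eqxx. Qed.

Lemma supportedD P f g : supported P f -> supported P g -> supported P (f + g).
Proof.
move=> Pf Pg u k; rewrite coefD mcoeffD; have [->|/Pf//] := eqVneq (f`_k)@_u 0.
by rewrite add0r => /Pg.
Qed.

Lemma supportedN P f : supported P f -> supported P (- f).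
Proof. by move=> Pf u k; rewrite coefN mcoeffN oppr_eq0 => /Pf. Qed.

Lemma sum_neq0 (J : eqType) (r : seq J) (Q : pred J) (F : J -> K) :
  \sum_(j <- r | Q j) F j != 0 -> exists2 j, j \in r & Q j && (F j != 0).
Proof.
move=> nz; apply/hasP; apply: contraNT nz => /hasPn F0.
rewrite big_seq_cond big1 // => j /andP[rj Qj]; apply/eqP.
by have := F0 j rj; rewrite Qj /= negbK.
Qed.

Lemma supportedM (P Q T : weight -> Prop) f g :
  (forall v w, P v -> Q w -> T (v + w)) ->
  supported P f -> supported Q g -> supported T (f * g).
Proof.
move=> PQT Pf Qg u k; rewrite coefM raddf_sum /= => /sum_neq0[j _ /= nz].
move: nz; rewrite mcoeffM => /sum_neq0[[u1 u2] _ /andP[/eqP Du nz]].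
have {Du} -> : u = (u1 + u2)%MM by [].
rewrite -(subnKC (ltn_ord j : j <= k)%N) mono_wtD; move: nz => /=.
by rewrite mulf_eq0 negb_or => /andP[/Pf ? /Qg ?]; apply: PQT.
Qed.

Lemma supported_mono P c u k :
  (c != 0 -> P (mono_wt u k)) -> supported P ((c%:MP)%:P * mono u k).
Proof.
move=> Pw u' k'; rewrite coefCM mcoeffCM coef_mono.
have [<-|_] := eqVneq u u'; last by rewrite mulr0 eqxx.
have [<-|_] := eqVneq k k'; last by rewrite mulr0 eqxx.
by rewrite mulr1.
Qed.

Lemma mono_expansion (f : {poly S}) : f = \sum_(k < size f) \sum_(u <- msupp f`_k)
  (((f`_k)@_u)%:MP)%:P * mono u k.
Proof.
rewrite -[LHS](coefK f) poly_def; apply: eq_bigr => k _.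
rewrite -mul_polyC [in LHS](mpolyE f`_k) rmorph_sum mulr_suml.
apply: eq_bigr => u _; rewrite /mono mulrA -rmorphM /=.
by rewrite mul_mpolyC.
Qed.

Lemma supported_ind (P : weight -> Prop) (Q : {poly S} -> Prop) :
  Q 0 -> (forall f g, Q f -> Q g -> Q (f + g)) ->
  (forall c u k, P (mono_wt u k) -> Q ((c%:MP)%:P * mono u k)) ->
  forall f, supported P f -> Q f.
Proof.
move=> Q0 QD Qmono f Pf; rewrite (mono_expansion f).
elim/big_ind: _ => // k _; rewrite big_seq; elim/big_ind: _ => // u.
by rewrite mcoeff_msupp => /Pf Pw; apply: Qmono.
Qed.

Lemma supported_phi_var (P : weight -> Prop) i :
  P (gen i) -> supported P (phi_var K E i).
Proof.
move=> Pi; rewrite phi_var_mono -[mono _ _]mul1r -[1](rmorph1 (@polyC _)).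
by rewrite -mpolyC1; apply: supported_mono => _; rewrite -gen_expE.
Qed.

Lemma supported_mul_phi_var P f i :
  supported P (f * phi_var K E i) <->
  supported (fun w => P (w + gen i)) f.
Proof.
split=> [Pf u k|Pf]; last first.
  apply: (supportedM (Q := eq (gen i))) Pf _; last exact: supported_phi_var.
  by move=> v w Pv <-.
rewrite gen_expE -mono_wtD => nz; apply: Pf.
rewrite phi_var_mono /mono mulrA coefMXn ltnNge leq_addl /= addnK coefMC.
by rewrite addmC mcoeffMX.
Qed.

End Weights.

(** * The Rees algebra as a semigroup ring *)

Section IdealGen.

Variable A : comNzRingType.
Implicit Types (P : A -> Prop) (f g : A).

Lemma ideal_gen0 P : ideal_gen P 0.
Proof. by exists [::]; rewrite big_nil. Qed.

Lemma ideal_genD P f g : ideal_gen P f -> ideal_gen P g -> ideal_gen P (f + g).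
Proof.
move=> [s [Ps ->]] [t [Pt ->]]; exists (s ++ t); split; last by rewrite big_cat.
by move=> h; rewrite mem_cat => /orP[/Ps|/Pt].
Qed.

Lemma ideal_genMl P f g : ideal_gen P f -> ideal_gen P (g * f).
Proof.
move=> [s [Ps ->]]; exists [seq (g * h.1, h.2) | h <- s]; split.
  by move=> h /mapP[h' /Ps Ph' ->].
by rewrite big_map mulr_sumr; apply: eq_bigr => h _; rewrite mulrA.
Qed.

Lemma ideal_gen_mem P f : P f -> ideal_gen P f.
Proof.
move=> Pf; exists [:: (1, f)]; split; last by rewrite big_seq1 mul1r.
by move=> g; rewrite inE => /eqP->.
Qed.

Lemma ideal_powS (I : A -> Prop) k f g :
  I g -> ideal_pow I k f -> ideal_pow I k.+1 (g * f).
Proof.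
move=> Ig [s [Ps ->]]; exists [seq (h.1, g * h.2) | h <- s]; split.
  move=> _ /mapP[h /Ps[e [Ie Dh]] ->] /=.
  exists (fun i => if unlift ord0 i is Some j then e j else g); split.
    by move=> i; case: unliftP.
  rewrite big_ord_recl unlift_none Dh; congr (_ * _).
  by apply: eq_bigr => j _; rewrite liftK.
by rewrite big_map mulr_sumr; apply: eq_bigr => h _; rewrite mulrCA.
Qed.

End IdealGen.

Section ReesRing.

Variables (K : fieldType) (n m : nat) (E : m.-tuple {set 'I_n}).

Local Notation S := {mpoly K[n]}.
Local Notation weight := ({ffun 'I_n -> int} * int)%type.
Local Notation H := (in_monoid (gen E) [set: 'I_(n + m)]).
Local Notation phiE := (phi (K := K) E).
Local Notation R := (rees_comp_edge (K := K) E).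

Lemma in_monoid_wt w : H w <-> exists a, w = wt E a.
Proof.
split=> [[c _ ->]|[a ->]]; last by exists a => // i; rewrite inE.
by exists [multinom c i | i < n + m]; apply: eq_bigr => i _; rewrite mnmE.
Qed.

Lemma reesD f g : R f -> R g -> R (f + g).
Proof. by move=> Rf Rg k; rewrite coefD; exact: ideal_genD (Rf k) (Rg k). Qed.

Lemma rees_phi_var i f : R f -> R (phi_var K E i * f).
Proof.
move=> Rf k; rewrite /phi_var; case: split => [v|j] /=.
  by rewrite coefCM; exact: ideal_genMl (Rf k).
rewrite mulrAC coefMX; case: k => [|k].
  exact: ideal_gen0.
rewrite coefCM; apply: ideal_powS => //.
by apply: ideal_gen_mem; exists j.
Qed.

Lemma rees_scalar c f : R f -> R ((c%:MP)%:P * f).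
Proof. by move=> Rf k; rewrite coefCM; exact: ideal_genMl (Rf k). Qed.

Lemma rees_phiX a : R (phiE 'X_[a]).
Proof.
rewrite phiE_mmap mmapX /mmap1.
elim/big_rec: _ => [|i f _ Rf].
  move=> [|k]; rewrite coef1 /=; last exact: ideal_gen0.
  apply: ideal_gen_mem; exists (fun=> 0); rewrite big_ord0.
    by split=> // i; have := ltn_ord i; rewrite ltn0.
by elim: (a i) => [|j IHj]; rewrite ?mul1r // exprS -mulrA; apply: rees_phi_var.
Qed.

(** The x-variables alone generate all monomials of t-degree zero. *)
Lemma in_monoid_constant u : H (mono_wt u 0).
Proof.
have HD u1 u2 : H (mono_wt u1 0) -> H (mono_wt u2 0) ->
    H (mono_wt (u1 + u2)%MM 0).
  by rewrite -[0%N]/(0 + 0)%N mono_wtD; apply: in_monoidD.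
have H0 : H (mono_wt 0%MM 0).
  suff -> : mono_wt (0%MM : 'X_{1..n}) 0 = 0 by apply: in_monoid0.
  by congr pair; apply/ffunP=> v; rewrite !ffunE mnm0E.
rewrite [u]multinomUE_id; elim/big_ind: _ => // v _.
elim: (u v) => [|j IHj]; first by rewrite mulm0n.
rewrite mulmS; apply: HD => //.
have -> : mono_wt U_(v)%MM 0 = gen E (lshift m v).
  by rewrite gen_expE /gen_exp (unsplitK (inl v)).
by apply: in_monoid_gen; rewrite inE.
Qed.

Lemma supported_constant (h : S) : supported H h%:P.
Proof.
move=> u [|k]; first by move=> _; apply: in_monoid_constant.
by rewrite coefC mcoeff0 eqxx.
Qed.

Lemma supported_edge_ideal (h : S) : comp_edge_ideal (K := K) E h ->
  supported H (h%:P * 'X).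
Proof.
move=> [s [Ps ->]]; rewrite rmorph_sum mulr_suml big_seq.
elim/big_ind: _ => [|f g|g /Ps[k Dg]].
- exact: supported0.
- exact: supportedD.
have -> : (g.1 * g.2)%:P * 'X = g.1%:P * phi_var K E (rshift n k).
  by rewrite rmorphM -mulrA Dg /phi_var (unsplitK (inr k)).
apply/supported_mul_phi_var => u j /supported_constant Hu.
by apply: in_monoidD => //; apply: in_monoid_gen; rewrite inE.
Qed.

Lemma supportedHM (f g : {poly S}) : supported H f -> supported H g -> supported H (f * g).
Proof. by apply: supportedM => v w; apply: in_monoidD. Qed.

(** An element of the k-th power of the ideal, times t^k, is a combination of
    products of k elements h t with h in the ideal. *)
Lemma supported_rees f : R f -> supported H f.
Proof.
move=> Rf u k nz; suff: supported H ((f`_k)%:P * 'X^k).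
  by apply; rewrite coefCM coefXn eqxx mulr1.
case: (Rf k) => s [Ps ->]; rewrite rmorph_sum mulr_suml big_seq.
elim/big_ind: _ => [|f1 f2|g /Ps[e [Ie ->]]].
- exact: supported0.
- exact: supportedD.
rewrite rmorphM -mulrA rmorph_prod -[k in 'X^k]card_ord -prodr_const -big_split.
apply: supportedHM; first exact: supported_constant.
elim/big_ind: _ => [||i _]; [exact: supported_constant|exact: supportedHM|].
exact: supported_edge_ideal.
Qed.

(** The Rees algebra is the semigroup ring of the monoid generated by the
    weights of the variables. *)
Lemma rees_supported f : R f <-> supported H f.
Proof.
split; first exact: supported_rees.
apply: supported_ind => [k|f1 f2|c u k /in_monoid_wt[a Dw]].
- by rewrite coef0; apply: ideal_gen0.
- exact: reesD.
by rewrite -(phiX _ (esym Dw)); apply/rees_scalar/rees_phiX.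
Qed.

Lemma rees0 : R 0.
Proof. by apply/rees_supported; apply: supported0. Qed.

Lemma rees1 : R 1.
Proof. by apply/rees_supported; rewrite -polyC1; apply: supported_constant. Qed.

Lemma reesN f : R f -> R (- f).
Proof. by move/rees_supported => Hf; apply/rees_supported; apply: supportedN. Qed.

Lemma reesM f g : R f -> R g -> R (f * g).
Proof.
by move=> /rees_supported Hf /rees_supported Hg; apply/rees_supported; apply: supportedHM.
Qed.

(* sum of the vertex coordinates plus three times the t-degree: an edge has
   two ends, so y_k gets degree 3 - 2 = 1 *)
Local Notation wdeg := (functional (index_enum 'I_n) 3).

Definition homogeneous_part (d : int) (f : {poly S}) : {poly S} :=
  \poly_(k < size f) \sum_(u <- msupp f`_k | wdeg (mono_wt u k) == d)
    (f`_k)@_u *: 'X_[u].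

Lemma coef_homogeneous_part d f u k : ((homogeneous_part d f)`_k)@_u =
  if wdeg (mono_wt u k) == d then (f`_k)@_u else 0.
Proof.
rewrite coef_poly; case: ltnP => [_|le_k]; last first.
  by rewrite (nth_default _ le_k) mcoeff0 if_same.
rewrite raddf_sum /= big_mkcond /= [in RHS](mpolyE f`_k) raddf_sum /=.
case: ifP => dP.
  apply: eq_bigr => u' _; case: ifPn => // dP'; rewrite mcoeffZ mcoeffX.
  by have [eq_u|_] := eqVneq u' u; [rewrite eq_u dP in dP' | rewrite mulr0].
rewrite big1 // => u' _; case: ifP => // dP'; rewrite mcoeffZ mcoeffX.
by have [eq_u|_] := eqVneq u' u; [rewrite eq_u dP in dP' | rewrite mulr0].
Qed.

Lemma homogeneous_partD d : {morph homogeneous_part d : f g / f + g}.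
Proof.
move=> f g; apply/polyP => k; apply/mpolyP => u.
rewrite coefD mcoeffD !coef_homogeneous_part coefD mcoeffD.
by case: ifP; rewrite ?addr0.
Qed.

Lemma homogeneous_part_id d f :
  supported (fun w => wdeg w = d) f -> homogeneous_part d f = f.
Proof.
move=> df; apply/polyP => k; apply/mpolyP => u; rewrite coef_homogeneous_part.
have [->|/df->] := eqVneq (f`_k)@_u 0; first by rewrite if_same.
by rewrite eqxx.
Qed.

Lemma homogeneous_part_eq0 d f :
  supported (fun w => wdeg w <> d) f -> homogeneous_part d f = 0.
Proof.
move=> df; apply/polyP => k; apply/mpolyP => u; rewrite coef_homogeneous_part.
rewrite coef0 mcoeff0; have [->|/df/eqP/negPf->//] := eqVneq (f`_k)@_u 0.
by rewrite if_same.
Qed.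

(** Splitting [f] into its part of degree [d] and the rest, the product of
    the rest with [l] has no component of degree [d + e]. *)
Lemma homogeneous_part_mul d e f l : supported (fun w => wdeg w = e) l ->
  homogeneous_part (d + e) (f * l) = homogeneous_part d f * l.
Proof.
move=> el; set f1 := homogeneous_part d f.
have -> : f * l = f1 * l + (f - f1) * l by rewrite -mulrDl addrC subrK.
rewrite homogeneous_partD homogeneous_part_id ?homogeneous_part_eq0 ?addr0 //.
  apply: (supportedM (P := fun w => wdeg w <> d)) el.
    by move=> v w vd we; rewrite raddfD /= we => /addIr/vd.
  move=> u k; rewrite coefB mcoeffB coef_homogeneous_part.
  by case: (wdeg _ =P d); rewrite ?subrr ?eqxx.
apply: (supportedM (P := fun w => wdeg w = d)) el.
  by move=> v w <- <-; rewrite raddfD.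
move=> u k; rewrite coef_homogeneous_part.
by case: (wdeg _ =P d); rewrite ?eqxx.
Qed.

Hypothesis card_edge : forall k, #|tnth E k| = 2%N.

Lemma wdeg_gen i : wdeg (gen E i) = 1.
Proof.
rewrite /functional /gen; case: split => [v|k] /=.
  rewrite mul0rn addr0 (bigD1 v) //= ffunE eqxx big1 ?addr0 // => u.
  by rewrite ffunE => /negPf->.
under eq_bigr do rewrite ffunE.
rewrite sumrN -(big_morph Posz PoszD (erefl 0)) /=.
by rewrite -big_mkcond /= sum1_card card_edge.
Qed.

Lemma wdeg_wt a : wdeg (wt E a) = mdeg a.
Proof.
rewrite raddf_sum mdegE (big_morph Posz PoszD (erefl 0)) /=.
by apply: eq_bigr => i _; rewrite raddfMn /= wdeg_gen natz.
Qed.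

(** The grading inherited from T is induced by a functional on weights, which
    is where the homogeneity of the kernel of phi comes from. *)
Lemma rees_deg_supported d f : rees_deg (K := K) E d f <->
  supported (fun w => H w /\ wdeg w = d) f.
Proof.
split=> [[p /dhomogP dp ->] u k|].
  rewrite coef_phi => /sum_neq0[a pa /andP[/eqP<- _]].
  split; first by apply/in_monoid_wt; exists a.
  by rewrite wdeg_wt; congr Posz; apply: dp.
apply: supported_ind => [|f1 f2 [p1 dp1 ->] [p2 dp2 ->]|].
- by exists 0; rewrite ?rpred0 // phiE_mmap raddf0.
- by exists (p1 + p2); rewrite ?rpredD // phiD.
move=> c u k [/in_monoid_wt[a Dw] dw]; exists (c *: 'X_[a]).
  by apply/rpredZ; rewrite dhomogX; move: dw; rewrite Dw wdeg_wt => -[/eqP].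
by rewrite phiZ (phiX _ (esym Dw)).
Qed.

Definition gens (L : seq 'I_(n + m)) : seq {poly S} := map (phi_var K E) L.

(** Ideals of the Rees algebra generated by images of variables are monomial,
    so their membership is tested on weights. *)
Lemma ideal_span_supported L f :
  ideal_span R (gens L) f <-> supported (in_ideal (gen E) [set: _] L) f.
Proof.
split=> [[c [Rc ->]]|].
  elim/big_ind: _ => [||i _]; [exact: supported0|exact: supportedD|].
  have [l Ll ->] : exists2 l, l \in L & (gens L)`_i = phi_var K E l.
    by apply/mapP; apply: mem_nth.
  apply/supported_mul_phi_var; apply: supportedW ((rees_supported _).1 (Rc i)).
  by move=> w Hw; exists l; rewrite // addrK.
apply: supported_ind => [|f1 f2|c u k [l Ll /in_monoid_wt[a Dw]]].
- exact: (span0 rees0).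
- exact: (spanD reesD).
have -> : (c%:MP)%:P * mono K u k = ((c%:MP)%:P * phiE 'X_[a]) * phi_var K E l.
  have [u' [k' [-> Dw']]] := phiX_exists K E a.
  rewrite -mulrA phi_var_mono monoM; congr (_ * _).
  move/eqP: Dw; rewrite subr_eq Dw' gen_expE -mono_wtD => /eqP.
  by case/mono_wt_inj => -> ->.
apply: (spanZ reesM); first exact/rees_scalar/rees_phiX.
have [i lt_i <-] : exists2 i, (i < size (gens L))%N & (gens L)`_i = phi_var K E l.
  by apply/nthP/map_f.
exact: (span_nth rees0 rees1 (V := {poly S}^o)).
Qed.

Lemma rees_deg_rees d f : rees_deg (K := K) E d f -> R f.
Proof.
by move/rees_deg_supported => Hf; apply/rees_supported; apply: supportedW Hf => w [].
Qed.

Lemma in_ideal_gens L w : L =i [set: 'I_(n + m)] ->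
  in_ideal (gen E) [set: _] L w <-> H w /\ 0 < wdeg w.
Proof.
move=> allL; split=> [[i _ Hw]|[/in_monoid_wt[a ->]]].
  split.
    by rewrite -(subrK (gen E i) w); apply: in_monoidD => //; apply: in_monoid_gen.
  case/in_monoid_wt: Hw => a Dw.
  by rewrite -(subrK (gen E i) w) raddfD /= wdeg_gen Dw wdeg_wt; lia.
rewrite wdeg_wt => lt_a.
have /existsP[i ai] : [exists i, 0 < a i]%N.
  apply: contraTT lt_a; rewrite negb_exists => /forallP a0.
  rewrite mdegE big1 // => i _; apply/eqP.
  by rewrite -leqn0 leqNgt a0.
have Da : (a - U_(i) + U_(i))%MM = a by apply: submK; rewrite lep1mP -lt0n.
exists i; first by rewrite allL inE.
by rewrite -Da wtD wt1 addrK; apply/in_monoid_wt; exists (a - U_(i))%MM.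
Qed.

(** Transfer from monoids to rings: colon ideals of monomial ideals by
    monomials are computed monomial by monomial. *)
Lemma koszul_rees : filtered (gen E) [set: 'I_(n + m)] ->
  koszul R (rees_deg (K := K) E).
Proof.
move=> [F filtF [M FM allM]].
pose F' L := exists2 L0, F L0 & L = gens L0.
have linear_gen i : rees_deg (K := K) E 1 (phi_var K E i).
  apply/rees_deg_supported; apply: supported_phi_var; rewrite wdeg_gen.
  by split=> //; apply: in_monoid_gen.
have deg_wdeg d f : rees_deg (K := K) E d f -> supported (fun w => wdeg w = d) f.
  by move/rees_deg_supported; apply: supportedW => w [].
have linF' L : F' L -> forall l, l \in L -> rees_deg (K := K) E 1 l.
  by move=> [L0 _ ->] l /mapP[i _ ->].
have filtF' : koszul_filtration R F'.
  move=> _ [L FL ->] k; rewrite size_map => lt_k.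
  case Dk: (drop k L) => [|l L2].
    by have := size_drop k L; rewrite Dk /= => /esym/eqP; rewrite subn_eq0 leqNgt lt_k.
  have DL : L = take k L ++ l :: L2 by rewrite -Dk cat_take_drop.
  have [L' FL' L'P] := (filtF L FL).2 _ _ _ DL.
  exists (gens L'); first by exists L'.
  move=> w /rees_supported Hw; rewrite -map_take (nth_map l) //.
  rewrite -[in nth l L k](addn0 k) -nth_drop Dk /=.
  rewrite !ideal_span_supported supported_mul_phi_var.
  by split=> Lw u j nz; apply/(L'P _ (Hw u j nz)); apply: Lw.
apply: (koszul_of_filtration rees0 rees1 reesD reesN reesM
  (@rees_deg_rees 1%N) linF' filtF' (deg1 := homogeneous_part 1)
  (deg2 := homogeneous_part (1 + 1)) _ _ _ _ _ _ (L := gens M)).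
- move=> f /rees_supported Hf; apply/rees_deg_supported => u k.
  rewrite coef_homogeneous_part; case: (wdeg _ =P _) => [dw nz|_]; last by rewrite eqxx.
  by split=> //; apply: Hf nz.
- exact: homogeneous_partD.
- by move=> f l _ /deg_wdeg dl; apply: homogeneous_part_mul.
- move=> f l /deg_wdeg df /deg_wdeg dl; apply: homogeneous_part_id.
  by apply: supportedM df dl => v w; rewrite raddfD /= => -> ->.
- by apply/rees_deg_supported; apply: supported0.
- move=> f /rees_deg_supported df; apply/rees_deg_supported.
  exact: supportedN.
- by exists M.
move=> f Rf; rewrite ideal_span_supported; split=> [[s [Ps ->]]|].
  rewrite big_seq; elim/big_ind: _ => [|f1 f2|g /Ps[d d_gt0]].
  - exact: supported0.
  - exact: supportedD.
  move/rees_deg_supported; apply: supportedW => w [Hw dw].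
  by apply/in_ideal_gens => //; rewrite dw; split.
apply: supported_ind => [|f1 f2 [s1 [Ps1 ->]] [s2 [Ps2 ->]]|c u k].
- by exists [::]; split=> //; rewrite big_nil.
- exists (s1 ++ s2); split; last by rewrite big_cat.
  by move=> g; rewrite mem_cat => /orP[/Ps1|/Ps2].
move=> /(in_ideal_gens _ allM)[/in_monoid_wt[a Dw]]; rewrite Dw wdeg_wt => a_gt0.
exists [:: (c%:MP)%:P * mono K u k]; split; last by rewrite big_seq1.
move=> g; rewrite inE => /eqP->; exists (mdeg a) => //.
exists (c *: 'X_[a]); last by rewrite phiZ (phiX _ (esym Dw)).
by apply: rpredZ; rewrite dhomogX.
Qed.
End ReesRing.

(** * Filtrations read off from facets *)

Section Saturated.

Variables (I : finType) (V : zmodType) (gen : I -> V).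
Variables (X : {set I}) (N : nat) (ix : nat -> I).
Hypothesis mem_X : forall i, reflect (exists2 c, (c < N)%N & i = ix c) (i \in X).
Variables (facet : nat -> {additive V -> int}) (supp : nat -> seq nat).
Hypothesis facet_gen :
  forall c j, (c < N)%N -> facet j (gen (ix c)) = (j \in supp c : nat)%:Z.
Hypothesis saturated : forall v w, in_monoid gen X v -> in_monoid gen X w ->
  (forall j, 0 <= facet j (v - w)) -> in_monoid gen X (v - w).

(** Since the facets take the values 0 and 1 on generators, whether an
    element of the monoid is divisible by a generator only depends on the
    facets on which it is positive. *)
Definition face (w : V) : pred nat := fun j => 0 < facet j w.

Definition meets (L : seq nat) (A : pred nat) : bool :=
  has (fun c => all A (supp c)) L.

Let ixX c : (c < N)%N -> ix c \in X.
Proof. by move=> ltcN; apply/mem_X; exists c. Qed.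

Lemma facet_ge0 j w : in_monoid gen X w -> 0 <= facet j w.
Proof.
move=> [c c0 ->]; rewrite raddf_sum; apply: sumr_ge0 => i _; rewrite raddfMn.
have [/mem_X[e lt_e ->]|/c0->] := boolP (i \in X); last by rewrite mulr0n.
by rewrite facet_gen // mulrn_wge0.
Qed.

(** Saturation allows to subtract a generator as soon as all facets stay
    nonnegative. *)
Lemma in_ideal_face L w : all (gtn N) L -> in_monoid gen X w ->
  in_ideal gen X (map ix L) w <-> meets L (face w).
Proof.
move=> /allP ltLN Xw; split=> [[_ /mapP[c Lc ->] Xwc]|/hasP[c Lc /allP Ac]].
  apply/hasP; exists c => //; apply/allP=> j cj.
  have := facet_ge0 j Xwc; rewrite raddfB facet_gen ?cj /face; last exact: ltLN.
  by rewrite subr_ge0; apply: lt_le_trans.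
exists (ix c); first exact: map_f.
apply: saturated => // [|j]; first by apply/in_monoid_gen/ixX/ltLN.
rewrite raddfB facet_gen; last exact: ltLN.
case: (boolP (j \in supp c)) => [/Ac|_]; first by rewrite /face /= subr_ge0 gtz0_ge1.
by rewrite subr0 facet_ge0.
Qed.

Lemma face_add_gen w c : (c < N)%N -> in_monoid gen X w ->
  face (w + gen (ix c)) =1 predU (face w) (mem (supp c)).
Proof.
move=> lt_c Xw j; rewrite /face /= raddfD /= facet_gen //.
have := facet_ge0 j Xw; case: (j \in supp c); rewrite ?orbT ?addr0 ?orbF //.
by move=> ?; rewrite ltr_wpDl.
Qed.

Variables (B : seq (seq nat)) (M : seq nat) (realizable : pred nat -> Prop).
Hypothesis ltBN : all (all (gtn N)) B.
Hypotheses (BM : M \in B) (MN : iota 0 N =i M).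
Hypothesis face_realizable : forall w, in_monoid gen X w -> realizable (face w).
Hypothesis table : forall L k, L \in B -> (k < size L)%N ->
  exists L' j, L' \in B /\ forall A, realizable A ->
    meets (take k L) (predU A (mem (supp (nth 0%N L k)))) = meets (take j L') A.

(** Colon ideals are determined by Boolean functions of faces, so a finite
    table certifies the filtration. Lists of generators are given by codes,
    and the ideals of the filtration are those of the prefixes of the lists
    in [B]. *)
Lemma filtered_saturated : filtered gen X.
Proof.
pose F L := exists L0 j, L0 \in B /\ L = map ix (take j L0).
have ltBt L0 j : L0 \in B -> all (gtn N) (take j L0).
  by move=> /(allP ltBN)/allP ltL; apply/allP=> c /mem_take/ltL.
exists F; last first.
  exists (map ix M); first by exists M, (size M); rewrite take_size.
  move=> i; apply/mapP/mem_X=> -[c Mc ->]; exists c => //.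
    by move: Mc; rewrite -MN mem_iota.
  by rewrite -MN mem_iota.
move=> _ [L0 [j [BL0 ->]]]; split.
  by move=> _ /mapP[c /(allP (ltBt L0 j BL0)) ltc ->]; apply: ixX.
move=> L1 l L2 DL; set k := size L1.
have lt_k : (k < size (take j L0))%N.
  by rewrite -(size_map ix) DL size_cat /= -addSnnS leq_addr.
have [lt_k0 lt_kj] : (k < size L0)%N /\ (k < j)%N.
  by move: lt_k; rewrite size_take_min leq_min => /andP[].
have DL1 : L1 = map ix (take k L0).
  by rewrite -(take_size_cat (l :: L2) (erefl k)) -DL -map_take take_takel // ltnW.
have Dl : l = ix (nth 0%N L0 k).
  have := congr1 (nth l ^~ k) DL; rewrite nth_cat ltnn subnn /= => <-.
  by rewrite (nth_map 0%N) // nth_take.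
have [L' [j' [BL' L'P]]] := table BL0 lt_k0.
exists (map ix (take j' L')); first by exists L', j'.
have ltk : (nth 0%N L0 k < N)%N.
  by apply: (allP (allP ltBN _ BL0)); apply: mem_nth.
move=> w Xw; rewrite DL1 Dl !in_ideal_face ?ltBt //; last first.
  by apply: in_monoidD => //; apply/in_monoid_gen/ixX.
rewrite -L'P; last exact: face_realizable.
have -> // : meets (take k L0) (face (w + gen (ix (nth 0%N L0 k)))) =
  meets (take k L0) (predU (face w) (mem (supp (nth 0%N L0 k)))).
by apply: eq_has => c; apply: eq_all; apply: face_add_gen.
Qed.

End Saturated.

(** * Triangles and four-cycles *)

Section CycleBases.

Variables (n m : nat) (E : m.-tuple {set 'I_n}).
Local Notation weight := ({ffun 'I_n -> int} * int)%type.
Local Notation H := (in_monoid (gen E)).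
Local Notation alpha u := (functional [:: u] 0).
Local Notation kdeg := (functional [::] 1).

(** The variables of the Rees algebra of the subgraph induced on [W]. *)
Definition induced (W : {set 'I_n}) : {set 'I_(n + m)} :=
  [set i | match split i with
           | inl v => v \in W
           | inr k => tnth E k \subset W
           end].

Lemma induced_x W v : (lshift m v \in induced W) = (v \in W).
Proof. by rewrite inE (unsplitK (inl v)). Qed.

Lemma induced_y W k : (rshift n k \in induced W) = (tnth E k \subset W).
Proof. by rewrite inE (unsplitK (inr k)). Qed.

Lemma alpha_x u v : alpha u (gen E (lshift m v)) = (u == v : nat)%:Z.
Proof. by rewrite functional_x /= addn0. Qed.

Lemma alpha_y u k : alpha u (gen E (rshift n k)) = - (u \in tnth E k : nat)%:Z.
Proof. by rewrite functional_y /= addn0 sub0r. Qed.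

Lemma kdeg_x v : kdeg (gen E (lshift m v)) = 0.
Proof. by rewrite functional_x. Qed.

Lemma kdeg_y k : kdeg (gen E (rshift n k)) = 1.
Proof. by rewrite functional_y subr0. Qed.

Lemma functional_cons v s e (w : weight) :
  functional (v :: s) e w = alpha v w + functional s e w.
Proof. by rewrite /functional big_cons big_seq1 mulr0n addr0 addrA. Qed.

Lemma functional1 v (w : weight) : functional [:: v] 1 w = alpha v w + kdeg w.
Proof. exact: functional_cons. Qed.

Lemma functional2 u v (w : weight) :
  functional [:: u; v] 1 w = alpha u w + alpha v w + kdeg w.
Proof. by rewrite functional_cons functional1 addrA. Qed.

Lemma functional3 u v v' (w : weight) : functional [:: u; v; v'] 2 w =
  alpha u w + alpha v w + alpha v' w + kdeg w + kdeg w.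
Proof.
rewrite (functional_cons u) (functional_cons v) (functional_cons v').
have -> : functional [::] 2 w = kdeg w + kdeg w.
  by rewrite /functional big_nil !add0r.
by rewrite !addrA.
Qed.

Lemma alpha_off (W : {set 'I_n}) u w : u \notin W -> H (induced W) w -> alpha u w = 0.
Proof.
move=> Wu; apply: (lam_in_monoid (lam := functional [:: u] 0)) => i.
case: (split_ordP i) => [v ->|k ->]; rewrite ?induced_x ?induced_y => Wi.
  by rewrite /= alpha_x; case: eqP Wi => // <-; rewrite (negPf Wu).
by rewrite /= alpha_y; case: (boolP (u \in _)) => // /(subsetP Wi); rewrite (negPf Wu).
Qed.

Lemma int_mulrn (x : int) p : x *+ p = x * p%:Z.
Proof. by rewrite -mulr_natr natz. Qed.

Section FourCycle.

Variables (a b c e : 'I_n) (kab kbc kce kea : 'I_m).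
Hypothesis uniq_abce : uniq [:: a; b; c; e].
Hypotheses (Eab : tnth E kab = [set a; b]) (Ebc : tnth E kbc = [set b; c]).
Hypotheses (Ece : tnth E kce = [set c; e]) (Eea : tnth E kea = [set e; a]).
Let W := [set v in [:: a; b; c; e]].
Hypothesis induced_edges :
  forall k, tnth E k \subset W -> k \in [:: kab; kbc; kce; kea].

Let neq : [/\ a != b, a != c & a != e] /\ [/\ b != c, b != e & c != e].
Proof.
move: uniq_abce; rewrite /= !inE !negb_or !andbT.
by case/and3P=> /and3P[-> -> ->] /andP[-> ->] ->.
Qed.

(** Codes 0 to 3 stand for the vertices and 4 to 7 for the edges ab, bc, ce,
    ea. *)
Definition four_ix (i : nat) : 'I_(n + m) :=
  nth (lshift m a) [:: lshift m a; lshift m b; lshift m c; lshift m e;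
    rshift n kab; rshift n kbc; rshift n kce; rshift n kea] i.

(** The facets of the monoid: the t-degree, four facets that forbid a vertex
    to be covered more often than there are edges, and two for the pairs of
    opposite vertices, as an edge covers exactly one vertex of each pair.
    From index 7 on the functional is zero. *)
Definition four_facet (j : nat) : {additive weight -> int} :=
  functional (nth [::] [:: [::]; [:: a]; [:: b]; [:: c]; [:: e]; [:: a; c]; [:: b; e]] j)
    (j < 7).

Definition four_supp (i : nat) : seq nat :=
  nth [::] [:: [:: 1; 5]; [:: 2; 6]; [:: 3; 5]; [:: 4; 6];
    [:: 0; 3; 4]; [:: 0; 1; 4]; [:: 0; 1; 2]; [:: 0; 2; 3]]%N i.

(** The maximal ideal, followed by those of its colon ideals, and of theirs,
    that are not generated by a prefix of an earlier list. *)
Definition four_lists : seq (seq nat) :=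
  [:: [:: 6; 1; 5; 7; 4; 3; 2; 0]; [:: 6; 5]; [:: 6; 1; 7];
      [:: 6; 1; 5; 0; 7]; [:: 6; 1; 5; 0; 3]]%N.

(** The facet values satisfy two linear relations, one for each pair of
    opposite vertices: the sum of the values for the two vertices is the
    value for the pair plus the t-degree. These are their traces on supports. *)
Definition four_realizable (A : pred nat) : Prop :=
  (A 1%N || A 3%N) = (A 5%N || A 0%N) /\ (A 2%N || A 4%N) = (A 6%N || A 0%N).

Lemma four_mem i :
  reflect (exists2 c, (c < 8)%N & i = four_ix c) (i \in induced W).
Proof.
apply: (iffP idP) => [|[j lt_j ->]].
  case: (split_ordP i) => [v ->|k ->]; rewrite ?induced_x ?induced_y.
    rewrite !inE => /or4P[]/eqP->; [exists 0%N|exists 1%N|exists 2%N|exists 3%N] => //.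
  move=> /induced_edges; rewrite !inE.
  by move=> /or4P[]/eqP->; [exists 4%N|exists 5%N|exists 6%N|exists 7%N].
do 8?[case: j lt_j => [|j] //= lt_j];
  rewrite ?induced_x ?induced_y ?Eab ?Ebc ?Ece ?Eea ?subUset ?sub1set ?inE ?eqxx ?orbT //.
Qed.

Lemma four_facet_gen i j : (i < 8)%N ->
  four_facet j (gen E (four_ix i)) = (j \in four_supp i : nat)%:Z.
Proof.
have [[nab nac nae] [nbc nbe nce]] := neq.
case: j => [|[|[|[|[|[|[|j]]]]]]]; do 8?[case: i => [|i] //] => _;
  rewrite /four_facet /four_ix /= ?functional_x ?functional_y ?Eab ?Ebc ?Ece ?Eea
    /= ?inE ?eqxx ?(eq_sym b a) ?(eq_sym c a) ?(eq_sym e a) ?(eq_sym c b)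
    ?(eq_sym e b) ?(eq_sym e c) ?(negPf nab) ?(negPf nac) ?(negPf nae)
    ?(negPf nbc) ?(negPf nbe) ?(negPf nce) //.
all: by rewrite ?nth_nil ?functional_x ?functional_y //=.
Qed.

(** A point satisfying the facet inequalities prescribes how often the edges
    have to cover each vertex; [r0] and [r1] are the multiplicities at two
    adjacent vertices, which determine the other two, and sharing [minn r0
    r1] edges between them realizes these multiplicities. *)
Lemma four_weights (x0 x1 x2 x3 k : int) :
  [/\ 0 <= k, 0 <= x0 + k, 0 <= x1 + k, 0 <= x2 + k & 0 <= x3 + k] ->
  0 <= x0 + x2 + k -> 0 <= x1 + x3 + k ->
  exists p0 p1 p2 p3 q0 q1 q2 q3 : nat,
  [/\ x0 = p0%:Z - q0%:Z - q3%:Z, x1 = p1%:Z - q0%:Z - q1%:Z,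
      x2 = p2%:Z - q1%:Z - q2%:Z, x3 = p3%:Z - q2%:Z - q3%:Z &
      k = q0%:Z + q1%:Z + q2%:Z + q3%:Z].
Proof.
move=> [k_ge0 h0 h1 h2 h3] h02 h13.
have natP z : 0 <= z -> exists p : nat, z = p%:Z by case: z => // p; exists p.
have split_k x y : 0 <= x + k -> 0 <= y + k -> 0 <= x + y + k ->
    exists r : nat, [/\ 0 <= x + r%:Z, r%:Z <= k & 0 <= y + k - r%:Z].
  move=> hx hy hxy; have [x_ge0|x_lt0] := lerP 0 x.
    by exists 0%N; split; lia.
  by exists `|x|%N; split; lia.
have [r0 [hx0 hr0 hx2]] := split_k _ _ h0 h2 h02.
have [r1 [hx1 hr1 hx3]] := split_k _ _ h1 h3 h13.
have [p0 Dp0] := natP _ hx0; have [p1 Dp1] := natP _ hx1.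
have [p2 Dp2] := natP _ hx2; have [p3 Dp3] := natP _ hx3.
have [kn Dk] := natP _ k_ge0.
exists p0, p1, p2, p3, (minn r0 r1), (r1 - minn r0 r1)%N,
  (kn + minn r0 r1 - r0 - r1)%N, (r0 - minn r0 r1)%N.
by split; lia.
Qed.

(** The facet inequalities describe the monoid. *)
Lemma four_saturated v w : H (induced W) v -> H (induced W) w ->
  (forall j, 0 <= four_facet j (v - w)) -> H (induced W) (v - w).
Proof.
move=> Hv Hw; set z := v - w => z_ge0.
have zoff u : u \notin W -> alpha u z = 0.
  by move=> Wu; rewrite raddfB /= !(alpha_off Wu) // subrr.
clearbody z; have := z_ge0 0%N; have := z_ge0 1%N; have := z_ge0 2%N; have := z_ge0 3%N.
have := z_ge0 4%N; have := z_ge0 5%N; have := z_ge0 6%N.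
rewrite /four_facet /= !functional2 !functional1.
move=> h6 h5 h4 h3 h2 h1 h0.
have [|||p0 [p1 [p2 [p3 [q0 [q1 [q2 [q3 [Dx0 Dx1 Dx2 Dx3 Dk]]]]]]]]] :=
  @four_weights (alpha a z) (alpha b z) (alpha c z) (alpha e z) (kdeg z) => //.
have HP i : (i < 8)%N -> forall p, H (induced W) (gen E (four_ix i) *+ p).
  by move=> lt_i p; apply/in_monoidMn/in_monoid_gen/four_mem; exists i.
have -> : z = \sum_(i < 8) gen E (four_ix i) *+
    nth 0%N [:: p0; p1; p2; p3; q0; q1; q2; q3] i.
  rewrite !big_ord_recl big_ord0 /four_ix /=; apply: weightP => [u|]; last first.
    rewrite !raddfD !raddfMn /= !kdeg_x !kdeg_y raddf0 !mul0rn !natz Dk; lia.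
  rewrite !raddfD !raddfMn /= !alpha_x !alpha_y raddf0 Eab Ebc Ece Eea !inE.
  rewrite !int_mulrn; have [[nab nac nae] [nbc nbe nce]] := neq.
  have [Wu|Wu] := boolP (u \in W).
    move: Wu; rewrite !inE => /or4P[]/eqP->;
      rewrite !eqxx ?(eq_sym b a) ?(eq_sym c a) ?(eq_sym e a) ?(eq_sym c b)
        ?(eq_sym e b) ?(eq_sym e c) ?(negPf nab) ?(negPf nac) ?(negPf nae)
        ?(negPf nbc) ?(negPf nbe) ?(negPf nce) /=; lia.
  rewrite zoff //; move: Wu; rewrite !inE !negb_or.
  by case/and4P=> /negPf-> /negPf-> /negPf-> /negPf->; lia.
by elim/big_ind: _ => [|x y|[i lt_i] _]; [apply: in_monoid0|apply: in_monoidD|apply: HP].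
Qed.

Ltac four_check :=
  let A := fresh in intro A; case; rewrite /meets /four_supp /=;
  case: (A 0%N); case: (A 1%N); case: (A 2%N); case: (A 3%N);
  case: (A 4%N); case: (A 5%N); case: (A 6%N).

Lemma filtered_four_cycle : filtered (gen E) (induced W).
Proof.
apply: (filtered_saturated four_mem four_facet_gen four_saturated
  (B := four_lists) (M := [:: 6; 1; 5; 7; 4; 3; 2; 0]%N)
  (realizable := four_realizable)) => //.
- by move=> i; rewrite !inE; do 8?[case: i => [|i] //].
- move=> w Hw.
  have pos j : 0 <= four_facet j w.
    by apply: (facet_ge0 four_mem four_facet_gen).
  have := pos 0%N; have := pos 1%N; have := pos 2%N; have := pos 3%N.
  have := pos 4%N; have := pos 5%N; have := pos 6%N.
  rewrite /four_realizable /face /four_facet /= !functional2 !functional1; lia.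
have meetsP L' j L k : L' \in four_lists ->
    (forall A, four_realizable A ->
      meets four_supp (take k L) (predU A (mem (four_supp (nth 0%N L k)))) =
      meets four_supp (take j L') A) ->
    exists L' j, L' \in four_lists /\ forall A, four_realizable A ->
      meets four_supp (take k L) (predU A (mem (four_supp (nth 0%N L k)))) =
      meets four_supp (take j L') A by exists L', j.
pose M := [:: 6; 1; 5; 7; 4; 3; 2; 0]%N.
move=> L k; rewrite !inE => /or4P[/eqP->|/eqP->|/eqP->|/orP[]/eqP->].
- case: k => [|[|[|[|[|[|[|[|k]]]]]]]] // _.
  + by apply: (meetsP M 0%N).
  + by apply: (meetsP [:: 6; 5]%N 2%N) => //; four_check.
  + by apply: (meetsP [:: 6; 1; 7]%N 3%N) => //; four_check.
  + by apply: (meetsP [:: 6; 1; 5; 0; 3]%N 5%N) => //; four_check.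
  + by apply: (meetsP [:: 6; 1; 5; 0; 7]%N 5%N) => //; four_check.
  + by apply: (meetsP M 5%N) => //; four_check.
  + by apply: (meetsP M 6%N) => //; four_check.
  + by apply: (meetsP M 7%N) => //; four_check.
- case: k => [|[|k]] // _.
  + by apply: (meetsP M 0%N).
  + by apply: (meetsP [:: 6; 1; 7]%N 3%N) => //; four_check.
- case: k => [|[|[|k]]] // _.
  + by apply: (meetsP M 0%N).
  + by apply: (meetsP [:: 6; 5]%N 2%N) => //; four_check.
  + by apply: (meetsP [:: 6; 1; 5; 0; 3]%N 5%N) => //; four_check.
- case: k => [|[|[|[|[|k]]]]] // _.
  + by apply: (meetsP M 0%N).
  + by apply: (meetsP [:: 6; 5]%N 2%N) => //; four_check.
  + by apply: (meetsP [:: 6; 1; 7]%N 3%N) => //; four_check.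
  + by apply: (meetsP M 5%N) => //; four_check.
  + by apply: (meetsP [:: 6; 1; 5; 0; 3]%N 5%N) => //; four_check.
case: k => [|[|[|[|[|k]]]]] // _.
- by apply: (meetsP M 0%N).
- by apply: (meetsP [:: 6; 5]%N 2%N) => //; four_check.
- by apply: (meetsP [:: 6; 1; 7]%N 3%N) => //; four_check.
- by apply: (meetsP M 5%N) => //; four_check.
- by apply: (meetsP [:: 6; 1; 5; 0; 7]%N 5%N) => //; four_check.
Qed.

End FourCycle.
Section Triangle.

Variables (a b c : 'I_n) (kbc kac kab : 'I_m).
Hypothesis uniq_abc : uniq [:: a; b; c].
Hypotheses (Ebc : tnth E kbc = [set b; c]) (Eac : tnth E kac = [set a; c]).
Hypothesis Eab : tnth E kab = [set a; b].
Let W := [set v in [:: a; b; c]].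
Hypothesis induced_edges :
  forall k, tnth E k \subset W -> k \in [:: kbc; kac; kab].

Let neq : [/\ a != b, a != c & b != c].
Proof.
by move: uniq_abc; rewrite /= !inE !negb_or !andbT => /andP[/andP[-> ->] ->].
Qed.

(** Codes 0 to 2 stand for the vertices and 3 to 5 for the opposite edges. *)
Definition tri_ix (i : nat) : 'I_(n + m) :=
  nth (lshift m a) [:: lshift m a; lshift m b; lshift m c;
    rshift n kbc; rshift n kac; rshift n kab] i.

(** The facets are the t-degree, one facet for each vertex, and the sum of
    all vertex coordinates plus twice the t-degree. They exhibit the ring as
    the Segre product of a projective line and a projective plane. *)
Definition tri_facet (j : nat) : {additive weight -> int} :=
  functional (nth [::] [:: [::]; [:: a]; [:: b]; [:: c]; [:: a; b; c]] j)
    (nth 0 [:: 1; 1; 1; 1; 2] j)%N.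

Definition tri_supp (i : nat) : seq nat :=
  nth [::] [:: [:: 1; 4]; [:: 2; 4]; [:: 3; 4]; [:: 0; 1]; [:: 0; 2]; [:: 0; 3]]%N i.

Definition tri_lists : seq (seq nat) :=
  [:: [:: 0; 1; 2; 3; 4; 5]; [:: 0; 3]; [:: 0; 3; 1; 4]]%N.

(** The values for the three vertices sum up to the last facet plus the
    t-degree. *)
Definition tri_realizable (A : pred nat) : Prop :=
  [|| A 1%N, A 2%N | A 3%N] = A 4%N || A 0%N.

Lemma tri_mem i :
  reflect (exists2 c, (c < 6)%N & i = tri_ix c) (i \in induced W).
Proof.
apply: (iffP idP) => [|[j lt_j ->]].
  case: (split_ordP i) => [v ->|k ->]; rewrite ?induced_x ?induced_y.
    by rewrite !inE => /or3P[]/eqP->; [exists 0%N|exists 1%N|exists 2%N].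
  move=> /induced_edges; rewrite !inE.
  by move=> /or3P[]/eqP->; [exists 3%N|exists 4%N|exists 5%N].
do 6?[case: j lt_j => [|j] //= lt_j];
  rewrite ?induced_x ?induced_y ?Eab ?Ebc ?Eac ?subUset ?sub1set ?inE ?eqxx ?orbT //.
Qed.

Lemma tri_facet_gen i j : (i < 6)%N ->
  tri_facet j (gen E (tri_ix i)) = (j \in tri_supp i : nat)%:Z.
Proof.
have [nab nac nbc] := neq.
case: j => [|[|[|[|[|j]]]]]; do 6?[case: i => [|i] //] => _;
  rewrite /tri_facet /tri_ix /= ?functional_x ?functional_y ?Eab ?Ebc ?Eac /=
    ?inE ?eqxx ?(eq_sym b a) ?(eq_sym c a) ?(eq_sym c b)
    ?(negPf nab) ?(negPf nac) ?(negPf nbc) //.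
all: by rewrite ?nth_nil ?functional_x ?functional_y //=.
Qed.

(** An edge misses one vertex, so a vertex with coordinate x_i is missed at
    most x_i + k times by the k edges; the missing edges are distributed
    greedily. *)
Lemma tri_weights (x0 x1 x2 k : int) :
  [/\ 0 <= k, 0 <= x0 + k, 0 <= x1 + k & 0 <= x2 + k] ->
  0 <= x0 + x1 + x2 + k + k ->
  exists p0 p1 p2 q0 q1 q2 : nat,
  [/\ x0 = p0%:Z - q1%:Z - q2%:Z, x1 = p1%:Z - q0%:Z - q2%:Z,
      x2 = p2%:Z - q0%:Z - q1%:Z & k = q0%:Z + q1%:Z + q2%:Z].
Proof.
have natP z : 0 <= z -> exists p : nat, z = p%:Z by case: z => // p; exists p.
move=> [k_ge0 /natP[r0 D0] /natP[r1 D1] /natP[r2 D2]] h.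
have [kn Dk] := natP _ k_ge0.
pose q0 := minn kn r0; pose q1 := minn (kn - q0) r1; pose q2 := (kn - q0 - q1)%N.
exists (r0 - q0)%N, (r1 - q1)%N, (r2 - q2)%N, q0, q1, q2.
by rewrite /q2 /q1 /q0; split; lia.
Qed.

Lemma tri_saturated v w : H (induced W) v -> H (induced W) w ->
  (forall j, 0 <= tri_facet j (v - w)) -> H (induced W) (v - w).
Proof.
move=> Hv Hw; set z := v - w => z_ge0.
have zoff u : u \notin W -> alpha u z = 0.
  by move=> Wu; rewrite raddfB /= !(alpha_off Wu) // subrr.
clearbody z; have := z_ge0 0%N; have := z_ge0 1%N; have := z_ge0 2%N.
have := z_ge0 3%N; have := z_ge0 4%N.
rewrite /tri_facet /= functional3 !functional1 => h4 h3 h2 h1 h0.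
have [||p0 [p1 [p2 [q0 [q1 [q2 [Dx0 Dx1 Dx2 Dk]]]]]]] :=
  @tri_weights (alpha a z) (alpha b z) (alpha c z) (kdeg z) => //.
have HP i : (i < 6)%N -> forall p, H (induced W) (gen E (tri_ix i) *+ p).
  by move=> lt_i p; apply/in_monoidMn/in_monoid_gen/tri_mem; exists i.
have -> : z = \sum_(i < 6) gen E (tri_ix i) *+
    nth 0%N [:: p0; p1; p2; q0; q1; q2] i.
  rewrite !big_ord_recl big_ord0 /tri_ix /=; apply: weightP => [u|]; last first.
    rewrite !raddfD !raddfMn /= !kdeg_x !kdeg_y raddf0 !mul0rn !natz Dk; lia.
  rewrite !raddfD !raddfMn /= !alpha_x !alpha_y raddf0 Eab Ebc Eac !inE.
  rewrite !int_mulrn; have [nab nac nbc] := neq.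
  have [Wu|Wu] := boolP (u \in W).
    move: Wu; rewrite !inE => /or3P[]/eqP->;
      rewrite !eqxx ?(eq_sym b a) ?(eq_sym c a) ?(eq_sym c b)
        ?(negPf nab) ?(negPf nac) ?(negPf nbc) /=; lia.
  rewrite zoff //; move: Wu; rewrite !inE !negb_or.
  by case/and3P=> /negPf-> /negPf-> /negPf->; lia.
by elim/big_ind: _ => [|x y|[i lt_i] _]; [apply: in_monoid0|apply: in_monoidD|apply: HP].
Qed.

Ltac tri_check :=
  let A := fresh in intro A; rewrite /tri_realizable /meets /tri_supp /=;
  case: (A 0%N); case: (A 1%N); case: (A 2%N); case: (A 3%N); case: (A 4%N).

Lemma filtered_triangle : filtered (gen E) (induced W).
Proof.
apply: (filtered_saturated tri_mem tri_facet_gen tri_saturated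
  (B := tri_lists) (M := iota 0 6) (realizable := tri_realizable)) => //.
- move=> w Hw.
  have pos j : 0 <= tri_facet j w.
    by apply: (facet_ge0 tri_mem tri_facet_gen).
  have := pos 0%N; have := pos 1%N; have := pos 2%N; have := pos 3%N.
  have := pos 4%N.
  rewrite /tri_realizable /face /tri_facet /= functional3 !functional1; lia.
have meetsP L' j L k : L' \in tri_lists ->
    (forall A, tri_realizable A ->
      meets tri_supp (take k L) (predU A (mem (tri_supp (nth 0%N L k)))) =
      meets tri_supp (take j L') A) ->
    exists L' j, L' \in tri_lists /\ forall A, tri_realizable A ->
      meets tri_supp (take k L) (predU A (mem (tri_supp (nth 0%N L k)))) =
      meets tri_supp (take j L') A by exists L', j.
move=> L k; rewrite !inE => /or3P[]/eqP->.
- case: k => [|[|[|[|[|[|k]]]]]] // _.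
  + by apply: (meetsP (iota 0 6) 0%N).
  + by apply: (meetsP [:: 0; 3]%N 2%N) => //; tri_check.
  + by apply: (meetsP [:: 0; 3; 1; 4]%N 4%N) => //; tri_check.
  + by apply: (meetsP (iota 0 6) 3%N) => //; tri_check.
  + by apply: (meetsP (iota 0 6) 4%N) => //; tri_check.
  + by apply: (meetsP (iota 0 6) 5%N) => //; tri_check.
- case: k => [|[|k]] // _.
  + by apply: (meetsP (iota 0 6) 0%N).
  + by apply: (meetsP (iota 0 6) 3%N) => //; tri_check.
case: k => [|[|[|[|k]]]] // _.
- by apply: (meetsP (iota 0 6) 0%N).
- by apply: (meetsP (iota 0 6) 3%N) => //; tri_check.
- by apply: (meetsP [:: 0; 3]%N 2%N) => //; tri_check.
- by apply: (meetsP (iota 0 6) 4%N) => //; tri_check.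
Qed.

End Triangle.
End CycleBases.

(** * Cycles and components of graphs *)

Section Graph.

Variables (n : nat) (G : sgraph n).
Implicit Types (u v x y : 'I_n) (c : seq 'I_n) (W : {set 'I_n}).

Lemma adj_neq x y : G x y -> x != y.
Proof. by apply: contraTneq => ->; rewrite adj_irr. Qed.

Lemma connect_adj_sym : connect_sym G.
Proof. exact/sym_connect_sym/adj_sym. Qed.

Lemma mem_cover_cycle c : cover (cycle_edges c) = [set x in c].
Proof.
apply/setP=> x; rewrite inE; apply/bigcupP/idP => [[e /imsetP[y cy ->]]|cx].
  by rewrite !inE => /orP[/eqP->//|/eqP->]; rewrite mem_next.
by exists [set x; next c x]; rewrite ?inE ?eqxx //; apply/imsetP; exists x.
Qed.

Lemma set2_eq (T : finType) (x y x' y' : T) : [set x; y] = [set x'; y'] ->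
  (x = x' /\ y = y') \/ (x = y' /\ y = x').
Proof.
move=> eq_xy; have [xP yP] : x \in [set x'; y'] /\ y \in [set x'; y'].
  by rewrite -eq_xy !inE !eqxx orbT.
have [x'P y'P] : x' \in [set x; y] /\ y' \in [set x; y].
  by rewrite eq_xy !inE !eqxx orbT.
move: xP yP x'P y'P; rewrite !inE.
case/orP=> /eqP->; case/orP=> /eqP->; rewrite ?eqxx ?orbb; [|by left|by right|].
  by move=> _ /eqP->; left.
by move=> /eqP->; left.
Qed.

Lemma next_next_neq c x : uniq c -> (2 < size c)%N -> x \in c ->
  next c (next c x) != x.
Proof.
move=> Uc szc cx; have [i s Dc] := rot_to cx.
have Us : uniq (x :: s) by rewrite -Dc rot_uniq.
rewrite -!(next_rot i Uc) Dc.
have : (2 < size (x :: s))%N by rewrite -Dc size_rot.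
case: s Dc Us => [|y [|z s]] //= _ /and3P[]; rewrite !inE !negb_or.
move=> /and3P[nxy nxz _] _ _ _; rewrite !eqxx (eq_sym y x) (negPf nxy).
by rewrite eq_sym.
Qed.

(** Two vertices with the same outgoing edge would form a cycle of length
    two. *)
Lemma card_cycle_edges c : uniq c -> (2 < size c)%N ->
  #|cycle_edges c| = size c.
Proof.
move=> Uc szc; rewrite card_in_imset; first exact/card_uniqP.
move=> x y cx cy /set2_eq[[]//|[Dx Dy]].
by have := next_next_neq Uc szc cx; rewrite Dy -Dx eqxx.
Qed.

(** A class of the connectivity relation has a second element exactly when it
    contains an edge. *)
Lemma nontrivial_componentsP u0 v0 : G u0 v0 ->
  nontrivial_components G = 1%N <->
  forall u v u' v', G u v -> G u' v' -> connect G u u'.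
Proof.
move=> Guv0.
pose B x := [set y in [set: 'I_n] | connect G x y].
have memB x : B x \in components G.
  by apply: imset_f; rewrite inE.
have nontrivB x y : G x y -> B x \in [set A in components G | (1 < #|A|)%N].
  move=> Gxy; rewrite inE memB /=; apply/card_gt1P; exists x, y.
  by rewrite !inE connect0 connect1 // adj_neq.
have BP A : A \in [set A in components G | (1 < #|A|)%N] ->
    exists x y, G x y /\ A = B x.
  rewrite inE => /andP[/imsetP[x _ ->] /card_gt1P[y [z [By Bz nyz]]]].
  have [w Bw nxw] : exists2 w, connect G x w & x != w.
    move: By Bz; rewrite !inE => /= By Bz.
    have [exy|nxy] := eqVneq x y; last by exists y.
    by exists z; rewrite // exy.
  have /connectP[[|y' p] /=] := Bw; first by move=> _ ew; rewrite ew eqxx in nxw.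
  by case/andP=> Gxy' _ _; exists x, y'.
split=> [c1|conn].
  move=> u v u' v' /nontrivB Bu /nontrivB Bu'.
  have /eqP/cards1P[A DA] : nontrivial_components G = 1%N by [].
  move: Bu Bu'; rewrite DA !inE => /eqP eBu /eqP eBu'.
  have : u' \in B u by rewrite eBu -eBu' !inE connect0.
  by rewrite !inE.
apply/eqP/cards1P; exists (B u0); apply/setP=> A; rewrite in_set1.
apply/idP/eqP => [/BP[x [y [Gxy ->]]]|->]; last exact: nontrivB Guv0.
apply/setP=> z; rewrite !inE /=.
by apply: (same_connect connect_adj_sym); apply: conn Gxy Guv0.
Qed.

End Graph.

(** * Growing the graph from its cycle *)

Section Growth.

Variables (n m : nat) (G : sgraph n) (E : m.-tuple {set 'I_n}).
Variable C : {set {set 'I_n}}.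
Implicit Types (W : {set 'I_n}).
Hypothesis E_uniq : uniq E.
Hypothesis E_edges : E =i edge_set G.
Hypothesis cycle_unique : forall C', is_cycle G C' -> C' = C.

Local Notation weight := ({ffun 'I_n -> int} * int)%type.
Local Notation H := (in_monoid (gen E)).

Lemma edge_index x y : G x y -> exists k, tnth E k = [set x; y].
Proof.
move=> Gxy; have : [set x; y] \in E.
  by rewrite E_edges; apply/imsetP; exists (x, y); rewrite ?inE.
by case/tnthP=> k ->; exists k.
Qed.

Lemma tnth_edge k : exists x y, G x y /\ tnth E k = [set x; y].
Proof.
have := mem_tnth k E; rewrite E_edges => /imsetP[[x y]].
by rewrite inE /= => Gxy ->; exists x, y.
Qed.

Lemma card_tnth_edge k : #|tnth E k| = 2%N.
Proof. by have [x [y [/adj_neq nxy ->]]] := tnth_edge k; rewrite cards2 nxy. Qed.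

Lemma tnth_edge_inj k l : tnth E k = tnth E l -> k = l.
Proof. by apply/tuple_uniqP. Qed.

Lemma ucycle_cover c : (2 < size c)%N -> ucycle G c -> cover C = [set x in c].
Proof.
move=> szc Gc; rewrite -(cycle_unique (C' := cycle_edges c)).
  exact: mem_cover_cycle.
by exists c.
Qed.

Definition rel_in (W : {set 'I_n}) : rel 'I_n :=
  [rel x y | [&& G x y, x \in W & y \in W]].

Definition connected_in (W : {set 'I_n}) : Prop :=
  {in W &, forall x y, connect (rel_in W) x y}.

(** Two neighbours in a connected set containing the cycle would close up,
    through the new vertex, to a second cycle. *)
Lemma unique_neighbor W p q q' : cover C \subset W -> connected_in W ->
  p \notin W -> q \in W -> q' \in W -> G p q -> G p q' -> q = q'.
Proof.
move=> sCW connW Wp Wq Wq' Gpq Gpq'; apply/eqP/negP => /negP neq_q.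
have /connectP[s Gs Dq'] := connW q q' Wq Wq'.
case/shortenP: Gs Dq' => t Gt Ut _ Dq'.
have sWt x : x \in t -> x \in W.
  move: Gt; elim: t q {Ut Dq' Wq Gpq neq_q} => //= y t IHt q /andP[/and3P[_ _ Wy] Gt].
  by rewrite inE => /orP[/eqP->|/(IHt _ Gt)].
have Gt' : path G q t by apply: sub_path Gt => x y /and3P[].
case: t Dq' Gt Ut sWt Gt' => [|y t] Dq' Gt Ut sWt Gt'.
  by rewrite Dq' eqxx in neq_q.
have Gc : ucycle G [:: p, q, y & t].
  rewrite /ucycle; apply/andP; split; last first.
    rewrite cons_uniq Ut andbT inE negb_or; apply/andP; split.
      by apply: contraNneq Wp => ->.
    by apply: contra Wp; apply: sWt.
  rewrite (_ : cycle G _ = path G p (rcons [:: q, y & t] p)) // rcons_path.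
  rewrite [path _ _ _]/(G p q && path G q (y :: t)) Gpq Gt'.
  by have -> : last p [:: q, y & t] = q' by []; rewrite adj_sym.
have := subsetP sCW p; rewrite (ucycle_cover _ Gc) // !inE eqxx => /(_ isT).
by rewrite (negPf Wp).
Qed.

Lemma induced_leaf W p q k : p \notin W -> q \in W -> tnth E k = [set p; q] ->
  (forall q', q' \in W -> G p q' -> q' = q) ->
  induced E (p |: W) = lshift m p |: (rshift n k |: induced E W).
Proof.
move=> Wp Wq Ek uq; apply/setP=> i; rewrite in_setU1 [in RHS]in_setU1.
case: (split_ordP i) => [v ->|l ->].
  by rewrite !induced_x !inE eq_lrshift (inj_eq (@lshift_inj _ _)).
rewrite !induced_y eq_rlshift (inj_eq (@rshift_inj _ _)) /=.
have [->|nlk] := eqVneq l k.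
  by rewrite Ek subUset !sub1set !inE eqxx Wq orbT.
apply/idP/idP => [sl|]; last by move/subset_trans; apply; apply: subsetUr.
apply/subsetP=> x lx; have := subsetP sl x lx; rewrite !inE => /orP[/eqP ex|//].
case/eqP: nlk; apply: tnth_edge_inj; rewrite Ek.
have [y [z [Gyz El]]] := tnth_edge l.
have Wyz u v : G u v -> tnth E l = [set u; v] -> u = p -> v = q.
  move=> Guv Eu eu; apply: uq; last by rewrite -eu.
  have : v \in p |: W by apply: (subsetP sl); rewrite Eu !inE eqxx orbT.
  by rewrite !inE => /orP[/eqP ev|//]; have := adj_neq Guv; rewrite eu ev eqxx.
move: lx; rewrite El !inE ex => /orP[]/eqP ep.
  by rewrite -ep (Wyz y z).
rewrite -ep setUC (Wyz z y) //; last by rewrite El setUC.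
by rewrite adj_sym.
Qed.

Lemma induced_isolated W p : p \notin W -> (forall q, q \in W -> ~~ G p q) ->
  induced E (p |: W) = lshift m p |: induced E W.
Proof.
move=> Wp iso; apply/setP=> i; rewrite in_setU1.
case: (split_ordP i) => [v ->|l ->].
  by rewrite !induced_x !inE (inj_eq (@lshift_inj _ _)).
rewrite !induced_y eq_rlshift /=.
apply/idP/idP => [sl|]; last by move/subset_trans; apply; apply: subsetUr.
have Wyz u v : G u v -> tnth E l = [set u; v] -> u != p.
  move=> Guv Eu; apply/eqP=> eu.
  have /setU1P[ev|Wv] : v \in p |: W.
    by apply: (subsetP sl); rewrite Eu !inE eqxx orbT.
    by have := adj_neq Guv; rewrite eu ev eqxx.
  by have := iso v Wv; rewrite -eu Guv.
have [y [z [Gyz El]]] := tnth_edge l.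
have nyp := Wyz y z Gyz El.
have nzp : z != p by apply: (Wyz z y); rewrite 1?adj_sym // El setUC.
move: sl; rewrite El !subUset !sub1set !inE.
by rewrite (negPf nyp) (negPf nzp).
Qed.

Lemma alpha_induced W p : p \notin W ->
  forall i, i \in induced E W -> functional [:: p] 0 (gen E i) = 0.
Proof. by move=> Wp i Wi; apply: alpha_off Wp _; apply: in_monoid_gen. Qed.

(** The new vertex p has a single neighbour q in [W], and x_p y_pq = x_r y_qr
    for any other neighbour r of q: this is the relation ab = c of
    [filtered_leaf]. *)
Lemma filtered_add_leaf W p q : cover C \subset W -> connected_in W ->
  p \notin W -> q \in W -> G p q -> (exists2 r, r \in W & G q r) ->
  filtered (gen E) (induced E W) -> filtered (gen E) (induced E (p |: W)).
Proof.
move=> sCW connW Wp Wq Gpq [r Wr Gqr] filtW.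
have [k Ek] := edge_index Gpq; have [l El] := edge_index Gqr.
rewrite (induced_leaf Wp Wq Ek); last first.
  by move=> q' Wq' Gpq'; apply: (unique_neighbor sCW connW Wp Wq' Wq Gpq' Gpq).
apply: (filtered_leaf (lam := functional [:: p] 0)) filtW => /=.
- exact: alpha_induced.
- by rewrite alpha_x eqxx.
- by rewrite alpha_y Ek !inE eqxx.
exists (lshift m r); first by rewrite induced_x.
have -> : gen E (lshift m p) + gen E (rshift n k) - gen E (lshift m r) =
    gen E (rshift n l).
  apply: weightP => [u|]; last first.
    by rewrite raddfB raddfD /= !kdeg_x !kdeg_y; lia.
  rewrite raddfB raddfD /= !alpha_x !alpha_y Ek El !inE.
  have npq := adj_neq Gpq; have nqr := adj_neq Gqr.
  have npr : p != r by apply: contraNneq Wp => ->.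
  have [->|nup] := eqVneq u p; first by rewrite (negPf npq) (negPf npr).
  have [->|nuq] := eqVneq u q; first by rewrite (negPf nqr).
  by case: (u == r).
apply: in_monoid_gen; rewrite induced_y El subUset !sub1set Wq Wr //.
Qed.

Lemma filtered_add_isolated W p : p \notin W -> (forall q, q \in W -> ~~ G p q) ->
  filtered (gen E) (induced E W) -> filtered (gen E) (induced E (p |: W)).
Proof.
move=> Wp iso filtW; rewrite (induced_isolated Wp iso).
apply: (filtered_free_variable (lam := functional [:: p] 0)) filtW => /=.
- exact: alpha_induced.
- by rewrite alpha_x eqxx.
Qed.

Lemma connected_in_add W p q : connected_in W -> q \in W -> G p q ->
  connected_in (p |: W).
Proof.
move=> connW Wq Gpq.
have toq x : x \in p |: W -> connect (rel_in (p |: W)) x q.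
  case/setU1P=> [->|Wx].
    by apply: connect1; rewrite /rel_in /= Gpq !inE eqxx Wq orbT.
  apply: connect_sub (connW _ _ Wx Wq) => y z /and3P[Gyz Wy Wz].
  by apply: connect1; rewrite /rel_in /= Gyz !inE Wy Wz !orbT.
have sym : connect_sym (rel_in (p |: W)).
  by apply: sym_connect_sym => x y; rewrite /rel_in /= adj_sym; congr (_ && _); apply: andbC.
move=> x y /toq xq /toq yq; apply: connect_trans xq _.
by rewrite sym.
Qed.

(** Leaves are attached until the connected component of the cycle is
    exhausted. *)
Lemma filtered_component W : cover C \subset W -> connected_in W ->
  (1 < #|W|)%N -> filtered (gen E) (induced E W) ->
  exists2 W' : {set 'I_n}, W \subset W' & filtered (gen E) (induced E W') /\
    forall p q, p \notin W' -> q \in W' -> ~~ G p q.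
Proof.
have [k] := ubnP #|~: W|; elim: k W => // k IHk W le_k sCW connW gt1W filtW.
have [/existsP[p /existsP[q /and3P[Wp Wq Gpq]]]|] :=
    boolP [exists p, exists q, [&& p \notin W, q \in W & G p q]]; last first.
  rewrite negb_exists => /forallP noE; exists W => //; split=> // p q Wp Wq.
  by apply/negP=> Gpq; have /existsP[] := noE p; exists q; rewrite Wp Wq.
have [r Wr Gqr] : exists2 r, r \in W & G q r.
  have /card_gt1P[x [y [Wx Wy nxy]]] := gt1W.
  have [z Wz nqz] : exists2 z, z \in W & q != z.
    have [eqx|nqx] := eqVneq q x; last by exists x.
    by exists y; rewrite // eqx.
  have /connectP[[|r s] /= Gs Dz] := connW q z Wq Wz.
    by rewrite Dz eqxx in nqz.
  by exists r; case/andP: Gs => /and3P[].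
have [|||||W' sW' [filtW' noE]] := IHk (p |: W).
- rewrite -ltnS; apply: leq_trans le_k; rewrite ltnS; apply: proper_card.
  rewrite properE !setCS subsetUr; apply: contra Wp => /subsetP; apply.
  exact: setU11.
- by apply: subset_trans sCW (subsetUr _ _).
- exact: connected_in_add Wq Gpq.
- by apply: leq_trans gt1W (subset_leq_card (subsetUr _ _)).
- by apply: filtered_add_leaf Gpq _ filtW => //; exists r.
by exists W' => //; apply: subset_trans sW'; apply: subsetUr.
Qed.

(** The remaining vertices are isolated and contribute polynomial variables. *)
Lemma filtered_all W : (forall p q, p \notin W -> ~~ G p q) ->
  filtered (gen E) (induced E W) -> filtered (gen E) [set: 'I_(n + m)].
Proof.
have [k] := ubnP #|~: W|; elim: k W => // k IHk W le_k iso filtW.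
have [p Wp|allW] := pickP [predC W]; last first.
  suff <- : induced E W = [set: 'I_(n + m)] by [].
  have WT : W = [set: 'I_n] by apply/setP=> x; rewrite inE; apply/negbFE/allW.
  apply/setP=> i; rewrite [RHS]inE; case: (split_ordP i) => [v ->|l ->].
    by rewrite induced_x WT inE.
  by rewrite induced_y WT subsetT.
apply: (IHk (p |: W)).
- rewrite -ltnS; apply: leq_trans le_k; rewrite ltnS; apply: proper_card.
  rewrite properE !setCS subsetUr; apply: contra Wp => /subsetP; apply.
  exact: setU11.
- by move=> r q; rewrite !inE negb_or => /andP[_ /iso].
by apply: filtered_add_isolated => // q _; apply: iso.
Qed.

Lemma filtered_connected W x0 y0 : G x0 y0 -> x0 \in W ->
  nontrivial_components G = 1%N ->
  cover C \subset W -> connected_in W -> (1 < #|W|)%N ->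
  filtered (gen E) (induced E W) -> filtered (gen E) [set: 'I_(n + m)].
Proof.
move=> Gxy0 Wx0 /(nontrivial_componentsP Gxy0) conn sCW connW gt1W filtW.
have [W' sW' [filtW' noE]] := filtered_component sCW connW gt1W filtW.
apply: filtered_all filtW' => p q W'p; apply/negP => Gpq.
have clW' : closed G W'.
  apply: intro_closed; first exact: connect_adj_sym.
  move=> x y Gxy W'x; apply: contraTT Gxy => W'y.
  by rewrite adj_sym noE.
have := closed_connect clW' (conn _ _ _ _ Gxy0 Gpq).
by rewrite (subsetP sW' _ Wx0) (negPf W'p).
Qed.

Lemma cycle_connected c : cycle G c -> connected_in [set x in c].
Proof.
case: c => [|x0 s] Gc; first by move=> x; rewrite !inE.
set W := [set x in _].
have sW y : y \in x0 :: s -> y \in W by move=> sy; rewrite in_set.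
have Wx0 x : x \in W -> connect (rel_in W) x0 x.
  rewrite in_set; apply: path_connect.
  apply: (@sub_in_path _ (mem W) G).
  - by move=> x' y' /= Wx Wy Gxy; rewrite /rel_in /= Gxy Wx Wy.
  - by apply/allP=> y /sW.
  by move: Gc; rewrite /= rcons_path => /andP[].
have sym : connect_sym (rel_in W).
  by apply: sym_connect_sym => x y; rewrite /rel_in /= adj_sym; congr (_ && _); apply: andbC.
move=> x y /Wx0 x0x /Wx0 x0y; apply: connect_trans x0y.
by rewrite sym.
Qed.

Lemma tnth_edge_eq k l : (k == l) = (tnth E k == tnth E l).
Proof. by apply/eqP/eqP => [->|/tnth_edge_inj]. Qed.

Lemma filtered_three_cycle a b c : ucycle G [:: a; b; c] ->
  nontrivial_components G = 1%N -> filtered (gen E) [set: 'I_(n + m)].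
Proof.
move=> Gc c1; have /andP[cycG Uc] := Gc.
have /= /and4P[Gab Gbc Gca _] := cycG.
set W := [set v in [:: a; b; c]].
have [kab Eab] := edge_index Gab; have [kbc Ebc] := edge_index Gbc.
have [kac Eac] := edge_index (etrans (adj_sym G a c) Gca).
apply: (@filtered_connected W a b) => //.
- by rewrite !inE eqxx.
- by rewrite (ucycle_cover _ Gc).
- by exact: cycle_connected.
- by rewrite cardsE (card_uniqP Uc).
apply: (filtered_triangle Uc Ebc Eac Eab) => k sk.
have [x [y [Gxy Ek]]] := tnth_edge k.
move: sk; rewrite Ek subUset !sub1set !inE !tnth_edge_eq => /andP[].
move=> /or3P[]/eqP ex /or3P[]/eqP ey; move: Gxy; rewrite Ek ex ey ?adj_irr // => _;
  rewrite Eab Ebc Eac ?eqxx ?orbT // setUC ?eqxx ?orbT //.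
Qed.

(** A chord would create a triangle, that is, a second cycle. *)
Lemma filtered_four_cycle_graph a b c e : ucycle G [:: a; b; c; e] ->
  nontrivial_components G = 1%N -> filtered (gen E) [set: 'I_(n + m)].
Proof.
move=> Gc c1; have /andP[cycG Uc] := Gc.
have /= /and5P[Gab Gbc Gce Gea _] := cycG.
set W := [set v in [:: a; b; c; e]].
have coverC : cover C = W by rewrite (ucycle_cover _ Gc).
have Ce : e \in cover C by rewrite coverC !inE eqxx !orbT.
have [kab Eab] := edge_index Gab; have [kbc Ebc] := edge_index Gbc.
have [kce Ece] := edge_index Gce; have [kea Eea] := edge_index Gea.
have [/and4P[nab nac nae _] /and3P[nbc nbe _] nce] :
  [/\ [&& a != b, a != c, a != e & true], [&& b != c, b != e & true] & c != e].
  by move: Uc; rewrite /= !inE !negb_or !andbT => /and3P[/and3P[-> -> ->] /andP[-> ->] ->].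
have Gac : G a c = false.
  apply: contraTF Ce => Gac; rewrite (@ucycle_cover [:: a; b; c]) //.
    by rewrite !inE !negb_or !(eq_sym e) nae nbe nce.
  by rewrite /ucycle /= Gab Gbc adj_sym Gac !inE !negb_or nab nac nbc.
have Gbe : G b e = false.
  have : a \in cover C by rewrite coverC !inE eqxx.
  apply: contraTF => Gbe; rewrite (@ucycle_cover [:: b; c; e]) //.
    by rewrite !inE !negb_or nab nac nae.
  by rewrite /ucycle /= Gbc Gce adj_sym Gbe !inE !negb_or nbc nbe nce.
apply: (@filtered_connected W a b) => //.
- by rewrite !inE eqxx.
- by rewrite coverC.
- by exact: cycle_connected.
- by rewrite cardsE (card_uniqP Uc).
apply: (filtered_four_cycle Uc Eab Ebc Ece Eea) => k sk.
have [x [y [Gxy Ek]]] := tnth_edge k.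
move: sk; rewrite Ek subUset !sub1set !inE !tnth_edge_eq => /andP[].
move=> /or4P[]/eqP ex /or4P[]/eqP ey; move: Gxy; rewrite Ek ex ey ?adj_irr ?Gac ?Gbe //;
  rewrite ?(adj_sym G c a) ?(adj_sym G e b) ?Gac ?Gbe // => _;
  rewrite Eab Ebc Ece Eea ?eqxx ?orbT // setUC ?eqxx ?orbT //.
Qed.

End Growth.

(** * Initial ideals and fibres *)

Section LexFibres.

Variables (K : fieldType) (n m : nat) (E : m.-tuple {set 'I_n}).
Implicit Types (a b c : 'X_{1..n + m}).
Local Notation phiE := (phi (K := K) E).

Lemma lex_ltP N (a b : 'X_{1..N}) :
  reflect (exists i : 'I_N, (a i < b i)%N /\ forall j : 'I_N, (j < i)%N -> a j = b j)
    (lex_lt a b).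
Proof.
apply: (iffP existsP) => -[i].
  case/andP=> lt_i /forallP eq_j; exists i; split=> // j lt_ji.
  by apply/eqP; have := eq_j j; rewrite lt_ji.
case=> lt_i eq_j; exists i; rewrite lt_i; apply/forallP=> j.
by apply/implyP => /eq_j ->.
Qed.

Lemma lex_lt_irr N (a : 'X_{1..N}) : ~~ lex_lt a a.
Proof. by apply/lex_ltP => -[i []]; rewrite ltnn. Qed.

Lemma lex_lt_trans N : transitive (@lex_lt N).
Proof.
move=> b a c /lex_ltP[i [lt_i eq_i]] /lex_ltP[j [lt_j eq_j]]; apply/lex_ltP.
have [lt_ij|lt_ji|eq_ij] := ltngtP i j.
- exists i; rewrite -eq_j //; split=> // k lt_k.
  by rewrite eq_i ?eq_j // (ltn_trans lt_k).
- exists j; rewrite eq_i //; split=> // k lt_k.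
  by rewrite -eq_j // eq_i // (ltn_trans lt_k).
have {}eq_ij : i = j by apply: val_inj.
exists i; rewrite eq_ij in eq_i lt_i *; split; first exact: ltn_trans lt_j.
by move=> k lt_k; rewrite eq_i ?eq_j.
Qed.

Lemma lex_lt_total N (a b : 'X_{1..N}) : a != b -> lex_lt a b || lex_lt b a.
Proof.
move=> nab; have /existsP[i0 ni0] : [exists i, a i != b i].
  rewrite -negb_forall; apply: contra nab => /forallP eq_ab.
  by apply/eqP/mnmP => i; apply/eqP.
case: (arg_minnP (P := fun i => a i != b i) (fun i : 'I_N => i : nat) ni0) => i ni mini.
have eq_j (j : 'I_N) : (j < i)%N -> a j = b j.
  by move=> lt_ji; apply/eqP; apply: contraTT lt_ji => /mini; rewrite -leqNgt.
case: (ltngtP (a i) (b i)) ni => // lt_i _; apply/orP; [left|right].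
  by apply/lex_ltP; exists i.
by apply/lex_ltP; exists i; split=> // j /eq_j.
Qed.

Lemma lex_lt_add2l N (a b c : 'X_{1..N}) :
  lex_lt (c + a)%MM (c + b)%MM = lex_lt a b.
Proof.
apply/lex_ltP/lex_ltP => -[i [lt_i eq_i]]; exists i.
  split=> [|j /eq_i]; first by move: lt_i; rewrite !mnmDE ltn_add2l.
  by rewrite !mnmDE => /addnI.
split=> [|j /eq_i]; first by rewrite !mnmDE ltn_add2l.
by rewrite !mnmDE => ->.
Qed.

(** In terms of fibres of [wt]: [a] is not the lexicographically smallest
    monomial with its image under phi. These are the leading monomials of the
    elements of the kernel. *)
Definition nonminimal a : Prop := exists2 b, lex_lt b a & wt E b = wt E a.

Lemma rees_ker_binomial a b : wt E a = wt E b ->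
  rees_ker (K := K) E ('X_[a] - 'X_[b]).
Proof.
move=> eq_ab; have [u [k [_ Dw]]] := phiX_exists K E a.
rewrite /rees_ker phiE_mmap raddfB /= -!phiE_mmap (phiX _ Dw).
by rewrite (phiX _ (etrans (esym eq_ab) Dw)) subrr.
Qed.

(** The terms of [f] in the fibre of its leading monomial cancel under phi,
    so there are at least two of them. *)
Lemma lead_nonminimal f a :
  rees_ker (K := K) E f -> is_lex_lead f a -> nonminimal a.
Proof.
move=> kerf [fa ltfa]; have [u [k [_ Dw]]] := phiX_exists K E a.
have := coef_phi E f u k; rewrite kerf coef0 mcoeff0 => /esym/eqP.
rewrite -big_filter (bigD1_seq a) /=; last 2 first.
- by rewrite mem_filter -Dw eqxx.
- by rewrite filter_uniq ?msupp_uniq.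
rewrite addr_eq0 => /eqP Dfa.
have: (\sum_(b <- [seq b <- msupp f | wt E b == mono_wt u k] | b != a) f@_b) != 0.
  by move: fa; rewrite mcoeff_msupp Dfa oppr_eq0.
case/sum_neq0=> b; rewrite mem_filter => /andP[/eqP wb fb] /andP[nba _].
by exists b; [apply: ltfa | rewrite wb Dw].
Qed.

Lemma binomial_lead a b : lex_lt b a -> is_lex_lead ('X_[a] - 'X_[b] : {mpoly K[n + m]}) a.
Proof.
move=> lt_ba; have nab : a != b.
  by apply: contraTneq lt_ba => ->; apply: lex_lt_irr.
have coefE' c : ('X_[a] - 'X_[b] : {mpoly K[n + m]})@_c = (a == c)%:R - (b == c)%:R.
  by rewrite mcoeffB !mcoeffX.
split=> [|c]; rewrite mcoeff_msupp coefE'.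
  by rewrite eqxx (eq_sym b) (negPf nab) subr0 oner_neq0.
rewrite (eq_sym a) => nz nca; move: nz; rewrite (negPf nca) sub0r oppr_eq0.
by have [<-|_] := eqVneq b c; rewrite // eqxx.
Qed.

Lemma mdeg_wt : (forall k, #|tnth E k| = 2%N) ->
  forall a b, wt E a = wt E b -> mdeg a = mdeg b.
Proof.
by move=> cardE a b eq_ab; apply/eqP; rewrite -eqz_nat -!(wdeg_wt cardE) eq_ab.
Qed.

Definition quadratic_divisors : Prop := forall a, nonminimal a ->
  exists a', [/\ nonminimal a', mdeg a' = 2%N & (a' <= a)%MM].

Lemma mdeg2P N (a : 'X_{1..N}) :
  mdeg a = 2%N -> exists i j, a = (U_(i) + U_(j))%MM.
Proof.
move=> a2; have /existsP[i ai] : [exists i, a i != 0%N].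
  apply: contra_eqT a2; rewrite negb_exists => /forallP a0.
  by rewrite mdegE big1 // => i _; apply/eqP; have := a0 i; rewrite negbK.
have Da : (a - U_(i) + U_(i))%MM = a by apply: submK; rewrite lep1mP.
have : mdeg (a - U_(i))%MM = 1%N.
  by move: a2; rewrite -{1}Da mdegD mdeg1 addn1 => -[].
by move/eqP/mdeg1P=> [j /eqP Dj]; exists j, i; rewrite -Dj Da.
Qed.

Hypothesis E_inj : forall k l, tnth E k = tnth E l -> k = l.

Lemma gen_inj : injective (gen E).
Proof.
move=> i j eq_ij; have eqk := congr1 (functional [::] 1) eq_ij.
have eqa u := congr1 (functional [:: u] 0) eq_ij; move: eqk eqa.
case: (split_ordP i) => [v ->|k ->]; case: (split_ordP j) => [w ->|l ->];
  rewrite ?kdeg_x ?kdeg_y // => _ eqa.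
  by move: (eqa w); rewrite !alpha_x eqxx; case: eqP => // ->.
congr rshift; apply: E_inj; apply/setP=> u; move: (eqa u); rewrite !alpha_y.
by move/oppr_inj => [/eqP]; do 2!case: (u \in _).
Qed.

Hypothesis card_edge : forall k, #|tnth E k| = 2%N.

Lemma nonminimal_mdeg a : nonminimal a -> (1 < mdeg a)%N.
Proof.
move=> [b lt_ba eq_ba]; have deg_ba := mdeg_wt card_edge eq_ba.
rewrite ltnNge; apply/negP; rewrite leq_eqVlt ltnS leqn0 => /orP[a1|a0].
  have := a1; rewrite -deg_ba => /mdeg1P[j /eqP Db].
  case/mdeg1P: a1 => i /eqP Da; move: lt_ba.
  move: eq_ba; rewrite Da Db !wt1 => /gen_inj->.
  by rewrite (negPf (lex_lt_irr _)).
have := a0; rewrite -deg_ba mdeg_eq0 => /eqP Db.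
move: a0 lt_ba; rewrite mdeg_eq0 Db => /eqP->.
by rewrite (negPf (lex_lt_irr _)).
Qed.

(** The kernel of phi is spanned by differences of monomials of the same
    fibre. Its initial ideal is therefore spanned by the nonminimal
    monomials, and quadratic binomials form a Groebner basis if and only if
    the minimal generators of this initial ideal have degree two. Fibres are
    homogeneous and variables have distinct weights, so no nonminimal
    monomial has degree less than two. *)
Lemma quadratic_groebner_basisP :
  has_quadratic_groebner_basis (rees_ker (K := K) E) <-> quadratic_divisors.
Proof.
split=> [[gs [[gsJ inJ] gs2]] a nma|quad].
  have [b lt_ba eq_ba] := nma.
  have : initial_ideal (rees_ker (K := K) E) 'X_[a].
    apply: ideal_gen_mem; exists ('X_[a] - 'X_[b]), a.
    by split=> //; [apply: rees_ker_binomial | apply: binomial_lead].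
  case/inJ=> s [Ps /(congr1 (mcoeff a))]; rewrite mcoeffX eqxx raddf_sum /=.
  move=> s1; have : \sum_(g <- s) (g.1 * g.2)@_a != 0 by rewrite -s1 oner_neq0.
  case/sum_neq0=> g sg /= nz; have [f [a' [gsf lead_f Dg]]] := Ps g sg.
  have nma' := lead_nonminimal (gsJ f gsf) lead_f.
  exists a'; split=> //.
    apply/eqP; rewrite eqn_leq nonminimal_mdeg // andbT -ltnS -(gs2 f gsf).
    by apply: msize_mdeg_lt; case: lead_f.
  apply: contraR nz => nle; rewrite Dg mcoeffM big1 // => -[u v] /= /eqP Du.
  rewrite mcoeffX; case: eqP => [Dv|_]; last by rewrite mulr0.
  by case/negP: nle; rewrite Du -Dv lem_addl.
pose T := ('I_(n + m) * 'I_(n + m) * ('I_(n + m) * 'I_(n + m)))%type.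
pose top (t : T) := (U_(t.1.1) + U_(t.1.2))%MM.
pose bot (t : T) := (U_(t.2.1) + U_(t.2.2))%MM.
pose Q t := lex_lt (bot t) (top t) && (wt E (bot t) == wt E (top t)).
pose gs := [seq 'X_[top t] - 'X_[bot t] : {mpoly K[n + m]} | t <- enum [pred t : T | Q t]].
have gsP g : g \in gs -> exists t, Q t /\ g = 'X_[top t] - 'X_[bot t].
  by case/mapP=> t; rewrite mem_enum => Qt ->; exists t.
have gsJ g : g \in gs -> rees_ker (K := K) E g.
  case/gsP=> t [/andP[_ /eqP eq_t] ->]; exact: rees_ker_binomial.
exists gs; split; last first.
  move=> g /gsP[t [/andP[lt_t _] ->]].
  have [top_t _] := binomial_lead lt_t; apply/eqP; rewrite eqn_leq; apply/andP; split.
    apply: leq_trans (msizeD_le _ _) _; rewrite msizeN !msizeX.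
    by rewrite !mdegD !mdeg1.
  by have := msize_mdeg_lt top_t; rewrite mdegD !mdeg1.
split=> // f; split=> -[s [Ps ->]].
  exists s; split=> // g /Ps[f0 [a [gsf lead_f Dg]]]; exists f0, a.
  by split=> //; apply: gsJ.
rewrite big_seq; elim/big_ind: _ => [||g /Ps[f0 [a [Jf lead_f ->]]]].
- exact: ideal_gen0.
- by move=> ? ?; apply: ideal_genD.
apply: ideal_genMl; have nma := lead_nonminimal Jf lead_f.
have [a' [[b' lt_b' eq_b'] a'2 le_a']] := quad _ nma.
have [i [j Da']] := mdeg2P a'2.
have [k [l Db']] : exists k l, b' = (U_(k) + U_(l))%MM.
  by apply: mdeg2P; rewrite (mdeg_wt card_edge eq_b').
rewrite -(submK le_a') mpolyXD; apply: ideal_genMl; apply: ideal_gen_mem.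
have Qt : Q ((i, j), (k, l)) by rewrite /Q /top /bot /= -Da' -Db' lt_b' eq_b' eqxx.
exists ('X_[a'] - 'X_[b']), a'; split=> //; last exact: binomial_lead.
by rewrite Da' Db'; apply/mapP; exists ((i, j), (k, l)); rewrite // mem_enum.
Qed.

End LexFibres.

(** * Fibres in degree two *)

Section QuadraticFibres.

Variables (n m : nat) (G : sgraph n) (E : m.-tuple {set 'I_n}).
Hypothesis E_uniq : uniq E.
Hypothesis E_edges : E =i edge_set G.
Implicit Types (a b : 'X_{1..n + m}) (u v w : 'I_n) (k l : 'I_m).

Local Notation alpha u := (functional [:: u] 0).
Local Notation kdeg := (functional [::] 1).
Local Notation x v := (lshift m v).
Local Notation y k := (rshift n k).

Let E_inj := tnth_edge_inj E_uniq.
Let card_edge := card_tnth_edge E_edges.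

Lemma alpha_wt u a :
  alpha u (wt E a) = (a (x u))%:Z - \sum_k (u \in tnth E k)%:Z * (a (y k))%:Z.
Proof.
rewrite raddf_sum big_split_ord /=; congr (_ + _).
  rewrite (bigD1 u) //= raddfMn /= alpha_x eqxx natz big1 ?addr0 // => v nvu.
  by rewrite raddfMn /= alpha_x eq_sym (negPf nvu) mul0rn.
rewrite -sumrN; apply: eq_bigr => k _.
by rewrite raddfMn /= alpha_y mulNrn int_mulrn.
Qed.

Lemma kdeg_wt a : kdeg (wt E a) = \sum_k (a (y k))%:Z.
Proof.
rewrite raddf_sum big_split_ord /= big1 ?add0r => [|v _]; last first.
  by rewrite raddfMn /= kdeg_x mul0rn.
by apply: eq_bigr => k _; rewrite raddfMn /= kdeg_y natz.
Qed.

(** The quadratic relation x_v y_vw = x_v' y_v'w attached to two edges with a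
    common end [w]. *)
Lemma exchange_eq v k v' l w :
  tnth E k = [set v; w] -> tnth E l = [set v'; w] -> v != w -> v' != w ->
  gen E (x v) + gen E (y k) = gen E (x v') + gen E (y l).
Proof.
move=> Ek El nvw nv'w; apply: weightP => [u|]; last first.
  by rewrite !raddfD /= !kdeg_x !kdeg_y.
rewrite !raddfD /= !alpha_x !alpha_y Ek El !inE.
have [->|nuw] := eqVneq u w; first by rewrite !orbT !(eq_sym w) (negPf nvw) (negPf nv'w).
by rewrite !orbF !subrr.
Qed.

(** Away from [v] and [w], the two edges have the same vertices. *)
Lemma quadric_xy v k i j : gen E (x v) + gen E (y k) = gen E i + gen E j ->
  exists w l, (U_(i) + U_(j) = U_(x w) + U_(y l))%MM /\
    (w = v /\ l = k \/
     w != v /\ exists q, tnth E k = [set v; q] /\ tnth E l = [set w; q]).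
Proof.
move=> eq_g; suff [w [l [eqU eq_g']]] : exists w l,
    (U_(i) + U_(j) = U_(x w) + U_(y l))%MM /\
    gen E (x v) + gen E (y k) = gen E (x w) + gen E (y l).
  exists w, l; split=> //; have [eq_wv|nwv] := eqVneq w v.
    left; split=> //; move: eq_g'; rewrite eq_wv => /addrI/(gen_inj E_inj).
    by move/rshift_inj.
  right; split=> //; have al u := congr1 (alpha u) eq_g'.
  have {}al u : (u == v)%:Z - (u \in tnth E k)%:Z =
      (u == w)%:Z - (u \in tnth E l)%:Z.
    by have := al u; rewrite !raddfD /= !alpha_x !alpha_y.
  have [vk vl] : v \in tnth E k /\ v \notin tnth E l.
    have := al v; rewrite eqxx eq_sym (negPf nwv).
    by case: (v \in _); case: (v \in _).
  have [wl wk] : w \in tnth E l /\ w \notin tnth E k.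
    have := al w; rewrite eqxx (negPf nwv).
    by case: (w \in _); case: (w \in _).
  have [q Ek] : exists q, tnth E k = [set v; q].
    have [p [q [_ Epq]]] := tnth_edge E_edges k.
    move: vk; rewrite Epq !inE => /orP[]/eqP->; first by exists q.
    by exists p; rewrite setUC.
  have nvq : v != q by have := card_edge k; rewrite Ek cards2; case: eqP.
  exists q; split=> //; apply/setP=> u; rewrite !inE.
  have [->|nuv] := eqVneq u v.
    by rewrite (negPf vl) (eq_sym v w) (negPf nwv) (negPf nvq).
  have := al u; rewrite Ek !inE (negPf nuv) /=.
  have [->|nuw] := eqVneq u w; first by rewrite wl.
  by rewrite /=; case: (u == q); case: (u \in _).
have := congr1 kdeg eq_g; move: eq_g.
case: (split_ordP i) => [w ->|l ->]; case: (split_ordP j) => [w' ->|l' ->];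
  rewrite !raddfD /= ?kdeg_x ?kdeg_y // => eq_g _.
  by exists w, l'.
by exists w', l; rewrite addmC; split=> //; rewrite eq_g addrC.
Qed.

Lemma quadric_xx v w i j : gen E (x v) + gen E (x w) = gen E i + gen E j ->
  (U_(i) + U_(j) = U_(x v) + U_(x w))%MM.
Proof.
move=> eq_g; have := congr1 kdeg eq_g; move: eq_g.
case: (split_ordP i) => [v' ->|l ->]; case: (split_ordP j) => [w' ->|l' ->];
  rewrite !raddfD /= ?kdeg_x ?kdeg_y // => eq_g _.
have al u : ((u == v) + (u == w) = (u == v') + (u == w'))%N.
  have := congr1 (alpha u) eq_g; rewrite !raddfD /= !alpha_x; lia.
apply/mnmP=> t; rewrite !mnmDE !mnm1E; case: (split_ordP t) => [u ->|k ->].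
  rewrite !(inj_eq (@lshift_inj _ _)) !(eq_sym _ u); have := al u; lia.
by rewrite !eq_lrshift.
Qed.

Definition has_four_cycle : Prop := exists c, ucycle G c /\ size c = 4%N.

(** Two pairs of edges covering the same vertices with the same
    multiplicities either coincide or are the two perfect matchings of a
    four-cycle. *)
Lemma quadric_yy k k' i j : gen E (y k) + gen E (y k') = gen E i + gen E j ->
  (U_(i) + U_(j) = U_(y k) + U_(y k'))%MM \/ has_four_cycle.
Proof.
move=> eq_g; have := congr1 kdeg eq_g; move: eq_g.
case: (split_ordP i) => [v' ->|l ->]; case: (split_ordP j) => [w' ->|l' ->];
  rewrite !raddfD /= ?kdeg_x ?kdeg_y // => eq_g _.
have [eq_lk|nlk] := eqVneq l k.
  by left; move: eq_g; rewrite eq_lk => /addrI/(gen_inj E_inj)->.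
have [eq_lk'|nlk'] := eqVneq l k'.
  left; move: eq_g; rewrite eq_lk' [RHS]addrC => /addIr/(gen_inj E_inj)->.
  by rewrite addmC.
right.
have al u : ((u \in tnth E k) + (u \in tnth E k') =
    (u \in tnth E l) + (u \in tnth E l'))%N.
  have := congr1 (alpha u) eq_g; rewrite !raddfD /= !alpha_y.
  by do 4!case: (u \in tnth E _).
have [p [q [Gpq El]]] := tnth_edge E_edges l.
have cov u : u \in tnth E l -> (u \in tnth E k) || (u \in tnth E k').
  by move=> ul; have := al u; rewrite ul; do 2!case: (u \in tnth E _).
(* an edge of the second pair joins the two edges of the first one, and the
   remaining edge joins their other ends *)
have main p' q' r r' : G p' q' -> tnth E l = [set p'; q'] -> p' \in tnth E r ->
    q' \in tnth E r' -> l != r -> l != r' ->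
    (forall u, (u \in tnth E r) + (u \in tnth E r') =
      (u \in tnth E l) + (u \in tnth E l'))%N -> has_four_cycle.
  move=> Gpq' El' p'r q'r' nlr nlr' al'.
  have [s [Er Gps]] : exists s, tnth E r = [set p'; s] /\ G p' s.
    have [z [t [Gzt Ezt]]] := tnth_edge E_edges r.
    move: p'r; rewrite Ezt !inE => /orP[]/eqP->; first by exists t.
    by exists z; rewrite setUC adj_sym.
  have [t [Er' Gqt]] : exists t, tnth E r' = [set q'; t] /\ G q' t.
    have [z [t [Gzt Ezt]]] := tnth_edge E_edges r'.
    move: q'r'; rewrite Ezt !inE => /orP[]/eqP->; first by exists t.
    by exists z; rewrite setUC adj_sym.
  have npq := adj_neq Gpq'; have nps := adj_neq Gps; have nqt := adj_neq Gqt.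
  have npt : p' != t.
    apply: contraNneq nlr' => ept; apply/eqP/E_inj.
    by rewrite El' Er' ept setUC.
  have nqs : q' != s.
    by apply: contraNneq nlr => eqs; apply/eqP/E_inj; rewrite El' Er eqs.
  have sl' : s \in tnth E l'.
    have := al' s; rewrite Er Er' El' !inE eqxx orbT (eq_sym s p') (eq_sym s q').
    by rewrite (negPf nps) (negPf nqs); case: (s \in tnth E l'); case: (s == t).
  have tl' : t \in tnth E l'.
    have := al' t; rewrite Er Er' El' !inE eqxx orbT (eq_sym t p') (eq_sym t q').
    by rewrite (negPf npt) (negPf nqt) orbF; case: (t \in tnth E l'); case: (t == s).
  have nst : s != t.
    apply: contraTneq isT => est; have := al' s; rewrite Er Er' El' -est !inE eqxx.
    rewrite !orbT (eq_sym s p') (eq_sym s q') (negPf nps) (negPf nqs).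
    by case: (s \in _).
  have Gst : G s t.
    have [z [z' [Gz Ez]]] := tnth_edge E_edges l'.
    move: sl' tl'; rewrite Ez !inE => /orP[]/eqP Ds /orP[]/eqP Dt.
    - by rewrite Ds Dt eqxx in nst.
    - by rewrite Ds Dt.
    - by rewrite Ds Dt adj_sym.
    by rewrite Ds Dt eqxx in nst.
  exists [:: p'; s; t; q']; split=> //.
  rewrite /ucycle /= Gps Gst (adj_sym G t) Gqt (adj_sym G q') Gpq'.
  by rewrite !inE !negb_or nps npt npq nst (eq_sym s q') nqs (eq_sym t q') nqt.
have [pl ql] : p \in tnth E l /\ q \in tnth E l by rewrite El !inE !eqxx orbT.
have sub r : p \in tnth E r -> q \in tnth E r -> l = r.
  move=> pr qr; apply: E_inj; apply/eqP; rewrite eqEcard !card_edge leqnn andbT.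
  by rewrite El subUset !sub1set pr qr.
case/orP: (cov p pl) => pk; case/orP: (cov q ql) => qk.
- by rewrite (sub k pk qk) eqxx in nlk.
- exact: (main p q k k').
- by apply: (main p q k' k) => // u; rewrite addnC.
by rewrite (sub k' pk qk) eqxx in nlk'.
Qed.

(** There are only two kinds of quadratic relations: exchanges at a vertex
    and four-cycles. *)
Lemma nonminimal_quadric a : nonminimal E a -> mdeg a = 2%N ->
  (exists v k w l q, [/\ a = (U_(x v) + U_(y k))%MM, w != v,
      tnth E k = [set v; q], tnth E l = [set w; q] &
      lex_lt (U_(x w) + U_(y l))%MM a]) \/
  (exists k k', a = (U_(y k) + U_(y k'))%MM /\ has_four_cycle).
Proof.
move=> [b lt_ba eq_ba] a2; have [i [j Da]] := mdeg2P a2.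
have [i' [j' Db]] : exists i' j', b = (U_(i') + U_(j'))%MM.
  by apply: mdeg2P; rewrite (mdeg_wt card_edge eq_ba).
have eq_g : gen E i + gen E j = gen E i' + gen E j'.
  by move: eq_ba; rewrite Da Db !wtD !wt1.
have irr : a <> b.
  by move=> eq_ab; move: lt_ba; rewrite eq_ab (negPf (lex_lt_irr _)).
have xy_case v k : a = (U_(x v) + U_(y k))%MM ->
    gen E (x v) + gen E (y k) = gen E i' + gen E j' ->
    exists v k w l q, [/\ a = (U_(x v) + U_(y k))%MM, w != v,
      tnth E k = [set v; q], tnth E l = [set w; q] &
      lex_lt (U_(x w) + U_(y l))%MM a].
  move=> Da' /quadric_xy[w [l [eqU []]]].
    by case=> ew el; case: irr; rewrite Da' Db eqU ew el.
  by case=> nwv [q [Ek El]]; exists v, k, w, l, q; rewrite -eqU -Db.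
move: Da eq_g; case: (split_ordP i) => [v ->|k ->];
  case: (split_ordP j) => [v' ->|k' ->] Da eq_g.
- by case: irr; rewrite Da Db (quadric_xx eq_g).
- by left; apply: xy_case eq_g.
- by left; apply: (xy_case v' k); rewrite 1?addmC // addrC.
right; exists k, k'; split=> //.
by have [eqU|//] := quadric_yy eq_g; case: irr; rewrite Da Db eqU.
Qed.

End QuadraticFibres.

(** * Labelled unicyclic graphs *)

Section LabelledCycle.

Variables (n d : nat) (G : sgraph n) (C : {set {set 'I_n}}).
Hypothesis G_unicyclic : unicyclic G C d.
Hypothesis G_labeled : well_labeled G C d.
Implicit Types (u v w : 'I_n) (c : seq 'I_n).

Lemma cycle_eq c : (2 < size c)%N -> ucycle G c -> cycle_edges c = C.
Proof. by move=> szc Gc; case: G_unicyclic => _ uniqC _; apply: uniqC; exists c. Qed.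

Lemma cycle_size c : (2 < size c)%N -> ucycle G c -> size c = d.
Proof.
move=> szc Gc; have /andP[_ Uc] := Gc; case: G_unicyclic => _ _ <-.
by rewrite -(cycle_eq szc Gc) card_cycle_edges.
Qed.

Lemma cycle_labels c v : (2 < size c)%N -> ucycle G c -> (v \in c) = (n - d <= v)%N.
Proof.
move=> szc Gc; case: G_labeled => _ coverC _; move/setP/(_ v): coverC.
by rewrite -(cycle_eq szc Gc) mem_cover_cycle !inE.
Qed.

Lemma the_cycle : exists2 c, (2 < size c)%N & ucycle G c.
Proof. by case: G_unicyclic => -[c [szc Gc _]] _ _; exists c. Qed.

Lemma d_gt2 : (2 < d)%N.
Proof. by have [c szc Gc] := the_cycle; rewrite -(cycle_size szc Gc). Qed.

Lemma d_le_n : (d <= n)%N.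
Proof.
have [c szc Gc] := the_cycle; rewrite -(cycle_size szc Gc).
have /andP[_ /card_uniqP <-] := Gc.
by rewrite -[leqRHS]card_ord max_card.
Qed.

Lemma n_gt0 : (0 < n)%N.
Proof. by have := d_gt2; have := d_le_n; lia. Qed.

(** The vertices of the cycle in the order of their labels. *)
Definition vtx (j : nat) : 'I_n := insubd (Ordinal n_gt0) (n - d + j)%N.

Lemma val_vtx j : (j < d)%N -> vtx j = (n - d + j)%N :> nat.
Proof.
move=> lt_jd; rewrite val_insubd; case: ifP => //.
by have := d_le_n; lia.
Qed.

Lemma vtx_inj i j : (i < d)%N -> (j < d)%N -> vtx i = vtx j -> i = j.
Proof.
by move=> lti ltj /(congr1 val) /=; rewrite !val_vtx //; lia.
Qed.

Lemma vtxP v : (n - d <= v)%N -> exists2 j, (j < d)%N & v = vtx j.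
Proof.
move=> le_v; have := ltn_ord v; have := d_le_n => le_d lt_v.
exists (v - (n - d))%N; first by lia.
by apply: val_inj; rewrite /= val_vtx; lia.
Qed.

Lemma adj_vtxS j : (j.+1 < d)%N -> G (vtx j) (vtx j.+1).
Proof.
by move=> lt_j; case: G_labeled => _ _ adjS; apply: adjS; rewrite !val_vtx; lia.
Qed.

Lemma path_vtx j l : (j + l < d)%N ->
  path G (vtx j) [seq vtx i | i <- iota j.+1 l] /\
  last (vtx j) [seq vtx i | i <- iota j.+1 l] = vtx (j + l).
Proof.
elim: l j => [|l IHl] j lt_jl /=; first by rewrite addn0.
have [|pth lst] := IHl j.+1; first by rewrite addSnnS.
by rewrite lst adj_vtxS ?pth ?addSnnS //; lia.
Qed.

(** A chord, together with the consecutive edges that it spans, is a cycle,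
    hence the whole cycle. *)
Lemma adj_vtx i j : (i < j < d)%N -> G (vtx i) (vtx j) ->
  j = i.+1 \/ i = 0%N /\ j = d.-1.
Proof.
case/andP=> lt_ij lt_jd Gij.
have [->|ne_j] := eqVneq j i.+1; [by left|right].
pose c := vtx i :: [seq vtx k | k <- iota i.+1 (j - i)].
have szc : (2 < size c)%N by rewrite /= size_map size_iota; lia.
have memc k : (k < d)%N -> (vtx k \in c) = (i <= k <= j)%N.
  move=> lt_k; have -> : c = [seq vtx k | k <- iota i (j - i).+1] by [].
  apply/mapP/idP => [[l]|le_k].
    by rewrite mem_iota => ltl /vtx_inj-> //; lia.
  by exists k; rewrite // mem_iota; lia.
have Gc : ucycle G c.
  have [|pth lst] := @path_vtx i (j - i); first by lia.
  apply/andP; split; last first.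
    have -> : c = [seq vtx k | k <- iota i (j - i).+1] by [].
    rewrite map_inj_in_uniq ?iota_uniq // => k l.
    by rewrite !mem_iota => ltk ltl /vtx_inj->; lia.
  by rewrite /= rcons_path pth lst adj_sym subnKC // ltnW.
have le_v k : (k < d)%N -> (n - d <= vtx k)%N by move=> ltk; rewrite val_vtx ?leq_addr.
have c0 : vtx 0 \in c by rewrite (cycle_labels _ szc Gc) le_v //; have := d_gt2; lia.
have cd : vtx d.-1 \in c by rewrite (cycle_labels _ szc Gc) le_v //; have := d_gt2; lia.
by move: c0 cd; rewrite !memc; have := d_gt2; lia.
Qed.

(** One of the two neighbours of the first vertex on the cycle is not the
    second vertex, so it is joined to the first by a nonconsecutive edge. *)
Lemma adj_vtx_closing : G (vtx 0) (vtx d.-1).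
Proof.
have gt2 := d_gt2; have [c szc Gc] := the_cycle; have /andP[cycG Uc] := Gc.
have c0 : vtx 0 \in c.
  by rewrite (cycle_labels _ szc Gc) val_vtx ?leq_addr //; lia.
have Gn := next_cycle cycG c0; have Gp := prev_cycle cycG c0.
suff [w [Gw cw nw]] : exists w, [/\ G (vtx 0) w, w \in c & w != vtx 1].
  have [j lt_j Dw] : exists2 j, (j < d)%N & w = vtx j.
    by apply: vtxP; rewrite -(cycle_labels _ szc Gc).
  have j_gt0 : (0 < j)%N.
    by rewrite lt0n; apply: contraTneq Gw => j0; rewrite Dw j0 adj_irr.
  rewrite Dw in Gw nw.
  have [|j1|[_ <-]] // := adj_vtx _ Gw; first by rewrite j_gt0.
  by rewrite j1 eqxx in nw.
have [en|nn] := eqVneq (next c (vtx 0)) (vtx 1); last first.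
  by exists (next c (vtx 0)); rewrite mem_next.
exists (prev c (vtx 0)); rewrite adj_sym mem_prev; split=> //.
rewrite -en; apply: contraTneq isT => eq_pn.
have := next_next_neq Uc szc c0.
by rewrite -eq_pn next_prev // eqxx.
Qed.

Hypothesis G_connected : nontrivial_components G = 1%N.

Lemma upper_neighbor_unique v u w : (v < n - d)%N -> (v <= u)%N -> (v <= w)%N ->
  G v u -> G v w -> u = w.
Proof.
case: G_labeled => deg1 _ _ lt_v le_u le_w Gu Gw; apply/eqP.
apply: contraTT (deg1 v lt_v) => nuw; rewrite -ltnNge; apply/card_gt1P.
by exists u, w; rewrite !inE le_u le_w.
Qed.

(** A vertex off the cycle has at most one neighbour with a larger label, so
    a path that has gone down once keeps going down. *)
Lemma descending_path p u v : (v < u)%N -> (v < n - d)%N -> G v u ->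
  path G v p -> uniq [:: u, v & p] -> (last v p <= v)%N.
Proof.
elim: p u v => //= w p IHp u v lt_vu lt_v Gvu /andP[Gvw pth].
rewrite inE => /andP[]; rewrite negb_or => /andP[nuv]; rewrite inE negb_or.
case/andP=> nuw _ Up; have lt_wv : (w < v)%N.
  rewrite ltnNge; apply: contra nuw => le_vw; apply/eqP.
  exact: upper_neighbor_unique (ltnW lt_vu) le_vw Gvu Gvw.
apply: leq_trans (ltnW lt_wv); apply: (IHp v w) => //; first exact: ltn_trans lt_v.
by rewrite adj_sym.
Qed.

(** Otherwise all paths leaving [q] would descend and never reach the cycle,
    against connectedness. *)
Lemma another_neighbor v (q : 'I_n) : (v < n - d)%N -> (v < q)%N -> G v q ->
  exists2 r : 'I_n, G q r & (v < r)%N.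
Proof.
move=> lt_v lt_vq Gvq; have gt2 := d_gt2.
have [le_q|lt_q] := leqP (n - d) q.
  have [[|j] lt_j Dq] := vtxP le_q.
    exists (vtx 1); first by rewrite Dq; apply: adj_vtxS; lia.
    by rewrite val_vtx; lia.
  exists (vtx j); first by rewrite Dq adj_sym adj_vtxS.
  by rewrite val_vtx; lia.
have [/existsP[r /andP[Gqr lt_r]]|noR] := boolP [exists r, G q r && (v < r)%N].
  by exists r.
have lowR r : G q r -> (r <= v)%N.
  move=> Gqr; rewrite leqNgt; apply: contra noR => lt_r.
  by apply/existsP; exists r; rewrite Gqr.
have conn : connect G q (vtx 0).
  have := (nontrivial_componentsP adj_vtx_closing).1 G_connected.
  by apply; [rewrite adj_sym; exact: Gvq | exact: adj_vtx_closing].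
have val0 : vtx 0 = (n - d)%N :> nat by rewrite val_vtx ?addn0 //; lia.
case/connectP: conn => p0 pth0 lst0.
case: (shortenP pth0) lst0 => p pth Up _ lst.
case: p pth Up lst => [|w p] /=; first by move=> _ _ eq0; move: val0; rewrite eq0; lia.
case/andP=> Gqw pth Up lst; have le_w := lowR w Gqw.
have : (last w p <= w)%N.
  apply: (@descending_path p q w) => //; first exact: leq_ltn_trans lt_vq.
    exact: leq_ltn_trans lt_v.
  by rewrite adj_sym.
by rewrite -lst; lia.
Qed.

End LabelledCycle.

(** * Necessity of the conditions on the graph *)

Lemma minimal_element (T : finType) (r : rel T) (P : pred T) (x0 : T) :
  irreflexive r -> transitive r -> P x0 ->
  exists x, P x /\ forall y, P y -> ~~ r y x.
Proof.
move=> irr tr Px0; pose below x := #|[set y | P y && r y x]|.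
case: (arg_minnP below Px0) => x Px minx; exists x; split=> // y Py.
apply/negP => ryx; have := minx y Py; rewrite leqNgt => /negP; apply.
apply: proper_card; apply/properP; split.
  apply/subsetP=> z; rewrite !inE => /andP[-> rzy].
  exact: tr ryx.
by exists y; rewrite !inE Py ?ryx ?irr.
Qed.

Section Necessity.

Variables (n m d : nat) (G : sgraph n) (E : m.-tuple {set 'I_n}).
Variable C : {set {set 'I_n}}.
Hypothesis E_uniq : uniq E.
Hypothesis E_edges : E =i edge_set G.
Hypothesis G_unicyclic : unicyclic G C d.
Hypothesis G_labeled : well_labeled G C d.
Hypothesis quad : quadratic_divisors E.
Implicit Types (a b : 'X_{1..n + m}) (u v w : 'I_n) (k l : 'I_m).

Local Notation alpha u := (functional [:: u] 0).
Local Notation kdeg := (functional [::] 1).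
Local Notation x v := (lshift m v).
Local Notation y k := (rshift n k).
Local Notation lt_xw := (@lex_lt (n + m)).

Let nonmin_quadric := nonminimal_quadric E_uniq E_edges.

Lemma nonmin_lex_total a b : a != b -> wt E a = wt E b ->
  nonminimal E a \/ nonminimal E b.
Proof.
move=> nab eq_ab; have /orP[lt_ab|lt_ba] := lex_lt_total nab.
  by right; exists a.
by left; exists b.
Qed.

(** The cubic x_p x_q y_k for the k-th edge {p, q}. All of them have image t
    times the product of all vertices. *)
Definition edge_monomial k : 'X_{1..n + m} :=
  [multinom match split i with
            | inl v => v \in tnth E k : nat
            | inr l => l == k : nat
            end | i < n + m].

Lemma edge_monomial_x k v : edge_monomial k (x v) = (v \in tnth E k).
Proof. by rewrite mnmE (unsplitK (inl v)). Qed.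

Lemma edge_monomial_y k l : edge_monomial k (y l) = (l == k).
Proof. by rewrite mnmE (unsplitK (inr l)). Qed.

Lemma wt_edge_monomial k l : wt E (edge_monomial k) = wt E (edge_monomial l).
Proof.
have wtk k' u : alpha u (wt E (edge_monomial k')) = 0.
  rewrite alpha_wt edge_monomial_x (bigD1 k') //= edge_monomial_y eqxx mulr1.
  rewrite big1 ?addr0 ?subrr // => l' /negPf nl'.
  by rewrite edge_monomial_y nl' mulr0.
have wtd k' : kdeg (wt E (edge_monomial k')) = 1.
  rewrite kdeg_wt (bigD1 k') //= edge_monomial_y eqxx big1 ?addr0 // => l'.
  by rewrite edge_monomial_y => /negPf->.
by apply: weightP => [u|]; rewrite ?wtk ?wtd.
Qed.

Lemma edge_monomialE k v q : tnth E k = [set v; q] -> v != q ->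
  edge_monomial k = (U_(x q) + (U_(x v) + U_(y k)))%MM.
Proof.
move=> Ek nvq; apply/mnmP=> i; rewrite !mnmDE !mnm1E.
case: (split_ordP i) => [u ->|l ->].
  rewrite edge_monomial_x Ek !inE !(inj_eq (@lshift_inj _ _)) eq_rlshift addn0.
  rewrite (eq_sym q) (eq_sym v); have [->|_] := eqVneq u v; last by rewrite addn0.
  by rewrite (negPf nvq).
by rewrite edge_monomial_y !eq_lrshift (inj_eq (@rshift_inj _ _)) eq_sym.
Qed.

Lemma edge_adj k p q : tnth E k = [set p; q] -> G p q.
Proof.
have [u [v [Guv ->]]] := tnth_edge E_edges k.
by case/set2_eq=> -[<- <-] //; rewrite adj_sym.
Qed.

(** Suppose that some edge cannot be reached from [u]. Take the smallest edge
    cubic among the edges that can be reached and the smallest one among the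
    others. The larger of the two is nonminimal. A quadratic nonminimal
    divisor of it is exchanged for a smaller quadric, and this leads to a
    smaller edge cubic whose edge shares a vertex with the old one, hence is
    on the same side: a contradiction. *)
Lemma edges_connected u v u' v' : G u v -> G u' v' -> connect G u u'.
Proof.
move=> Guv Guv'; apply/idPn => nconn.
have [k1 Ek1] := edge_index E_edges Guv; have [k2 Ek2] := edge_index E_edges Guv'.
pose near k := [exists p in tnth E k, connect G u p].
have nearP k p q : tnth E k = [set p; q] -> near k = connect G u p.
  move=> Ek; apply/existsP/idP => [[z]|up]; last first.
    by exists p; rewrite up Ek !inE eqxx.
  rewrite Ek !inE => /andP[/orP[]/eqP-> //] uq.
  apply: connect_trans uq _; apply: connect1.
  by rewrite adj_sym (edge_adj Ek).
pose lt_edge k l := lex_lt (edge_monomial k) (edge_monomial l).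
have irr_edge : irreflexive lt_edge by move=> k; apply/negbTE/lex_lt_irr.
have tr_edge : transitive lt_edge by move=> k l l'; apply: lex_lt_trans.
have near1 : near k1 by rewrite (nearP _ _ _ Ek1) connect0.
have near2 : ~~ near k2 by rewrite (nearP _ _ _ Ek2).
have main k l : near k != near l -> lt_edge l k ->
    (forall k', near k' = near k -> ~~ lt_edge k' k) -> False.
  move=> nkl lt_lk mink.
  have [] := quad (a := edge_monomial k).
    by exists (edge_monomial l) => //; apply: wt_edge_monomial.
  move=> a [nma a2 /mnm_lepP le_a].
  have [[z [k' [w [l' [q [Da nwz Ek' El' lt_a]]]]]]|] := nonmin_quadric nma a2.
    have ek : k' = k.
      apply/eqP; have := le_a (y k'); rewrite edge_monomial_y Da mnmDE !mnm1E eqxx.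
      by rewrite eq_lrshift; case: (k' == k).
    rewrite ek in Ek' Da.
    have nzq := adj_neq (edge_adj Ek'); have nwq := adj_neq (edge_adj El').
    have near_l' : near l' = near k.
      by rewrite (nearP l' q w) ?(nearP k q z) // setUC.
    case/negP: (mink l' near_l').
    rewrite /lt_edge (edge_monomialE El' nwq) (edge_monomialE Ek' nzq).
    by rewrite lex_lt_add2l -Da.
  case=> k' [k'' [Da _]]; have := le_a (y k'); have := le_a (y k'').
  rewrite !edge_monomial_y Da !mnmDE !mnm1E !eqxx !(inj_eq (@rshift_inj _ _)).
  have [->|] := eqVneq k' k; last by [].
  by have [_|_] := eqVneq k'' k.
have [k [near_k mink]] := minimal_element irr_edge tr_edge near1.
have [l [near_l minl]] :=
  minimal_element (P := [pred l | ~~ near l]) irr_edge tr_edge near2.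
rewrite /= in near_l minl.
have nkl : near k != near l by rewrite near_k (negPf near_l).
have neq_kl : edge_monomial k != edge_monomial l.
  apply: contraNneq nkl => /mnmP/(_ (y k)); rewrite !edge_monomial_y eqxx.
  by case: eqP => [->|].
have /orP[lt_kl|lt_lk] := lex_lt_total neq_kl.
  apply: (main l k) lt_kl _; first by rewrite eq_sym.
  by move=> k' nk'; apply: minl; rewrite nk'.
by apply: (main k l) lt_lk _ => // k' nk'; apply: mink; rewrite nk'.
Qed.

Lemma one_component : nontrivial_components G = 1%N.
Proof.
apply/(nontrivial_componentsP (adj_vtx_closing G_unicyclic G_labeled)).
exact: edges_connected.
Qed.

Definition walk (r : nat) (w : nat -> 'I_n) (f : nat -> 'I_m) : Prop :=
  forall i, (i < r)%N -> tnth E (f i) = [set w i; w i.+1].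

(** If [f] lists the edges of a walk, this is one of its two alternating
    products. *)
Definition alternate (f : nat -> 'I_m) (e k : nat) : 'X_{1..n + m} :=
  (\sum_(j < k) U_(y (f (j.*2 + e)%N)))%MM.

Lemma alternateS (f : nat -> 'I_m) (e k : nat) :
  alternate f e k.+1 = (alternate f e k + U_(y (f (k.*2 + e)%N)))%MM.
Proof. by rewrite /alternate big_ord_recr. Qed.

(** Moving the x-variable along the walk two steps at a time. *)
Lemma wt_walk (w : nat -> 'I_n) (f : nat -> 'I_m) (k : nat) : walk k.*2 w f ->
  wt E (U_(x (w 0%N)) + alternate f 0 k)%MM =
  wt E (U_(x (w k.*2)) + alternate f 1 k)%MM.
Proof.
elim: k => [|k IHk] wf; first by rewrite /alternate !big_ord0.
rewrite !alternateS !addmA wtD IHk; last first.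
  by move=> i lt_i; apply: wf; lia.
have E0 : tnth E (f (k.*2 + 0)%N) = [set w k.*2; w k.*2.+1].
  by rewrite addn0; apply: wf; lia.
have E1 : tnth E (f (k.*2 + 1)%N) = [set w k.*2.+1; w k.*2.+2].
  by rewrite addn1; apply: wf; lia.
have n0 := adj_neq (edge_adj E0); have n1 := adj_neq (edge_adj E1).
rewrite !wtD !wt1 doubleS addrAC.
rewrite (exchange_eq E0 (etrans E1 (setUC _ _))) //.
  by rewrite addrAC.
by rewrite eq_sym.
Qed.

Lemma alternate_x (f : nat -> 'I_m) (e k : nat) v : alternate f e k (x v) = 0%N.
Proof. by rewrite mnm_sumE big1 // => j _; rewrite mnm1E eq_rlshift. Qed.

Hypothesis d_ne3 : d <> 3%N.
Hypothesis d_ne4 : d <> 4%N.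

Lemma no_short_cycle c : ucycle G c -> size c = 3%N \/ size c = 4%N -> False.
Proof.
move=> Gc szc; have := cycle_size G_unicyclic _ Gc.
by case: szc => -> /(_ isT) /esym.
Qed.

(** Without four-cycles a quadratic nonminimal monomial involves an
    x-variable. *)
Lemma nonmin_divisor_mixed a : nonminimal E a -> exists v k w l q,
  [/\ w != v, tnth E k = [set v; q], tnth E l = [set w; q],
      lex_lt (U_(x w) + U_(y l))%MM (U_(x v) + U_(y k))%MM & (0 < a (x v))%N].
Proof.
case/quad=> a' [nma' a'2 /mnm_lepP le_a'].
have [[v [k [w [l [q [Da nwv Ek El lt_a]]]]]]|] := nonmin_quadric nma' a'2.
  exists v, k, w, l, q; rewrite -Da; split=> //.
  by have := le_a' (x v); rewrite Da mnmDE !mnm1E eqxx eq_rlshift addn0.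
case=> k [k' [_ [c [Gc szc]]]].
by case: (no_short_cycle Gc); right.
Qed.

Local Notation cvx := (vtx G_unicyclic).

(** The two perfect matchings of the cycle lie in the same fibre, and neither
    involves an x-variable. *)
Lemma even_cycle_false : ~~ odd d -> False.
Proof.
move=> even_d; have gt2 := d_gt2 G_unicyclic.
have Dd : d./2.*2 = d by rewrite even_halfK.
pose w i := cvx (i %% d).
have adj_w i : G (w i) (w i.+1).
  rewrite /w; have lt_i : (i %% d < d)%N by rewrite ltn_mod; lia.
  rewrite -addn1 -modnDml addn1; have [eq_i|ne_i] := eqVneq (i %% d).+1 d.
    rewrite eq_i modnn adj_sym; have -> : (i %% d = d.-1)%N by rewrite -[in RHS]eq_i.
    exact: adj_vtx_closing.
  have lt_i1 : ((i %% d).+1 < d)%N by lia.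
  by rewrite (modn_small lt_i1); apply: adj_vtxS.
have /fin_all_exists[f0 Ef0] (i : 'I_d) :
  exists k, tnth E k = [set w i; w i.+1] by apply: (edge_index E_edges).
have d_gt0 : (0 < d)%N by lia.
pose f i := f0 (insubd (Ordinal d_gt0) i).
have wf : walk d./2.*2 w f.
  by move=> i lt_i; rewrite /f Ef0 val_insubd /= -Dd lt_i.
have := wt_walk wf; rewrite {2}/w Dd modnn /w mod0n !wtD => /addrI eq_wt.
have neq : alternate f 0 d./2 != alternate f 1 d./2.
  have half_gt0 : (0 < d./2)%N by lia.
  apply: contraTneq isT => /mnmP/(_ (y (f 0%N))); rewrite !mnm_sumE.
  rewrite (bigD1 (Ordinal half_gt0)) //= mnm1E eqxx [RHS]big1 // => j _.
  rewrite mnm1E (inj_eq (@rshift_inj _ _)); apply/eqP; rewrite eqb0.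
  apply: contraTneq isT => ef; have lt_j := ltn_ord j.
  have := wf 0%N; rewrite -ef wf; last lia.
  rewrite Dd => /(_ d_gt0)/setP eqE.
  have := eqE (w (j.*2 + 1)%N); have := eqE (w (j.*2 + 1).+1).
  rewrite !inE !eqxx ?orbT /= => /esym h2 /esym h1.
  have inj_w i i' : (i < d)%N -> (i' < d)%N -> (w i == w i') = (i == i').
    move=> lti lti'; apply/eqP/eqP => [|->//].
    rewrite /w !modn_small //; exact: vtx_inj.
  move: h1; rewrite !inj_w //; [|lia|lia|lia].
  have -> : (j.*2 + 1 == 0)%N = false by lia.
  rewrite /= => j0; have {}j0 : (j = 0 :> nat)%N by lia.
  by move: h2; rewrite j0 !inj_w //; lia.
by have [] := nonmin_lex_total neq eq_wt => /nonmin_divisor_mixed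
  [v [k [w' [l [q []]]]]]; rewrite alternate_x.
Qed.

(** The walk runs down the path of consecutive labels from the last vertex
    but one to the first, and then to the last vertex. The only x-variable of
    the larger monomial is that of the last vertex but one. It can only be
    exchanged for the smaller variable of the last vertex, and then both are
    neighbours of a common vertex, which gives a triangle. *)
Lemma odd_cycle_false : odd d -> False.
Proof.
move=> odd_d; have gt2 := d_gt2 G_unicyclic.
have Dd : (d./2.*2 = d.-1)%N by have := odd_double_half d; rewrite odd_d; lia.
have d_ge5 : (4 < d)%N by lia.
pose w i := if (i < d.-1)%N then cvx (d.-2 - i)%N else cvx d.-1.
have adj_w i : (i < d.-1)%N -> G (w i) (w i.+1).
  move=> lt_i; rewrite /w lt_i; have [lt_i1|ge_i1] := ltnP i.+1 d.-1.
    have -> : (d.-2 - i = (d.-2 - i.+1).+1)%N by clear -lt_i1; lia.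
    by rewrite adj_sym; apply: adj_vtxS => //; clear -lt_i1; lia.
  have -> : (d.-2 - i = 0)%N by lia.
  exact: adj_vtx_closing.
have /fin_all_exists[f0 Ef0] (i : 'I_d.-1) :
  exists k, tnth E k = [set w i; w i.+1] by apply: (edge_index E_edges); apply: adj_w.
have d_gt0 : (0 < d.-1)%N by lia.
pose f i := f0 (insubd (Ordinal d_gt0) i).
have wf : walk d./2.*2 w f.
  by move=> i lt_i; rewrite /f Ef0 val_insubd /= -Dd lt_i.
have eq_wt := wt_walk wf.
have w0 : w 0%N = cvx d.-2 by rewrite /w d_gt0 subn0.
have wd : w d./2.*2 = cvx d.-1 by rewrite /w Dd ltnn.
rewrite w0 wd in eq_wt.
have val0 : cvx d.-2 = (n - d + d.-2)%N :> nat by apply: val_vtx; lia.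
have vald : cvx d.-1 = (n - d + d.-1)%N :> nat by apply: val_vtx; lia.
have [|v [k [v' [l [q [nv'v Ek El lt_a av]]]]]] :=
    nonmin_divisor_mixed (a := U_(x (cvx d.-2)) + alternate f 0 d./2)%MM.
  exists (U_(x (cvx d.-1)) + alternate f 1 d./2)%MM => //.
  apply/lex_ltP; exists (x (cvx d.-2)); rewrite !mnmDE !alternate_x !mnm1E eqxx.
  rewrite (inj_eq (@lshift_inj _ _)) -val_eqE /= val0 vald; split; first by lia.
  move=> j; case: (split_ordP j) => [u ->|u ->] /=; last first.
    by have := ltn_ord (cvx d.-2); lia.
  rewrite !mnmDE !alternate_x !mnm1E !(inj_eq (@lshift_inj _ _)) -!val_eqE /=.
  rewrite val0 vald; lia.
have Dv : v = cvx d.-2.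
  move: av; rewrite mnmDE alternate_x mnm1E (inj_eq (@lshift_inj _ _)) addn0.
  by case: eqP.
have lt_vv' : (v < v')%N.
  rewrite ltnNge leq_eqVlt val_eqE (negPf nv'v) /=; apply/negP => lt_v'v.
  case/lex_ltP: lt_a => i [lt_i eq_i].
  have le_vi : (x v <= i)%N.
    case: (split_ordP i) lt_i => [u ->|u -> _] /=; last by have := ltn_ord v; lia.
    rewrite !mnmDE !mnm1E !(inj_eq (@lshift_inj _ _)) !eq_rlshift.
    by have [->|] := eqVneq v u.
  have := eq_i (x v') (leq_trans lt_v'v le_vi).
  rewrite !mnmDE !mnm1E !(inj_eq (@lshift_inj _ _)) !eq_rlshift eqxx.
  by rewrite eq_sym (negPf nv'v).
have Dv' : v' = cvx d.-1.
  apply: val_inj; rewrite /= vald; have := ltn_ord v'.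
  by move: lt_vv'; rewrite Dv val0; have := d_le_n G_unicyclic; lia.
have Gvq := edge_adj Ek; have Gv'q := edge_adj El.
have Gvv' : G v v'.
  have := adj_vtxS G_unicyclic G_labeled (j := d.-2); rewrite Dv Dv'.
  have -> : d.-2.+1 = d.-1 by lia.
  by apply; lia.
apply: (@no_short_cycle [:: v; v'; q]); last by left.
rewrite /ucycle /= Gvv' Gv'q (adj_sym G q) Gvq !inE !negb_or.
by rewrite (adj_neq Gvv') (adj_neq Gvq) (adj_neq Gv'q).
Qed.

Lemma no_long_cycle : False.
Proof.
have [/odd_cycle_false//|/even_cycle_false//] := boolP (odd d).
Qed.

End Necessity.

(** * Minimality of standard monomials *)

(** The first position where [a] and [b] differ is the one where [u] and [v]
    differ. *)
Lemma lex_lt_proportional N (a b u v : 'X_{1..N}) (t : int) :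
  0 < t -> lex_lt v u -> (forall i, (b i)%:Z - (a i)%:Z = t * ((u i)%:Z - (v i)%:Z)) ->
  lex_lt a b.
Proof.
move=> t_gt0 /lex_ltP[i [lt_i eq_i]] eq_ab; apply/lex_ltP; exists i; split.
  by have := eq_ab i; nia.
by move=> j /eq_i eq_j; have := eq_ab j; rewrite eq_j subrr mulr0; lia.
Qed.

Section Sufficiency.

Variables (n m d : nat) (G : sgraph n) (E : m.-tuple {set 'I_n}).
Variable C : {set {set 'I_n}}.
Hypothesis E_uniq : uniq E.
Hypothesis E_edges : E =i edge_set G.
Hypothesis G_unicyclic : unicyclic G C d.
Hypothesis G_labeled : well_labeled G C d.
Hypothesis G_connected : nontrivial_components G = 1%N.
Implicit Types (u v w : 'I_n) (k l : 'I_m).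

Local Notation x v := (lshift m v).
Local Notation y k := (rshift n k).
Local Notation cvx := (vtx G_unicyclic).

Let E_inj := tnth_edge_inj E_uniq.

Variables a b : 'X_{1..n + m}.
Hypothesis lt_ba : lex_lt b a.
Hypothesis eq_ba : wt E b = wt E a.
Hypothesis standard : forall a', nonminimal E a' -> mdeg a' = 2%N ->
  ~ (a' <= a)%MM.

(** Comparing the weights of [a] and [b] expresses the differences of all
    exponents by those of the edge variables. *)
Let diff k : int := (a (y k))%:Z - (b (y k))%:Z.

Lemma x_difference v :
  (a (x v))%:Z - (b (x v))%:Z = \sum_k (v \in tnth E k)%:Z * diff k.
Proof.
have cross (p q r s : int) : p - q = r - s -> r - p = s - q by lia.
have := congr1 (functional [:: v] 0) eq_ba; rewrite !alpha_wt => /cross->.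
by rewrite -sumrB; apply: eq_bigr => k _; rewrite mulrBr.
Qed.

Lemma y_difference : \sum_k diff k = 0.
Proof.
have := congr1 (functional [::] 1) eq_ba; rewrite !kdeg_wt => eq_k.
by rewrite sumrB eq_k subrr.
Qed.

Lemma lex_le_x v : (forall u, (u < v)%N -> a (x u) = b (x u)) -> (b (x v) <= a (x v))%N.
Proof.
move=> eq_u; case/lex_ltP: lt_ba => i [lt_i eq_i].
have [lt_v|le_v] := ltnP (x v) i; first by rewrite eq_i.
case: (split_ordP i) lt_i le_v {eq_i} => [u ->|k ->] lt_i /=; last first.
  by move=> /(leq_trans (leq_addr _ _)); rewrite leqNgt ltn_ord.
rewrite leq_eqVlt => /orP[/eqP/val_inj<-|/eq_u eq_au]; first exact: ltnW.
by rewrite eq_au ltnn in lt_i.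
Qed.

Lemma divides_pair i j : i != j -> (0 < a i)%N -> (0 < a j)%N ->
  (U_(i) + U_(j) <= a)%MM.
Proof.
move=> nij ai aj; apply/mnm_lepP => t; rewrite mnmDE !mnm1E.
have [<-|_] := eqVneq i t; first by rewrite eq_sym (negPf nij).
by have [<-|_] := eqVneq j t.
Qed.

Lemma mdeg_pair N (i j : 'I_N) : mdeg (U_(i) + U_(j))%MM = 2%N.
Proof. by rewrite mdegD !mdeg1. Qed.

(** The divisor x_v y_vq would be nonminimal, because x_w is smaller than
    x_v. *)
Lemma exchange_standard v k w l q : (v < w)%N ->
  tnth E k = [set v; q] -> tnth E l = [set w; q] ->
  a (x v) = 0%N \/ a (y k) = 0%N.
Proof.
move=> lt_vw Ek El; have nvq := adj_neq (edge_adj E_edges Ek).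
have nwq := adj_neq (edge_adj E_edges El).
have nwv : w != v by rewrite -val_eqE /= gtn_eqF.
have [|av_gt0] := posnP (a (x v)); first by left.
have [|ak_gt0] := posnP (a (y k)); first by right.
case: (standard (a' := (U_(x v) + U_(y k))%MM)); last 2 first.
- exact: mdeg_pair.
- by apply: divides_pair; rewrite ?eq_lrshift.
exists (U_(x w) + U_(y l))%MM; last first.
  by rewrite !wtD !wt1 (exchange_eq Ek El nvq nwq).
apply/lex_ltP; exists (x v); rewrite !mnmDE !mnm1E eqxx !eq_rlshift.
rewrite (inj_eq (@lshift_inj _ _)) (negPf nwv); split=> // j /= lt_j.
rewrite !mnmDE !mnm1E; case: (split_ordP j) lt_j => [u ->|l' ->] /= lt_j.
  rewrite !(inj_eq (@lshift_inj _ _)) !eq_rlshift -!val_eqE /= !gtn_eqF //.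
  exact: ltn_trans lt_vw.
by have := ltn_ord v; lia.
Qed.

Definition agree (i : nat) : Prop := forall v, (v < i)%N ->
  a (x v) = b (x v) /\ forall k, v \in tnth E k -> diff k = 0.

(** Let {v, q} be the edge that joins [v] to a larger label. All other edges
    at [v] have been treated, so the exponents of x_v and of y_vq change by
    the same amount between [b] and [a], and x_v does not increase towards
    [b]. Since [q] has another neighbour r > v, the relation x_v y_vq = x_r
    y_qr forbids both variables to divide [a], so neither exponent changes.
    If there is no such edge, the exponent of x_v is determined by the
    weight. *)
Lemma agree_step v : (v < n - d)%N -> agree v -> agree v.+1.
Proof.
move=> lt_v agr; have le_v : (b (x v) <= a (x v))%N.
  by apply: lex_le_x => u /agr[].
have other k : v \in tnth E k -> exists q, tnth E k = [set v; q] /\ G v q.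
  have [p [q [Gpq ->]]] := tnth_edge E_edges k.
  rewrite !inE => /orP[]/eqP->; first by exists q.
  by exists p; rewrite setUC adj_sym.
suff [eq_v eq_k] : a (x v) = b (x v) /\ forall k, v \in tnth E k -> diff k = 0.
  move=> u; rewrite ltnS leq_eqVlt => /orP[/eqP/val_inj->//|]; exact: agr.
have diff0 k q : tnth E k = [set v; q] -> (q < v)%N -> diff k = 0.
  by move=> Ek /agr[_]; apply; rewrite Ek !inE eqxx orbT.
have [/existsP[k0 /existsP[q /andP[/eqP Ek0 lt_vq]]]|no_up] :=
    boolP [exists k, exists q, (tnth E k == [set v; q]) && (v < q)%N]; last first.
  have all0 k : v \in tnth E k -> diff k = 0.
    case/other=> q [Ek Gvq]; apply: (diff0 k q Ek).
    rewrite ltn_neqAle eq_sym val_eqE (adj_neq Gvq) /= leqNgt.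
    apply: contra no_up => lt_vq; apply/existsP; exists k; apply/existsP.
    by exists q; rewrite Ek eqxx.
  split=> //; have := x_difference v; rewrite big1 => [|k _]; first lia.
  by case: (boolP (v \in _)) => [/all0->|_]; rewrite ?mulr0 ?mul0r.
have Gvq := edge_adj E_edges Ek0.
have all0 k : v \in tnth E k -> k != k0 -> diff k = 0.
  case/other=> q' [Ek Gvq'] nk; apply: (diff0 k q' Ek).
  rewrite ltn_neqAle eq_sym val_eqE (adj_neq Gvq') /= leqNgt.
  apply: contra nk => lt_vq'; apply/eqP/E_inj; rewrite Ek Ek0.
  by rewrite (upper_neighbor_unique G_labeled lt_v (ltnW lt_vq') (ltnW lt_vq)).
have Dx : (a (x v))%:Z - (b (x v))%:Z = diff k0.
  rewrite x_difference (bigD1 k0) //= Ek0 !inE eqxx mul1r big1 ?addr0 // => k nk.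
  by case: (boolP (v \in _)) => [/all0->|_]; rewrite ?mulr0 ?mul0r.
have [r Gqr lt_vr] := another_neighbor G_unicyclic G_labeled G_connected lt_v lt_vq Gvq.
have [l El] := edge_index E_edges Gqr; rewrite setUC in El.
have [eq_v diff_k0] : a (x v) = b (x v) /\ diff k0 = 0.
  by rewrite /diff in Dx *; have [az|az] := exchange_standard lt_vr Ek0 El; split; lia.
split=> // k vk; have [->//|nk] := eqVneq k k0; exact: all0.
Qed.

Lemma agree_trees : agree (n - d).
Proof.
suff main i : (i <= n - d)%N -> agree i by apply: main.
elim: i => [|i IHi] lt_i; first by move=> v; rewrite ltn0.
have lt_in : (i < n)%N by apply: leq_trans lt_i (leq_subr _ _).
by apply: (agree_step (v := Ordinal lt_in)) => //; apply/IHi/ltnW.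
Qed.

Lemma vtx_eq i j : (i < d)%N -> (j < d)%N -> (cvx i == cvx j) = (i == j).
Proof. by move=> lti ltj; apply/eqP/eqP => [/vtx_inj|->//]; apply. Qed.

Lemma diff_off_cycle k : diff k = 0 \/ exists i j,
  [/\ (i < j < d)%N, tnth E k = [set cvx i; cvx j] &
      j = i.+1 \/ i = 0%N /\ j = d.-1].
Proof.
have [p [q [Gpq Ek]]] := tnth_edge E_edges k.
have low v : v \in tnth E k -> (v < n - d)%N -> diff k = 0.
  by move=> vk /agree_trees[_]; apply.
have [lt_p|le_p] := ltnP p (n - d).
  by left; apply: (low p); rewrite // Ek !inE eqxx.
have [lt_q|le_q] := ltnP q (n - d).
  by left; apply: (low q); rewrite // Ek !inE eqxx orbT.
have [i lt_i Dp] := vtxP G_unicyclic le_p; have [j lt_j Dq] := vtxP G_unicyclic le_q.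
rewrite Dp Dq in Gpq Ek; right.
have [lt_ij|lt_ji|eq_ij] := ltngtP i j.
- exists i, j; rewrite lt_ij lt_j; split=> //.
  by apply: (adj_vtx G_labeled) Gpq; rewrite lt_ij.
- exists j, i; rewrite lt_ji lt_i setUC; split=> //.
  by apply: (adj_vtx G_labeled (G_unicyclic := G_unicyclic)); rewrite ?lt_ji // adj_sym.
by have := adj_neq Gpq; rewrite eq_ij eqxx.
Qed.

Lemma sum_diff_off (s : seq 'I_m) (c : 'I_m -> int) : uniq s ->
  (forall k, k \notin s -> diff k = 0) ->
  \sum_k c k * diff k = \sum_(k <- s) c k * diff k.
Proof.
move=> Us off; rewrite (bigID (mem s)) /= [X in _ + X]big1 ?addr0.
  by rewrite -big_uniq.
by move=> k /off->; rewrite mulr0.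
Qed.

Lemma lex_contradiction : (forall v, a (x v) = b (x v)) -> (forall k, diff k = 0) -> False.
Proof.
move=> eq_x eq_y; have eq_ab : a = b.
  apply/mnmP => i; case: (split_ordP i) => [v ->|k ->] //.
  by have := eq_y k; rewrite /diff; lia.
by move: lt_ba; rewrite eq_ab (negPf (lex_lt_irr _)).
Qed.

Lemma x_agree : (forall j, (j < d)%N -> a (x (cvx j)) = b (x (cvx j))) ->
  forall v, a (x v) = b (x v).
Proof.
move=> eq_j v; have [lt_v|/(vtxP G_unicyclic)[j lt_j ->]] := ltnP v (n - d).
  by case: (agree_trees lt_v).
exact: eq_j.
Qed.

Lemma lex_le_vtx j : (j < d)%N ->
  (forall i, (i < j)%N -> a (x (cvx i)) = b (x (cvx i))) ->
  (b (x (cvx j)) <= a (x (cvx j)))%N.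
Proof.
move=> lt_j eq_i; apply: lex_le_x => u; rewrite (val_vtx G_unicyclic lt_j) => lt_u.
have [lt_u'|/(vtxP G_unicyclic)[i lt_i Du]] := ltnP u (n - d).
  by case: (agree_trees lt_u').
rewrite Du eq_i //; move: lt_u; rewrite Du (val_vtx G_unicyclic lt_i); lia.
Qed.

Lemma edge_vtx i j : G (cvx i) (cvx j) -> exists k, tnth E k = [set cvx i; cvx j].
Proof. exact: edge_index. Qed.

Lemma tnth_neq k l (p q p' q' : 'I_n) : tnth E k = [set p; q] -> tnth E l = [set p'; q'] ->
  p' != p -> p' != q -> k != l.
Proof.
move=> Ek El np nq; apply: contraTneq isT => ekl.
have : p' \in tnth E k by rewrite ekl El !inE eqxx.
by rewrite Ek !inE (negPf np) (negPf nq).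
Qed.

(** On the three edges of the triangle, the exponent equations together with
    the three exchanges leave no room for a smaller monomial. *)
Lemma three_cycle_false : d = 3%N -> False.
Proof.
move=> d3; have gt2 := d_gt2 G_unicyclic.
have veq i j : (i < 3)%N -> (j < 3)%N -> (cvx i == cvx j) = (i == j).
  by move=> lti ltj; apply: vtx_eq; rewrite d3.
have G01 : G (cvx 0) (cvx 1) by apply: adj_vtxS => //; lia.
have G12 : G (cvx 1) (cvx 2) by apply: adj_vtxS => //; lia.
have G02 : G (cvx 0) (cvx 2).
  by have := adj_vtx_closing G_unicyclic G_labeled; have -> : d.-1 = 2%N by lia.
have [k01 E01] := edge_vtx G01; have [k12 E12] := edge_vtx G12.
have [k02 E02] := edge_vtx G02.
have E10 := etrans E01 (setUC _ _); have E21 := etrans E12 (setUC _ _).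
have E20 := etrans E02 (setUC _ _).
have s1 := exchange_standard _ E01 E21; have s2 := exchange_standard _ E02 E12.
have s3 := exchange_standard _ E10 E20.
have lt_v i j : (i < j < 3)%N -> (cvx i < cvx j)%N.
  by move=> lt_ij; rewrite !val_vtx //; lia.
have {}s1 := s1 (lt_v 0%N 2%N isT); have {}s2 := s2 (lt_v 0%N 1%N isT).
have {}s3 := s3 (lt_v 1%N 2%N isT).
have Us : uniq [:: k01; k12; k02].
  rewrite /= !inE !negb_or !andbT.
  rewrite (tnth_neq E01 E21) ?(tnth_neq E01 E20) ?(tnth_neq E12 E02) ?veq //.
have off k : k \notin [:: k01; k12; k02] -> diff k = 0.
  move=> nk; have [//|[i [j [lt_ij Ek ij]]]] := diff_off_cycle k.
  case/negP: nk; rewrite !inE !(tnth_edge_eq E_uniq) Ek E01 E12 E02.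
  have [[-> ->]|[[-> ->]|[-> ->]]] : (i = 0 /\ j = 1 \/ i = 1 /\ j = 2 \/ i = 0 /\ j = 2)%N
    by clear - d3 lt_ij ij; lia.
  - by rewrite eqxx.
  - by rewrite eqxx orbT.
  by rewrite eqxx !orbT.
have := x_difference (cvx 0); have := x_difference (cvx 1).
have := x_difference (cvx 2); have := y_difference.
under eq_bigr do rewrite -[diff _]mul1r.
rewrite !(sum_diff_off _ Us off) !big_cons !big_nil E01 E12 E02 !inE !veq //=.
have le0 : (b (x (cvx 0)) <= a (x (cvx 0)))%N by apply: lex_le_vtx => //; lia.
have le1 : a (x (cvx 0)) = b (x (cvx 0)) -> (b (x (cvx 1)) <= a (x (cvx 1)))%N.
  by move=> e0; apply: lex_le_vtx => [|[|i]] //; lia.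
have le2 : a (x (cvx 0)) = b (x (cvx 0)) -> a (x (cvx 1)) = b (x (cvx 1)) ->
    (b (x (cvx 2)) <= a (x (cvx 2)))%N.
  by move=> e0 e1; apply: lex_le_vtx => [|[|[|i]]] //; lia.
move: s1 s2 s3 le0 le1 le2; rewrite /diff => s1 s2 s3 le0 le1 le2 h1 h2 h3 h4.
have [e0 [e1 [e2 [f1 [f2 f3]]]]] : a (x (cvx 0)) = b (x (cvx 0)) /\
    a (x (cvx 1)) = b (x (cvx 1)) /\ a (x (cvx 2)) = b (x (cvx 2)) /\
    a (y k01) = b (y k01) /\ a (y k12) = b (y k12) /\ a (y k02) = b (y k02).
  by lia.
apply: lex_contradiction.
  apply: x_agree => j lt_j; have {}lt_j : (j < 3)%N by lia.
  by case: j lt_j => [|[|[|j]]].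
move=> k; have [|/off//] := boolP (k \in [:: k01; k12; k02]).
by rewrite !inE => /or3P[]/eqP->; rewrite /diff ?f1 ?f2 ?f3 subrr.
Qed.

(** The exchanges force the x-exponents to agree, and the edge exponents of
    [a] and [b] then differ by a multiple of the difference of the two
    perfect matchings. The larger matching does not divide [a], so going from
    [a] to [b] trades the smaller matching for the larger one, against the
    choice of [b]. *)
Lemma four_cycle_false : d = 4%N -> False.
Proof.
move=> d4; have gt2 := d_gt2 G_unicyclic.
have [d_gt0 d_gt1] : (0 < d)%N /\ (1 < d)%N by lia.
have veq i j : (i < 4)%N -> (j < 4)%N -> (cvx i == cvx j) = (i == j).
  by move=> lti ltj; apply: vtx_eq; rewrite d4.
have G01 : G (cvx 0) (cvx 1) by apply: adj_vtxS => //; lia.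
have G12 : G (cvx 1) (cvx 2) by apply: adj_vtxS => //; lia.
have G23 : G (cvx 2) (cvx 3) by apply: adj_vtxS => //; lia.
have G03 : G (cvx 0) (cvx 3).
  by have := adj_vtx_closing G_unicyclic G_labeled; have -> : d.-1 = 3%N by lia.
have [k01 E01] := edge_vtx G01; have [k12 E12] := edge_vtx G12.
have [k23 E23] := edge_vtx G23; have [k03 E03] := edge_vtx G03.
have E10 := etrans E01 (setUC _ _); have E21 := etrans E12 (setUC _ _).
have E32 := etrans E23 (setUC _ _); have E30 := etrans E03 (setUC _ _).
have lt_v i j : (i < j < 4)%N -> (cvx i < cvx j)%N.
  by move=> lt_ij; rewrite !val_vtx //; lia.
have s1 := exchange_standard (lt_v 0%N 2%N isT) E01 E21.
have s2 := exchange_standard (lt_v 0%N 2%N isT) E03 E23.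
have s3 := exchange_standard (lt_v 1%N 3%N isT) E10 E30.
have s4 := exchange_standard (lt_v 1%N 3%N isT) E12 E32.
have [n1 n2 n3] : [/\ k01 != k12, k01 != k23 & k01 != k03].
  by split; [apply: (tnth_neq E01 E21)|apply: (tnth_neq E01 E23)|apply: (tnth_neq E01 E30)];
    rewrite veq.
have [n4 n5 n6] : [/\ k12 != k23, k12 != k03 & k23 != k03].
  by split; [apply: (tnth_neq E12 E32)|apply: (tnth_neq E12 E03)|apply: (tnth_neq E23 E03)];
    rewrite veq.
have Us : uniq [:: k01; k12; k23; k03].
  by rewrite /= !inE !negb_or n1 n2 n3 n4 n5 n6.
have off k : k \notin [:: k01; k12; k23; k03] -> diff k = 0.
  move=> nk; have [//|[i [j [lt_ij Ek ij]]]] := diff_off_cycle k.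
  case/negP: nk; rewrite !inE !(tnth_edge_eq E_uniq) Ek E01 E12 E23 E03.
  have [[-> ->]|[[-> ->]|[[-> ->]|[-> ->]]]] : (i = 0 /\ j = 1 \/ i = 1 /\ j = 2 \/
      i = 2 /\ j = 3 \/ i = 0 /\ j = 3)%N by clear - d4 lt_ij ij; lia.
  - by rewrite eqxx.
  - by rewrite eqxx orbT.
  - by rewrite eqxx !orbT.
  by rewrite eqxx !orbT.
have := x_difference (cvx 0); have := x_difference (cvx 1).
have := x_difference (cvx 2); have := x_difference (cvx 3); have := y_difference.
under eq_bigr do rewrite -[diff _]mul1r.
rewrite !(sum_diff_off _ Us off) !big_cons !big_nil E01 E12 E23 E03 !inE !veq //=.
have le0 : (b (x (cvx 0)) <= a (x (cvx 0)))%N by apply: lex_le_vtx.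
have le1 : a (x (cvx 0)) = b (x (cvx 0)) -> (b (x (cvx 1)) <= a (x (cvx 1)))%N.
  by move=> e0; apply: lex_le_vtx => // -[|i].
rewrite /diff => h1 h2 h3 h4 h5.
have [e0 [e1 [e2 e3]]] : a (x (cvx 0)) = b (x (cvx 0)) /\
    a (x (cvx 1)) = b (x (cvx 1)) /\ a (x (cvx 2)) = b (x (cvx 2)) /\
    a (x (cvx 3)) = b (x (cvx 3)).
  by clear - s1 s2 s3 s4 le0 le1 h1 h2 h3 h4 h5; lia.
have eq_x v : a (x v) = b (x v).
  apply: x_agree => j lt_j; have {}lt_j : (j < 4)%N by clear - lt_j d4; lia.
  by case: j lt_j => [|[|[|[|j]]]].
pose t := diff k01.
have [t1 t2 t3] : [/\ diff k23 = t, diff k12 = - t & diff k03 = - t].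
  by clear - e0 e1 e2 e3 h1 h2 h3 h4 h5; rewrite /t /diff; split; lia.
clear s1 s2 s3 s4 le0 le1 h1 h2 h3 h4 h5 e0 e1 e2 e3.
pose u := (U_(y k01) + U_(y k23))%MM; pose v := (U_(y k12) + U_(y k03))%MM.
have eq_uv : wt E u = wt E v.
  rewrite !wtD !wt1; apply: weightP => [w|]; last by rewrite !raddfD /= !kdeg_y.
  rewrite !raddfD /= !alpha_y E01 E12 E23 E03 !inE.
  have [->|n0] := eqVneq w (cvx 0); first by rewrite !veq.
  have [->|n1'] := eqVneq w (cvx 1); first by rewrite !veq.
  have [->|n2'] := eqVneq w (cvx 2); first by rewrite !veq.
  by have [_|_] := eqVneq w (cvx 3).
have nuv : u != v.
  apply: contraTneq isT => /mnmP/(_ (y k01)).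
  rewrite !mnmDE !mnm1E !(inj_eq (@rshift_inj _ _)) eqxx.
  by rewrite (eq_sym k12) (eq_sym k03) (negPf n1) (negPf n3).
have diff_uv i : (a i)%:Z - (b i)%:Z = t * ((u i)%:Z - (v i)%:Z).
  case: (split_ordP i) => [w ->|k ->].
    by rewrite eq_x !mnmDE !mnm1E !eq_rlshift !subrr mulr0.
  rewrite -/(diff k) !mnmDE !mnm1E !(inj_eq (@rshift_inj _ _)).
  have [|/[dup] nk /off->] := boolP (k \in [:: k01; k12; k23; k03]); last first.
    move: nk; rewrite !inE !negb_or => /and4P[m1 m2 m3 m4].
    rewrite !(eq_sym _ k) (negPf m1) (negPf m2) (negPf m3) (negPf m4).
    by rewrite subrr mulr0.
  rewrite !inE => /or4P[]/eqP->; rewrite ?eqxx ?(eq_sym k12 k01) ?(eq_sym k23 k01)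
    ?(eq_sym k03 k01) ?(eq_sym k23 k12) ?(eq_sym k03 k12) ?(eq_sym k03 k23)
    ?(negPf n1) ?(negPf n2) ?(negPf n3) ?(negPf n4) ?(negPf n5) ?(negPf n6)
    ?t1 ?t2 ?t3 ?addn0 ?add0n ?subr0 ?sub0r ?mulrN ?mulr1 //.
have no_ab : ~ lex_lt a b.
  by move=> /(lex_lt_trans lt_ba); rewrite (negPf (lex_lt_irr _)).
have t_neq0 : t <> 0.
  move=> t0; apply: lex_contradiction => // k.
  have [|/off//] := boolP (k \in [:: k01; k12; k23; k03]).
  by rewrite !inE => /or4P[]/eqP->; rewrite ?t1 ?t2 ?t3 -?/t t0 ?oppr0.
have pos_diff k : 0 < diff k -> (0 < a (y k))%N.
  by rewrite /diff subr_gt0 ltz_nat; apply: leq_ltn_trans.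
have /orP[lt_uv|lt_vu] := lex_lt_total nuv.
  have t_gt0 : 0 < t.
    rewrite lt_neqAle eq_sym leNgt; apply/andP; split; first exact/eqP.
    apply/negP => t_lt0; case: (standard (a' := v)).
    - by exists u.
    - exact: mdeg_pair.
    apply: divides_pair; first by rewrite (inj_eq (@rshift_inj _ _)).
      by apply: pos_diff; rewrite t2 oppr_gt0.
    by apply: pos_diff; rewrite t3 oppr_gt0.
  apply: no_ab; apply: (lex_lt_proportional t_gt0 lt_uv) => i.
  by rewrite -[LHS]opprB diff_uv -mulrN opprB.
have t_lt0 : 0 < - t.
  rewrite oppr_gt0 lt_neqAle leNgt; apply/andP; split; first exact/eqP.
  apply/negP => t_gt0; case: (standard (a' := u)).
  - by exists v.
  - exact: mdeg_pair.
  apply: divides_pair; first by rewrite (inj_eq (@rshift_inj _ _)).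
    exact: pos_diff.
  by apply: pos_diff; rewrite t1.
apply: no_ab; apply: (lex_lt_proportional t_lt0 lt_vu) => i.
by rewrite -[LHS]opprB diff_uv mulNr.
Qed.

End Sufficiency.

(** A nonminimal monomial without quadratic nonminimal divisors agrees with a
    smaller one of the same fibre off the cycle, and on a triangle or
    four-cycle this is impossible. *)
Lemma quadratic_divisors_unicyclic n m d (G : sgraph n) (E : m.-tuple {set 'I_n})
    (C : {set {set 'I_n}}) :
  uniq E -> E =i edge_set G -> unicyclic G C d -> well_labeled G C d ->
  nontrivial_components G = 1%N -> d = 3%N \/ d = 4%N -> quadratic_divisors E.
Proof.
move=> E_uniq E_edges G_uni G_lab G_conn d34 a [b lt_ba eq_ba].
apply: NNPP => no_divisor.
have standard a' : nonminimal E a' -> mdeg a' = 2%N -> ~ (a' <= a)%MM.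
  by move=> nma' a'2 le_a'; apply: no_divisor; exists a'.
case: d34.
  exact: (three_cycle_false E_uniq E_edges G_uni G_lab G_conn lt_ba eq_ba standard).
exact: (four_cycle_false E_uniq E_edges G_uni G_lab G_conn lt_ba eq_ba standard).
Qed.

(** * The theorem *)

Local Close Scope ring_scope.

Theorem theorem2p3 (K : fieldType) (n m d : nat) (G : sgraph n)
    (E : m.-tuple {set 'I_n}) (C : {set {set 'I_n}})
    (E_uniq : uniq E) (E_edges : E =i edge_set G)
    (G_unicyclic : unicyclic G C d) :
  (well_labeled G C d ->
     (has_quadratic_groebner_basis (rees_ker (K := K) E)
      <-> nontrivial_components G = 1 /\ (d = 3 \/ d = 4)))
  /\
  (nontrivial_components G = 1 -> d = 3 \/ d = 4 ->
     koszul (rees_comp_edge (K := K) E) (rees_deg (K := K) E)).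
Proof.
have G_cycle := G_unicyclic; case: (G_cycle) => -[c [szc Gc DC]] cycle_unique Cd.
have card_edge := card_tnth_edge E_edges; have E_inj := tnth_edge_inj E_uniq.
split=> [G_labeled|c1 d34].
  rewrite (quadratic_groebner_basisP K E_inj card_edge); split=> [quad|[c1 d34]].
    split; first exact: (one_component E_uniq E_edges G_unicyclic G_labeled quad).
    have [->|/eqP d3] := eqVneq d 3; first by left.
    have [->|/eqP d4] := eqVneq d 4; first by right.
    by case: (no_long_cycle E_uniq E_edges G_unicyclic G_labeled quad d3 d4).
  exact: (quadratic_divisors_unicyclic E_uniq E_edges G_unicyclic G_labeled c1 d34).
apply: (koszul_rees K card_edge).
have sz : size c = d.
  by rewrite -Cd DC card_cycle_edges //; case/andP: Gc.
case: d34 => dE; rewrite dE in sz.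
  case: c sz Gc {szc DC} => [|x [|y [|z [|]]]] //= _ Gc.
  exact: (filtered_three_cycle E_uniq E_edges cycle_unique Gc c1).
case: c sz Gc {szc DC} => [|x [|y [|z [|t [|]]]]] //= _ Gc.
exact: (filtered_four_cycle_graph E_uniq E_edges cycle_unique Gc c1).
Qed.
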